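(* Let $(\phi_t)_{t\ge 0}$ be a non-elliptic semigroup of holomorphic functions in the unit disk $\mathbb{D}$, let $\Delta$ be a petal of $(\phi_t)$, and let $K\subset\Delta$ be compact and non-polar. Then $$\lim_{t\to-\infty}\operatorname{cap}(\mathbb{D},\phi_t(K))=\operatorname{cap}(\Delta,K),$$ where $\operatorname{cap}(D,E)$ denotes the capacity of the condenser $(D,E)$.
   Context: $\mathbb{D}$ is the open unit disk. A (one-parameter) semigroup of holomorphic functions in $\mathbb{D}$ is a family $(\phi_t)_{t\ge0}$ of holomorphic maps $\phi_t:\mathbb{D}\to\mathbb{D}$ such that $\phi_0$ is the identity, $\phi_{t+s}=\phi_t\circ\phi_s$ for all $s,t\ge0$, and $\phi_t(z)\to z$ as $t\to0^+$ uniformly on compact subsets of $\mathbb{D}$. It is called non-elliptic if there is a point $\tau\in\partial\mathbb{D}$ (the Denjoy–Wolff point) with $\lim_{t\to+\infty}\phi_t(z)=\tau$ for every $z\in\mathbb{D}$. A non-elliptic semigroup is called parabolic if the angular derivatives satisfy $\phi_t'(\tau)=1$. Let $d_{\mathbb{D}}(z,w)=\operatorname{arctanh}\left|\frac{z-w}{1-\bar z w}\right|$ be the hyperbolic distance. A backward orbit of $(\phi_t)$ starting at a point $z\in\mathbb{D}$ is a continuous curve $\gamma:[0,+\infty)\to\mathbb{D}$ with $\gamma(0)=z$ and $\phi_s(\gamma(t))=\gamma(t-s)$ for all $t\ge0$, $s\in[0,t]$; it is regular if $\limsup_{t\to+\infty}d_{\mathbb{D}}(\gamma(t),\gamma(t+1))<+\infty$.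 The backward invariant set is $\mathcal{W}=\bigcap_{t\ge0}\phi_t(\mathbb{D})$. A petal $\Delta$ of $(\phi_t)$ is a non-empty simply connected component of the interior of $\mathcal{W}$ such that: (i) $\phi_t(\Delta)=\Delta$ for all $t\ge0$ and $(\phi_t|_{\Delta})$ is a group of automorphisms of $\Delta$; (ii) $\tau\in\partial\Delta$; (iii) there is a point $\sigma\in\partial\mathbb{D}\cap\partial\Delta$ (possibly $\sigma=\tau$) such that for every $z\in\Delta$ the curve $[0,+\infty)\ni t\mapsto(\phi_t|_\Delta)^{-1}(z)$ is a regular backward orbit for $(\phi_t)$ converging to $\sigma$; moreover $\sigma$ is a boundary regular fixed point (a boundary fixed point at which each $\phi_t$ has finite angular derivative), and if $\sigma=\tau$ then the semigroup is parabolic. For $t>0$ and $z\in\Delta$ one writes $\phi_{-t}(z):=(\phi_t|_\Delta)^{-1}(z)$, so $\phi_t$ is defined on $\Delta$ for all $t\in\mathbb{R}$. A compact set is polar if its logarithmic capacity is zero. For a domain $D$ with non-polar boundary, $g_D(z,w)$ denotes its Green function with pole at $w$: positive harmonic on $D\setminus\{w\}$, bounded outside each neighbourhood of $w$, $g_D(z,w)=-\log|z-w|+O(1)$ as $z\to w$ (for finite $w$), and with boundary values $0$ on $\partial D$. For a compact non-polar $E\subset D$, the Green energy is $$V(E,D)=\inf_\mu\iint g_D(x,y)\,d\mu(x)\,d\mu(y),$$ the infimum over Borel probability measures $\mu$ supported in $E$, and the capacity of the condenser $(D,E)$ is $\operatorname{cap}(D,E)=\frac{2\pi}{V(E,D)}$.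 *)

(* Defs.v *)
From HB Require Import structures.
From mathcomp Require Export all_boot all_order all_algebra.
From mathcomp Require Export all_classical all_reals all_analysis.
From mathcomp Require Export complex.

Set Implicit Arguments.
Unset Strict Implicit.
Unset Printing Implicit Defensive.

Import Order.TTheory GRing.Theory Num.Theory.
Import numFieldNormedType.Exports.

Local Open Scope classical_set_scope.
Local Open Scope ring_scope.

(* [R[i]] with the topology of its modulus, as a normed space over itself, so
   that [derivable f z 1] is complex differentiability at [z]. *)
HB.instance Definition _ (R : realType) := NormedModule.copy R[i] R[i]^o.

(* The norm [`|z|] of the library is valued in [R[i]]; [cmod z] is its real
   version. *)
Notation cmod := Normc.normc.

Notation borelC R := (g_sigma_algebraType (@open R[i])).

Section PlaneTopology.
Variable R : realType.
Local Notation C := R[i].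

Definition disk : set C := [set z | cmod z < 1].
Definition circle : set C := [set z | cmod z = 1].

Definition boundary (A : set C) : set C := closure A `\` A°.

Definition simply_connected (U : set C) : Prop :=
  connected U /\
  forall gamma : R -> C,
    {within `[0, 1], continuous gamma} -> gamma @` `[0, 1] `<=` U ->
    gamma 0 = gamma 1 ->
    exists H : R * R -> C,
      [/\ {within `[0, 1] `*` `[0, 1], continuous H},
          H @` (`[0, 1] `*` `[0, 1]) `<=` U,
          forall s : R, 0 <= s <= 1 -> H (s, 0) = gamma s /\ H (s, 1) = gamma 0 &
          forall t : R, 0 <= t <= 1 -> H (0, t) = gamma 0 /\ H (1, t) = gamma 0].

End PlaneTopology.

Section Holomorphic.
Variable R : realType.
Local Notation C := R[i].

(* Only used for open [U]. *)
Definition holomorphic (U : set C) (f : C -> C) : Prop :=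
  forall z, U z -> derivable f z 1.

Definition inv_on (U : set C) (f : C -> C) : C -> C := 'pinv_(fun=> 0) U f.

Definition automorphism (U : set C) (f : C -> C) : Prop :=
  [/\ holomorphic U f, set_bij U U f & holomorphic U (inv_on U f)].

Definition stolz (sigma : C) (M : R) : set C :=
  [set z | disk z /\ cmod (sigma - z) < M * (1 - cmod z)].

Definition angular_limit (f : C -> C) (sigma l : C) : Prop :=
  forall M : R, 1 < M ->
    f z @[z --> within (stolz sigma M) (nbhs sigma)] --> l.

Definition angular_derivative (f : C -> C) (sigma l : C) : Prop :=
  exists2 p : C, angular_limit f sigma p &
    angular_limit (fun z => (f z - p) / (z - sigma)) sigma l.

Definition artanh (x : R) : R := ln ((1 + x) / (1 - x)) / 2.

Definition hyp_dist (z w : C) : R :=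
  artanh (cmod ((z - w) / (1 - conjc z * w))).

End Holomorphic.

Section Semigroup.
Variable R : realType.
Local Notation C := R[i].
(* The values [phi t] for [t < 0] are irrelevant. *)
Variable phi : R -> C -> C.

Definition semigroup : Prop :=
  [/\ forall t : R, 0 <= t -> holomorphic (@disk R) (phi t) /\
        phi t @` @disk R `<=` @disk R,
      forall z, disk z -> phi 0 z = z,
      forall (s t : R) z, 0 <= s -> 0 <= t -> disk z ->
        phi (t + s) z = phi t (phi s z) &
      forall L : set C, compact L -> L `<=` @disk R ->
        {uniform L, phi t @[t --> 0^'+] --> id}].

Definition non_elliptic (tau : C) : Prop :=
  circle tau /\ forall z, disk z -> phi t z @[t --> +oo%R] --> tau.

Definition parabolic (tau : C) : Prop :=
  forall t : R, 0 <= t -> angular_derivative (phi t) tau 1.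

Definition boundary_regular_fixed_point (sigma : C) : Prop :=
  circle sigma /\ forall t : R, 0 <= t ->
    angular_limit (phi t) sigma sigma /\
    exists l, angular_derivative (phi t) sigma l.

Definition backward_orbit (z : C) (gamma : R -> C) : Prop :=
  [/\ {within `[0, +oo[, continuous gamma},
      forall t : R, 0 <= t -> disk (gamma t),
      gamma 0 = z &
      forall t s : R, 0 <= s <= t -> phi s (gamma t) = gamma (t - s)].

Definition regular_orbit (gamma : R -> C) : Prop :=
  (limf_esup (fun t => (hyp_dist (gamma t) (gamma (t + 1)))%:E) +oo%R
     < +oo)%E.

Definition backward_invariant_set : set C :=
  \bigcap_(t in [set t : R | 0 <= t]) (phi t @` @disk R).

Definition flow (Delta : set C) (t : R) : C -> C :=
  if 0 <= t then phi t else inv_on Delta (phi (- t)).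

Definition petal (tau : C) (Delta : set C) : Prop :=
  [/\ (exists2 z, backward_invariant_set° z &
         Delta = connected_component backward_invariant_set° z),
      simply_connected Delta,
      (forall t : R, 0 <= t -> phi t @` Delta = Delta) /\
        (forall t, automorphism Delta (flow Delta t)) /\
        (forall s t z, Delta z ->
           flow Delta (s + t) z = flow Delta s (flow Delta t z)),
      boundary Delta tau &
      exists sigma,
        [/\ circle sigma /\ boundary Delta sigma,
            forall z, Delta z ->
              let gamma := fun t => inv_on Delta (phi t) z in
              [/\ backward_orbit z gamma, regular_orbit gamma &
                  gamma t @[t --> +oo%R] --> sigma],
            boundary_regular_fixed_point sigma &
            sigma = tau -> parabolic tau]].

End Semigroup.

Section Potential.
Variable R : realType.
Local Notation C := R[i].

Definition supported_in (E : set C) : set (probability (borelC R) R) :=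
  [set mu | mu (~` E) = 0%E].

Definition energy (E : set C) (k : C -> C -> \bar R)
    (mu : probability (borelC R) R) : \bar R :=
  (\int[mu]_(y in E) \int[mu]_(x in E) k x y)%E.

Definition min_energy (E : set C) (k : C -> C -> \bar R) : \bar R :=
  ereal_inf [set energy E k mu | mu in supported_in E].

(* [lne 0 = -oo], so the kernel is [+oo] on the diagonal. *)
Definition log_kernel (x y : C) : \bar R := (- lne (cmod (x - y))%:E)%E.

Definition log_capacity (E : set C) : \bar R :=
  expeR (- min_energy E log_kernel).

Definition polar (E : set C) : Prop := log_capacity E = 0%E.

Definition dx (u : C -> R) (z : C) : R :=
  derive1 (fun x : R => u (Complex x (complex.Im z))) (complex.Re z).

Definition dy (u : C -> R) (z : C) : R :=
  derive1 (fun y : R => u (Complex (complex.Re z) y)) (complex.Im z).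

Definition C1_on (U : set C) (u : C -> R) : Prop :=
  forall z, U z ->
    [/\ derivable (fun x : R => u (Complex x (complex.Im z))) (complex.Re z) 1,
        derivable (fun y : R => u (Complex (complex.Re z) y)) (complex.Im z) 1,
        {for z, continuous (dx u)} & {for z, continuous (dy u)}].

(* Only used for open [U]. *)
Definition harmonic_on (U : set C) (u : C -> R) : Prop :=
  [/\ C1_on U u, C1_on U (dx u), C1_on U (dy u) &
      forall z, U z -> dx (dx u) z + dy (dy u) z = 0].

(* Green functions with finite pole of bounded plane domains, so the point at
   infinity plays no role in the boundary condition. *)
Definition is_green (D : set C) (w : C) (g : C -> R) : Prop :=
  [/\ harmonic_on (D `\ w) g /\ (forall z, (D `\ w) z -> 0 < g z),
      (forall U : set C, nbhs w U ->
         exists M : R, forall z, D z -> ~ U z -> `|g z| <= M),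
      (exists M : R, \forall z \near w^', `|g z + ln (cmod (z - w))| <= M) &
      forall zeta, boundary D zeta ->
        g z @[z --> within D (nbhs zeta)] --> (0 : R)].

(* The Green function with pole at [w] is unique on [D `\ w]; on the diagonal
   its value is [+oo]. *)
Definition green (D : set C) (z w : C) : \bar R :=
  if z == w then +oo%E
  else (xget (fun=> 0) [set g | is_green D w g] z)%:E.

Definition green_energy (D E : set C) : \bar R := min_energy E (green D).

Definition condenser_capacity (D E : set C) : \bar R :=
  ((2 * pi)%:E / green_energy D E)%E.

End Potential.

(* Main.v *)
From HB Require Import structures.
Require Import Defs.
From mathcomp Require Import ring lra measurable_realfun.

Set Implicit Arguments.
Unset Strict Implicit.
Unset Printing Implicit Defensive.

Import Order.TTheory GRing.Theory Num.Theory.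
Import numFieldNormedType.Exports.

Local Open Scope classical_set_scope.
Local Open Scope ring_scope.

(** Let [D] be the unit disk, and for [z, w] in [Delta] let [rho_t(z, w)] be the
    pseudo-hyperbolic distance in [D] of the points [phi_{-t}(z)] and
    [phi_{-t}(w)].  Since [phi_{-s}] is [phi_{t-s}] after [phi_{-t}] for
    [s <= t], the Schwarz-Pick lemma makes [rho_t] increase with [t]; call its
    limit [rho_oo].  The Green function of [D] at [phi_{-t}(z), phi_{-t}(w)] is
    [- log rho_t(z, w)], so the theorem follows from two facts: [- log rho_oo]
    is the Green function of [Delta], and minimal energies pass to the limit.

    Green function ([green_petal]).  Along an ultrafilter of times the Moebius
    images of [phi_{-t}] that vanish at [w] converge pointwise to a holomorphic
    function of modulus [rho_oo(., w)] ([limit_map]), which stands in for a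
    Riemann map of [Delta].  Hence [- log rho_oo] is harmonic off [w]; it has a
    logarithmic pole by the Schwarz lemma and is positive because [Delta] is
    connected ([rho_lim_lt1]).  It vanishes on the boundary because a boundary
    point [zeta] of a component of the interior of the backward invariant set is
    not interior to that set: there are points [c] arbitrarily close to [zeta]
    outside some [phi_t(D)], and Harnack's inequality for the positive harmonic
    function [- log |(phi_t - c) / 4|] bounds [1 - rho_oo(z, w)] by a multiple of
    [1 / log (1 / |z - zeta|)] ([rho_lim_boundary]).  Green functions are unique by
    a maximum principle ([green_le]).

    Energies.  The maps [phi_t] and [phi_{-t}] transport probability measures
    between [K] and [phi_{-t}(K)], so the Green energy of [phi_{-t}(K)] in [D] is
    the minimal energy of [K] for the kernel [- log rho_t] ([capacity_lower],
    [capacity_upper]).  On [K] these kernels decrease to [- log rho_oo] and exceed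
    it by a bounded amount, so for each measure of finite energy the energies
    converge by dominated convergence ([energy_cvg]).  The limit is bounded away
    from [0] because [rho_oo] is bounded away from [1] on [K] ([energy_pos]).

    The complex analysis is derived from differentiability alone.  Goursat's
    theorem gives primitives on disks; difference quotients of a primitive have
    two derivatives, so the second derivative test yields the maximum modulus
    principle, first for them and then for their uniform limits.  The maximum
    principle gives the Schwarz lemma, hence Lipschitz bounds, and Lipschitz
    bounds of second differences give a first-order Taylor expansion whose
    remainder depends only on a bound of the function ([taylor1]).  Therefore
    pointwise limits of bounded holomorphic functions are holomorphic, among
    them derivatives and the limit functions above. *)

(** * Complex moduli and complex differentiability *)

Section Modulus.
Variable R : realType.
Local Notation C := R[i].
Implicit Types x y z w : C.
Local Notation Re := complex.Re.
Local Notation Im := complex.Im.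

Lemma cmod0 : cmod (0 : C) = 0. Proof. exact: Normc.normc0. Qed.
Lemma cmod1 : cmod (1 : C) = 1. Proof. exact: Normc.normc1. Qed.
Lemma cmodM x y : cmod (x * y) = cmod x * cmod y.
Proof. exact: Normc.normcM. Qed.
Lemma cmodV x : cmod x^-1 = (cmod x)^-1. Proof. exact: Normc.normcV. Qed.
Lemma cmod_div x y : cmod (x / y) = cmod x / cmod y.
Proof. by rewrite cmodM cmodV. Qed.
Lemma cmodN x : cmod (- x) = cmod x. Proof. exact: normcN. Qed.
Lemma cmodX x n : cmod (x ^+ n) = cmod x ^+ n.
Proof. by elim: n => [|n IH]; rewrite ?expr0 ?cmod1 // !exprS cmodM IH. Qed.
Lemma cmodBC x y : cmod (x - y) = cmod (y - x).
Proof. by rewrite -cmodN opprB. Qed.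
Lemma cmodE x : cmod x = Num.sqrt (Re x ^+ 2 + Im x ^+ 2).
Proof. by case: x. Qed.
Lemma cmod_ge0 x : 0 <= cmod x. Proof. by rewrite cmodE sqrtr_ge0. Qed.
Lemma cmod_sqr x : cmod x ^+ 2 = Re x ^+ 2 + Im x ^+ 2.
Proof. by rewrite cmodE sqr_sqrtr // addr_ge0 ?sqr_ge0. Qed.
Lemma cmod_eq0 x : (cmod x == 0) = (x == 0).
Proof.
by apply/eqP/eqP => [/Normc.eq0_normc|->] //; exact: cmod0.
Qed.
Lemma cmod_gt0 x : (0 < cmod x) = (x != 0).
Proof. by rewrite lt_def cmod_eq0 cmod_ge0 andbT. Qed.
Lemma cmodD x y : cmod (x + y) <= cmod x + cmod y.
Proof. exact: le_normcD. Qed.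
Lemma cmodB x y : cmod (x - y) <= cmod x + cmod y.
Proof. by rewrite -(cmodN y) cmodD. Qed.
Lemma cmod_tri y x z : cmod (x - z) <= cmod (x - y) + cmod (y - z).
Proof. by rewrite -{1}(subrK y x) -addrA cmodD. Qed.
Lemma cmod_le_add x y : cmod x <= cmod y + cmod (x - y).
Proof. by rewrite -{1}(subrK y x) addrC cmodD. Qed.
Lemma Re_le_cmod z : `|Re z| <= cmod z.
Proof.
rewrite cmodE -sqrtr_sqr ler_sqrt ?lerDl ?sqr_ge0 //.
by rewrite addr_ge0 ?sqr_ge0.
Qed.
Lemma Im_le_cmod z : `|Im z| <= cmod z.
Proof.
rewrite cmodE -sqrtr_sqr ler_sqrt ?lerDr ?sqr_ge0 //.
by rewrite addr_ge0 ?sqr_ge0.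
Qed.
Lemma cmod_le_ReIm z : cmod z <= `|Re z| + `|Im z|.
Proof.
rewrite -(@ler_pXn2r _ 2) ?nnegrE ?addr_ge0 ?cmod_ge0 //.
rewrite cmod_sqr sqrrD !real_normK ?num_real // lerD2r lerDl.
by rewrite mulrn_wge0 // mulr_ge0.
Qed.
Lemma cmod_real (r : R) : cmod (r%:C)%C = `|r|.
Proof. by rewrite cmodE /= expr0n addr0 sqrtr_sqr. Qed.
Lemma cmod_conj z : cmod (conjc z) = cmod z.
Proof. by case: z => a b; rewrite !cmodE /= sqrrN. Qed.
Lemma mul_conj z : z * conjc z = ((cmod z ^+ 2)%:C)%C.
Proof.
rewrite cmod_sqr; case: z => a b; apply/eqP; rewrite eq_complex /=.
by apply/andP; split; apply/eqP; ring.
Qed.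

Lemma recD x y : Re (x + y) = Re x + Re y. Proof. by case: x y => ? ? []. Qed.
Lemma imcD x y : Im (x + y) = Im x + Im y. Proof. by case: x y => ? ? []. Qed.
Lemma recN x : Re (- x) = - Re x. Proof. by case: x. Qed.
Lemma imcN x : Im (- x) = - Im x. Proof. by case: x. Qed.
Lemma recB x y : Re (x - y) = Re x - Re y. Proof. by rewrite recD recN. Qed.
Lemma imcB x y : Im (x - y) = Im x - Im y. Proof. by rewrite imcD imcN. Qed.
Lemma recM x y : Re (x * y) = Re x * Re y - Im x * Im y.
Proof. by case: x y => ? ? []. Qed.
Lemma imcM x y : Im (x * y) = Re x * Im y + Im x * Re y.
Proof. by case: x y => a b [c d] /=; rewrite [b * c]mulrC [c * b]mulrC. Qed.
Lemma complex_ext x y : Re x = Re y -> Im x = Im y -> x = y.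
Proof. by case: x y => ? ? [? ?] /= -> ->. Qed.
Lemma Complex_eta z : Complex (Re z) (Im z) = z. Proof. by case: z. Qed.

Lemma cmod_hor (x1 x2 y : R) : cmod (Complex x1 y - Complex x2 y) = `|x1 - x2|.
Proof. by rewrite cmodE recB imcB /= subrr expr0n addr0 sqrtr_sqr. Qed.
Lemma cmod_ver (x y1 y2 : R) : cmod (Complex x y1 - Complex x y2) = `|y1 - y2|.
Proof. by rewrite cmodE recB imcB /= subrr expr0n add0r sqrtr_sqr. Qed.
Lemma cmod_Creal (t : R) : cmod (Complex t 0) = `|t|.
Proof. exact: cmod_real. Qed.
Lemma cmod_ii : cmod (Complex 0 1 : C) = 1.
Proof. by rewrite cmodE /= expr0n expr1n add0r sqrtr1. Qed.
Lemma cmod2 : cmod (2 : C) = 2.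
Proof. by rewrite -(rmorph_nat (real_complex R)) cmod_real ger0_norm. Qed.
Lemma Re_dist z w : `|Re z - Re w| <= cmod (z - w).
Proof. by rewrite -recB Re_le_cmod. Qed.
Lemma Im_dist z w : `|Im z - Im w| <= cmod (z - w).
Proof. by rewrite -imcB Im_le_cmod. Qed.

End Modulus.

Section ComplexDerivative.
Variable R : realType.
Local Notation C := R[i].
Implicit Types (f g : C -> C) (x y z w : C).
Local Notation Re := complex.Re.
Local Notation Im := complex.Im.

Definition cball (a : C) (r : R) : set C := [set z | cmod (z - a) < r].

Lemma cballE a r z : cball a r z = (cmod (z - a) < r) :> Prop.
Proof. by []. Qed.

(** Neighbourhoods in [R[i]] are given by positive complex radii; real radii
    suffice. *)
Lemma nbhsC (z : C) (P : set C) :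
  nbhs z P <-> exists2 r : R, 0 < r & cball z r `<=` P.
Proof.
split=> [/nbhs_ballP [e /= e0 sP]|[r r0 sP]].
  move: e0; case: e sP => er ei sP; rewrite ltcE /= => /andP[/eqP ei0 er0].
  exists er => // w wz; apply: sP; rewrite -ball_normE /ball_ /=.
  by rewrite ltcE /= ei0 eqxx /= -/(cmod (z - w)) cmodBC.
apply/nbhs_ballP; exists (r%:C)%C; first by rewrite /= ltcR.
move=> w; rewrite -ball_normE /ball_ /= ltcE /= => /andP[_ zw].
by apply: sP; rewrite cballE cmodBC.
Qed.

Lemma cballxx a r : 0 < r -> cball a r a.
Proof. by rewrite /cball /= subrr cmod0. Qed.

Lemma cball_nbhs a r z : cball a r z ->
  exists2 e : R, 0 < e & cball z e `<=` cball a r.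
Proof.
rewrite /cball /= => za; exists (r - cmod (z - a)); first by rewrite subr_gt0.
move=> w /= wz; rewrite (le_lt_trans (cmod_tri z _ _)) //.
by rewrite -ltrBrDr.
Qed.

Lemma cball_open a r : open (cball a r).
Proof.
by rewrite openE => z /cball_nbhs [e e0 sub]; apply/nbhsC; exists e.
Qed.

Lemma openCP (U : set C) z : open U -> U z ->
  exists2 r : R, 0 < r & cball z r `<=` U.
Proof. by rewrite openE => oU /oU /nbhsC. Qed.

Lemma openCE (U : set C) : open U <->
  forall z, U z -> exists2 r : R, 0 < r & cball z r `<=` U.
Proof.
split=> [oU z|H]; first exact: openCP.
by rewrite openE => z /H /nbhsC.
Qed.

Lemma continuousCC f z : {for z, continuous f} <->
  forall e : R, 0 < e -> exists2 d : R, 0 < d &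
    forall w, cmod (w - z) < d -> cmod (f w - f z) < e.
Proof.
split=> [cf e e0|H A /nbhsC [e e0 sA]].
  have /nbhsC [d d0 sd] : nbhs z (f @^-1` cball (f z) e).
    by apply: cf; apply/nbhsC; exists e.
  by exists d.
have [d d0 sd] := H e e0; apply/nbhsC; exists d => // w /sd wz.
exact: sA.
Qed.

Lemma continuousCR (f : C -> R) z : {for z, continuous f} <->
  forall e : R, 0 < e -> exists2 d : R, 0 < d &
    forall w, cmod (w - z) < d -> `|f w - f z| < e.
Proof.
split=> [cf e e0|H A /nbhs_ballP [e /= e0 sA]].
  have /nbhsC [d d0 sd] : nbhs z (f @^-1` ball (f z) e).
    by apply: cf; apply/nbhs_ballP; exists e.
  by exists d => // w /sd; rewrite -ball_normE /= distrC.
have [d d0 sd] := H e e0; apply/nbhsC; exists d => // w /sd wz.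
by apply: sA; rewrite -ball_normE /= distrC.
Qed.

(** An explicit error bound in place of a limit of difference quotients: at
    [w = z] nothing is divided, and estimates of moduli apply directly. *)
Definition cdiff f z (l : C) := forall e : R, 0 < e ->
  exists2 d : R, 0 < d & forall w, cmod (w - z) < d ->
    cmod (f w - f z - l * (w - z)) <= e * cmod (w - z).

Definition hol (U : set C) f := forall z, U z -> exists l, cdiff f z l.

Lemma derivable_cdiff f z : derivable f z 1 <-> exists l, cdiff f z l.
Proof.
split=> [/cvg_ex [l cl]|[l cl]].
  exists l => e e0.
  have /nbhsC [d d0 sd] : nbhs (0 : C)
     [set h : C | h != 0 -> cball l e (h^-1 *: (f (h *: 1 + z) - f z))].
    by apply: (cl (cball l e)); apply/nbhsC; exists e.
  exists d => // w wz; have [->|nwz] := eqVneq w z.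
    by rewrite !subrr mulr0 subrr cmod0 mulr0.
  have wz0 : w - z != 0 by rewrite subr_eq0.
  have := sd (w - z); rewrite /cball /= subr0 => /(_ wz wz0).
  have -> : (w - z) *: 1 + z = w by rewrite /GRing.scale /= mulr1 subrK.
  set q := (_ - l); have -> : f w - f z - l * (w - z) = q * (w - z).
    by rewrite /q /GRing.scale /=; field.
  by move=> qe; rewrite cmodM ler_wpM2r ?cmod_ge0 // ltW.
apply/cvg_ex; exists l => A /nbhsC [e e0 sA].
have e20 : 0 < e / 2 by rewrite divr_gt0.
have [d d0 sd] := cl _ e20; apply/nbhsC; exists d => // h.
rewrite /cball /= subr0 => hd h0; apply: sA; rewrite /cball /=.
have := sd (h + z); rewrite addrK => /(_ hd) le.
have -> : h *: 1 + z = h + z by rewrite /GRing.scale /= mulr1.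
set q := (_ - l); have qE : f (h + z) - f z - l * h = q * h.
  by rewrite /q /GRing.scale /=; field.
move: le; rewrite qE cmodM ler_pM2r ?cmod_gt0 // => le.
by rewrite (le_lt_trans le) // ltr_pdivrMr // ltr_pMr // ltr1n.
Qed.

Lemma cdiff_cont f z l : cdiff f z l -> {for z, continuous f}.
Proof.
move=> df; apply/continuousCC => e e0.
have [d d0 sd] := df 1 ltr01.
have L0 : 0 < 1 + cmod l by rewrite ltr_wpDr ?cmod_ge0.
exists (Num.min d (e / (1 + cmod l))); first by rewrite lt_min d0 divr_gt0.
move=> w; rewrite lt_min => /andP[wd we].
have -> : f w - f z = (f w - f z - l * (w - z)) + l * (w - z) by ring.
rewrite (le_lt_trans (cmodD _ _)) //.
rewrite (@le_lt_trans _ _ ((1 + cmod l) * cmod (w - z))) //.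
  by rewrite mulrDl lerD ?sd // cmodM.
by rewrite mulrC -ltr_pdivlMr.
Qed.

Lemma cdiff_lipschitz f z l : cdiff f z l -> exists2 d : R, 0 < d &
  forall w, cmod (w - z) < d -> cmod (f w - f z) <= (1 + cmod l) * cmod (w - z).
Proof.
move=> df; have [d d0 sd] := df 1 ltr01; exists d => // w wd.
have -> : f w - f z = (f w - f z - l * (w - z)) + l * (w - z) by ring.
by rewrite (le_trans (cmodD _ _)) // mulrDl lerD ?sd // cmodM.
Qed.

(** The factor [K] lets the sum, product and chain rules collect the errors of
    their arguments without choosing tolerances in advance. *)
Lemma cdiffW f z l (K : R) : (forall e : R, 0 < e ->
  exists2 d : R, 0 < d & forall w, cmod (w - z) < d ->
    cmod (f w - f z - l * (w - z)) <= K * e * cmod (w - z)) -> cdiff f z l.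
Proof.
move=> H e e0; have K0 : 0 < 1 + `|K| by rewrite ltr_wpDr.
have [d d0 sd] := H (e / (1 + `|K|)) (divr_gt0 e0 K0).
exists d => // w /sd /le_trans; apply; rewrite ler_wpM2r ?cmod_ge0 //.
rewrite mulrA ler_pdivrMr // mulrC ler_wpM2l ?(ltW e0) //.
by rewrite (le_trans (ler_norm _)) // lerDr.
Qed.

Lemma cdiff_quadratic f z l (d K : R) : 0 < d ->
  (forall w, cmod (w - z) < d ->
    cmod (f w - f z - l * (w - z)) <= K * cmod (w - z) ^+ 2) -> cdiff f z l.
Proof.
move=> d0 H; apply: (@cdiffW _ _ _ (`|K|)) => e e0.
exists (Num.min d e); first by rewrite lt_min d0.
move=> w; rewrite lt_min => /andP[wd we]; rewrite (le_trans (H _ wd)) //.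
rewrite expr2 mulrA ler_wpM2r ?cmod_ge0 //.
rewrite (@le_trans _ _ (`|K| * cmod (w - z))) //.
  by rewrite ler_wpM2r ?cmod_ge0 // ler_norm.
by rewrite ler_wpM2l // ltW.
Qed.

Lemma cdiff_near f g z l (r : R) : 0 < r ->
  (forall w, cball z r w -> f w = g w) -> cdiff f z l -> cdiff g z l.
Proof.
move=> r0 fg df e /df [d d0 sd]; exists (Num.min d r); rewrite ?lt_min ?d0 //.
move=> w; rewrite lt_min => /andP[wd wr].
by rewrite -!fg ?sd //; exact: cballxx.
Qed.

Lemma cdiff_cst c z : cdiff (fun=> c) z 0.
Proof.
by move=> e e0; exists 1 => // w _; rewrite mul0r !subrr cmod0 mulr_ge0 ?cmod_ge0 ?ltW.
Qed.

Lemma cdiff_id z : cdiff id z 1.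
Proof.
by move=> e e0; exists 1 => // w _; rewrite mul1r subrr cmod0 mulr_ge0 ?cmod_ge0 ?ltW.
Qed.

Lemma cdiffD f g z l m : cdiff f z l -> cdiff g z m ->
  cdiff (fun w => f w + g w) z (l + m).
Proof.
move=> df dg; apply: (@cdiffW _ _ _ 2) => e e0.
have [d1 d10 s1] := df e e0; have [d2 d20 s2] := dg e e0.
exists (Num.min d1 d2); rewrite ?lt_min ?d10 // => w.
rewrite lt_min => /andP[/s1 le1 /s2 le2].
rewrite [X in cmod X](_ : _ = (f w - f z - l * (w - z)) +
  (g w - g z - m * (w - z))); last by ring.
by rewrite (le_trans (cmodD _ _)) // mulr_natl mulr2n mulrDl lerD.
Qed.

Lemma cdiffZ f z l c : cdiff f z l -> cdiff (fun w => c * f w) z (c * l).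
Proof.
move=> df; apply: (@cdiffW _ _ _ (cmod c)) => e /df [d d0 s1].
exists d => // w /s1 le1.
rewrite [X in cmod X](_ : _ = c * (f w - f z - l * (w - z))); last by ring.
by rewrite cmodM -mulrA ler_wpM2l ?cmod_ge0.
Qed.

Lemma cdiffN f z l : cdiff f z l -> cdiff (fun w => - f w) z (- l).
Proof.
move=> /(@cdiffZ _ _ _ (- 1)); rewrite mulN1r.
by under eq_fun do rewrite mulN1r.
Qed.

Lemma cdiffB f g z l m : cdiff f z l -> cdiff g z m ->
  cdiff (fun w => f w - g w) z (l - m).
Proof. by move=> df /cdiffN; exact: cdiffD. Qed.

Lemma cdiffM f g z l m : cdiff f z l -> cdiff g z m ->
  cdiff (fun w => f w * g w) z (l * g z + f z * m).
Proof.
move=> df dg.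
have [d3 d30 s3] := cdiff_lipschitz dg.
apply: (@cdiffW _ _ _ (cmod (g z) + cmod (f z) + (1 + (1 + cmod l) * (1 + cmod m)))) => e e0.
have [d1 d10 s1] := df e e0; have [d2 d20 s2] := dg e e0.
have [d4 d40 s4] := cdiff_lipschitz df.
exists (Num.min (Num.min d1 d2) (Num.min (Num.min d3 d4) e)).
  by rewrite !lt_min d10 d20 d30 d40.
move=> w; rewrite !lt_min => /andP[/andP[/s1 le1 /s2 le2]].
move=> /andP[/andP[/s3 le3 /s4 le4] lte].
rewrite [X in cmod X](_ : _ = (f w - f z - l * (w - z)) * g z +
  f z * (g w - g z - m * (w - z)) + (f w - f z) * (g w - g z)); last by ring.
have c1 : 0 <= 1 + cmod l by rewrite addr_ge0 ?cmod_ge0.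
have c2 : 0 <= 1 + cmod m by rewrite addr_ge0 ?cmod_ge0.
have b1 : cmod ((f w - f z - l * (w - z)) * g z) <=
    cmod (g z) * e * cmod (w - z).
  by rewrite cmodM mulrC -mulrA ler_wpM2l ?cmod_ge0.
have b2 : cmod (f z * (g w - g z - m * (w - z))) <=
    cmod (f z) * e * cmod (w - z).
  by rewrite cmodM -mulrA ler_wpM2l ?cmod_ge0.
have b3 : cmod ((f w - f z) * (g w - g z)) <=
    (1 + (1 + cmod l) * (1 + cmod m)) * e * cmod (w - z).
  rewrite cmodM (le_trans (ler_pM _ _ le4 le3)) ?cmod_ge0 //.
  rewrite -subr_ge0 [X in 0 <= X](_ : _ = e * cmod (w - z) +
    (1 + cmod l) * (1 + cmod m) * cmod (w - z) * (e - cmod (w - z))); last by ring.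
  by rewrite addr_ge0 // !mulr_ge0 ?cmod_ge0 ?subr_ge0 // ltW.
rewrite (le_trans (cmodD _ _)) //.
rewrite (le_trans (lerD (le_trans (cmodD _ _) (lerD b1 b2)) b3)) //.
by rewrite -!mulrDl.
Qed.

Lemma cdiff_comp f g z l m : cdiff f z l -> cdiff g (f z) m ->
  cdiff (fun w => g (f w)) z (m * l).
Proof.
move=> df dg; have [d3 d30 s3] := cdiff_lipschitz df.
apply: (@cdiffW _ _ _ ((1 + cmod l) + cmod m)) => e e0.
have [d1 d10 s1] := df e e0; have [d2 d20 s2] := dg e e0.
have /continuousCC /(_ _ d20) [d4 d40 s4] := cdiff_cont df.
exists (Num.min (Num.min d1 d3) d4); first by rewrite !lt_min d10 d30.
move=> w; rewrite !lt_min => /andP[/andP[/s1 le1 /s3 le3] /s4 le4].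
rewrite [X in cmod X](_ : _ = (g (f w) - g (f z) - m * (f w - f z)) +
  m * (f w - f z - l * (w - z))); last by ring.
have b1 : cmod (g (f w) - g (f z) - m * (f w - f z)) <=
    (1 + cmod l) * e * cmod (w - z).
  by rewrite (le_trans (s2 _ le4)) // [_ * e]mulrC -mulrA ler_wpM2l // ltW.
have b2 : cmod (m * (f w - f z - l * (w - z))) <= cmod m * e * cmod (w - z).
  by rewrite cmodM -mulrA ler_wpM2l ?cmod_ge0.
by rewrite (le_trans (cmodD _ _)) // (le_trans (lerD b1 b2)) // -!mulrDl.
Qed.

Lemma cdiff_inv z : z != 0 -> cdiff (fun w => w^-1) z (- (z ^+ 2)^-1).
Proof.
move=> z0; have cz0 : 0 < cmod z by rewrite cmod_gt0.
apply: (@cdiff_quadratic _ _ _ (cmod z / 2) (2 / cmod z ^+ 3)).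
  by rewrite divr_gt0.
move=> w wz; have le : cmod z / 2 <= cmod w.
  have := cmod_le_add z w; rewrite cmodBC; lra.
have w0 : w != 0 by rewrite -cmod_gt0 (lt_le_trans _ le) // divr_gt0.
rewrite [X in cmod X](_ : _ = (w - z) ^+ 2 / (z ^+ 2 * w)); last first.
  by field; rewrite z0 w0.
rewrite cmod_div cmodM !cmodX mulrC ler_wpM2r ?exprn_ge0 ?cmod_ge0 //.
have cw0 : 0 < cmod w by rewrite cmod_gt0.
have -> : 2 / cmod z ^+ 3 = (cmod z ^+ 2 * (cmod z / 2))^-1.
  by field; rewrite gt_eqF.
by rewrite lef_pV2 ?posrE ?mulr_gt0 ?exprn_gt0 ?divr_gt0 // ler_wpM2l ?exprn_ge0 ?cmod_ge0.
Qed.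

Lemma cdiffV f z l : f z != 0 -> cdiff f z l ->
  cdiff (fun w => (f w)^-1) z (- l / f z ^+ 2).
Proof.
move=> fz df; have := cdiff_comp df (cdiff_inv fz).
by rewrite mulNr mulrC -mulNr.
Qed.

Lemma cdiff_div f g z l m : g z != 0 -> cdiff f z l -> cdiff g z m ->
  cdiff (fun w => f w / g w) z ((l * g z - f z * m) / g z ^+ 2).
Proof.
move=> gz df /(cdiffV gz) /(cdiffM df).
suff -> : l / g z + f z * (- m / g z ^+ 2) =
  (l * g z - f z * m) / g z ^+ 2 by [].
by field.
Qed.

Lemma cdiffX f z l n : cdiff f z l ->
  cdiff (fun w => f w ^+ n) z (l * f z ^+ n.-1 *+ n).
Proof.
move=> df; elim: n => [|n IH].
  under eq_fun do rewrite expr0; rewrite mulr0n; exact: cdiff_cst.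
under eq_fun do rewrite exprS.
have := cdiffM df IH; congr cdiff.
case: n {IH} => [|n] /=; first by rewrite mulr0n mulr0 addr0.
by rewrite [RHS]mulrS mulrnAr; congr (_ + _ *+ _); rewrite exprS; ring.
Qed.

Lemma cdiff_unique f z l m : cdiff f z l -> cdiff f z m -> l = m.
Proof.
move=> dl dm; apply/eqP; rewrite -subr_eq0 -cmod_eq0; apply/negPn/negP => n0.
have c0 : 0 < cmod (l - m) by rewrite lt_def n0 cmod_ge0.
have e0 : 0 < cmod (l - m) / 3 by rewrite divr_gt0.
have [d1 d10 s1] := dl _ e0; have [d2 d20 s2] := dm _ e0.
pose r := Num.min d1 d2 / 2.
have m0 : 0 < Num.min d1 d2 by rewrite lt_min d10.
have r0 : 0 < r by rewrite divr_gt0.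
have rm : r < Num.min d1 d2 by rewrite /r ltr_pdivrMr // ltr_pMr // ltr1n.
have Er : cmod (z + (r%:C)%C - z) = r.
  by rewrite addrC addKr cmod_real gtr0_norm.
have := s1 (z + (r%:C)%C); have := s2 (z + (r%:C)%C); rewrite Er.
move: rm; rewrite lt_min => /andP[-> ->] /(_ isT) h2 /(_ isT) h1.
have : cmod (l - m) * r <= cmod (l - m) / 3 * r + cmod (l - m) / 3 * r.
  rewrite -[X in _ * X <= _]Er -cmodM; apply: le_trans (lerD h2 h1).
  apply: le_trans (cmodB _ _); rewrite [X in cmod X <= _](_ : _ =
   (f (z + r%:C%C) - f z - m * (z + r%:C%C - z) -
    (f (z + r%:C%C) - f z - l * (z + r%:C%C - z)))) //; ring.
rewrite -mulrDl ler_pM2r //; lra.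
Qed.

End ComplexDerivative.

(** * Derivatives and antiderivatives along lines *)

Section RealVariable.
Variable R : realType.
Local Notation C := R[i].
Local Notation Re := complex.Re.
Local Notation Im := complex.Im.
Implicit Types (g G : R -> R) (x y : R).

Lemma is_derive_eps g x (l : R) : (forall e : R, 0 < e ->
  exists2 d : R, 0 < d & forall y, `|y - x| < d ->
    `|g y - g x - l * (y - x)| <= e * `|y - x|) -> is_derive x 1 g l.
Proof.
move=> H.
have cl : h^-1 *: (g (h *: 1 + x) - g x) @[h --> 0^'] --> l.
  move=> A /nbhs_ballP [e /= e0 sA].
  have e20 : 0 < e / 2 by rewrite divr_gt0.
  have [d d0 sd] := H _ e20; apply/nbhs_ballP; exists d => // h.
  rewrite -ball_normE /= sub0r normrN => hd h0; apply: sA.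
  rewrite -ball_normE /= distrC.
  have := sd (h + x); rewrite addrK => /(_ hd) le.
  have -> : h *: 1 + x = h + x by rewrite /GRing.scale /= mulr1.
  set q := (_ - l); have qE : g (h + x) - g x - l * h = q * h.
    by rewrite /q /GRing.scale /=; field.
  move: le; rewrite qE normrM ler_pM2r ?normr_gt0 // => le.
  by rewrite (le_lt_trans le) // ltr_pdivrMr // ltr_pMr // ltr1n.
apply: DeriveDef; first by apply/cvg_ex; exists l.
by apply/cvg_lim.
Qed.

Lemma between_dist (u v s : R) :
  Num.min u v <= s <= Num.max u v -> `|s - u| <= `|v - u|.
Proof.
rewrite minEle maxEle; case: ifP => [|/negbT]; rewrite -?ltNge => uv /andP[? ?].
  by rewrite !ger0_norm; lra.
by rewrite !ler0_norm; lra.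
Qed.

Lemma mvt_bound G g a b M :
  (forall x, Num.min a b <= x <= Num.max a b -> is_derive x 1 G (g x)) ->
  (forall x, Num.min a b <= x <= Num.max a b -> `|g x| <= M) ->
  `|G b - G a| <= M * `|b - a|.
Proof.
wlog ab : a b / a < b => [wl|] dG bg.
  have [/wl|ba|ab] := ltgtP a b; first exact.
    by rewrite distrC [X in _ * X]distrC; apply: wl => // x; rewrite minC maxC; auto.
  by rewrite ab !subrr !normr0 mulr0.
rewrite (min_idPl (ltW ab)) (max_idPr (ltW ab)) in dG bg.
have dGo x : x \in `]a, b[ -> is_derive x 1 G (g x).
  by rewrite in_itv /= => /andP[ax xb]; apply: dG; rewrite !ltW.
have cG : {within `[a, b], continuous G}.
  apply: derivable_within_continuous => x; rewrite in_itv /= => axb.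
  by have [] := dG x axb.
have [c cab ->] := MVT ab dGo cG.
rewrite normrM ler_wpM2r // bg //.
by move: cab; rewrite in_itv /= => /andP[? ?]; rewrite !ltW.
Qed.

Lemma derive0_cst G a b :
  (forall x, Num.min a b <= x <= Num.max a b -> is_derive x 1 G 0) -> G b = G a.
Proof.
move=> dG; apply/eqP; rewrite -subr_eq0 -normr_le0.
by have := @mvt_bound G (fun=> 0) a b 0 dG; rewrite mul0r; apply=> x; rewrite normr0.
Qed.

Lemma antiderivative_right g (a : R) : continuous g ->
  exists G, forall x, a < x -> is_derive x 1 G (g x).
Proof.
move=> cg; exists (fun x => (\int[lebesgue_measure]_(t in `[a, x]) g t)%R).
move=> x ax; have [//||||dF FE] := @continuous_FTC1 R g (BLeft a) x (x + 1).
- by rewrite ltrDl.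
- apply: continuous_compact_integrable; first exact: segment_compact.
  exact: continuous_subspaceT.
- by rewrite lte_fin.
- exact: cg.
by rewrite derive1E in FE; exact: DeriveDef dF FE.
Qed.

(** Antiderivatives from different base points differ by constants, so they
    glue to one on the whole line. *)
Lemma antiderivative g : continuous g ->
  exists G, forall x, is_derive x 1 G (g x).
Proof.
move=> cg; have /choice[A dA] := fun a : R => antiderivative_right a cg.
pose G x := A (- `|x| - 1) x - A (- `|x| - 1) 0.
have GE (N x : R) : 0 < N -> - N < x -> G x = A (- N) x - A (- N) 0.
  move=> N0 Nx; rewrite /G; set b := - `|x| - 1.
  have bx : b < x by have := ler_norm (- x); rewrite /b normrN; lra.
  have b0 : b < 0 by have := normr_ge0 x; rewrite /b; lra.
  suff : A b x - A (- N) x = A b 0 - A (- N) 0 by lra.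
  apply: (@derive0_cst (fun y => A b y - A (- N) y)) => y /andP[y1 _].
  have by' : b < y by rewrite (lt_le_trans _ y1) // lt_min b0.
  have Ny : - N < y by rewrite (lt_le_trans _ y1) // lt_min Nx andbT; lra.
  by rewrite -(subrr (g y)); apply: is_deriveB; exact: dA.
exists G => x; pose N := `|x| + 1.
have N0 : 0 < N by have := normr_ge0 x; rewrite /N; lra.
have Nx : - N < x by have := ler_norm (- x); rewrite /N normrN; lra.
apply: (@near_eq_is_derive _ _ _ (fun y => A (- N) y - A (- N) 0)).
  near=> y; rewrite (@GE N) //; near: y; exact: lt_nbhsr.
by rewrite -[g x]subr0; apply: is_deriveB; exact: dA.
Unshelve. all: by end_near. Qed.

(** The partial derivatives of the real and imaginary parts are read off the
    complex derivative; that they obey the Cauchy-Riemann equations is what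
    cancels the Laplacian in [max_principle_Re]. *)
Lemma cdiff_Re_dx (f : C -> C) (x0 y0 : R) l : cdiff f (Complex x0 y0) l ->
  is_derive x0 1 (fun x => Re (f (Complex x y0))) (Re l).
Proof.
move=> df; apply: is_derive_eps => e /df [d d0 sd]; exists d => // x xd.
have := sd (Complex x y0); rewrite cmod_hor => /(_ xd).
apply: le_trans; apply: le_trans (Re_le_cmod _).
by rewrite !(recB, recM, imcB) /= subrr mulr0 subr0.
Qed.

Lemma cdiff_Re_dy (f : C -> C) (x0 y0 : R) l : cdiff f (Complex x0 y0) l ->
  is_derive y0 1 (fun y => Re (f (Complex x0 y))) (- Im l).
Proof.
move=> df; apply: is_derive_eps => e /df [d d0 sd]; exists d => // y yd.
have := sd (Complex x0 y); rewrite cmod_ver => /(_ yd).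
apply: le_trans; apply: le_trans (Re_le_cmod _).
by rewrite !(recB, recM, imcB) /= subrr mulr0 sub0r mulNr.
Qed.

End RealVariable.

(** * Goursat's theorem on rectangles *)

Section Goursat.
Variable R : realType.
Local Notation C := R[i].
Local Notation Re := complex.Re.
Local Notation Im := complex.Im.
Local Notation ii := (Complex 0 1 : C).

Definition cantider (G g : R -> C) := forall x : R,
  is_derive x 1 (fun t => Re (G t)) (Re (g x)) /\
  is_derive x 1 (fun t => Im (G t)) (Im (g x)).

Lemma cantider_exists (g : R -> C) :
  continuous (fun t => Re (g t)) -> continuous (fun t => Im (g t)) ->
  exists G, cantider G g.
Proof.
move=> /antiderivative[G1 d1] /antiderivative[G2 d2].
by exists (fun t => Complex (G1 t) (G2 t)) => x; split; [exact: d1|exact: d2].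
Qed.

Lemma cantiderB G1 g1 G2 g2 : cantider G1 g1 -> cantider G2 g2 ->
  cantider (fun t => G1 t - G2 t) (fun t => g1 t - g2 t).
Proof.
move=> d1 d2 x; have [r1 i1] := d1 x; have [r2 i2] := d2 x.
split.
  rewrite recB; under eq_fun do rewrite recB.
  by apply: is_deriveB.
rewrite imcB; under eq_fun do rewrite imcB.
by apply: is_deriveB.
Qed.

Lemma cantider_bound (G g : R -> C) a b M : cantider G g ->
  (forall x, Num.min a b <= x <= Num.max a b -> cmod (g x) <= M) ->
  cmod (G b - G a) <= 2 * M * `|b - a|.
Proof.
move=> dG bg; rewrite (le_trans (cmod_le_ReIm _)) //.
rewrite mulr_natl mulr2n mulrDl recB imcB lerD //.
  apply: (@mvt_bound _ (fun t => Re (G t)) (fun t => Re (g t))) => x /bg.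
    by move=> _; have [] := dG x.
  exact: le_trans (Re_le_cmod _).
apply: (@mvt_bound _ (fun t => Im (G t)) (fun t => Im (g t))) => x /bg.
  by move=> _; have [] := dG x.
exact: le_trans (Im_le_cmod _).
Qed.

Lemma ii_mul (z : C) : ii * z = Complex (- Im z) (Re z).
Proof. by apply: complex_ext; rewrite ?recM ?imcM /=; ring. Qed.

Lemma Nii_mul (z : C) : (- ii) * z = Complex (Im z) (- Re z).
Proof. by rewrite mulNr ii_mul; apply: complex_ext => //=; rewrite opprK. Qed.

Lemma cdiff_Im_dx (f : C -> C) (x0 y0 : R) l : cdiff f (Complex x0 y0) l ->
  is_derive x0 1 (fun x => Im (f (Complex x y0))) (Im l).
Proof.
move=> /(@cdiffZ _ _ _ _ (- ii)) /cdiff_Re_dx; rewrite Nii_mul /=.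
by under eq_fun do rewrite Nii_mul /=.
Qed.

Lemma cdiff_Im_dy (f : C -> C) (x0 y0 : R) l : cdiff f (Complex x0 y0) l ->
  is_derive y0 1 (fun y => Im (f (Complex x0 y))) (Re l).
Proof.
move=> /(@cdiffZ _ _ _ _ (- ii)) /cdiff_Re_dy; rewrite Nii_mul /= opprK.
by under eq_fun do rewrite Nii_mul /=.
Qed.

Lemma cdiff_cantider_x (P p : C -> C) y : (forall z, cdiff P z (p z)) ->
  cantider (fun x => P (Complex x y)) (fun x => p (Complex x y)).
Proof. by move=> dP x; split; [exact: cdiff_Re_dx|exact: cdiff_Im_dx]. Qed.

Lemma cdiff_cantider_y (P p : C -> C) x : (forall z, cdiff P z (p z)) ->
  cantider (fun y => P (Complex x y)) (fun y => ii * p (Complex x y)).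
Proof.
move=> dP y; rewrite ii_mul /=; split; [exact: cdiff_Re_dy|exact: cdiff_Im_dy].
Qed.

(** The integral of [g dz] along the boundary of the rectangle with opposite
    corners [a + ic] and [b + id], where [H] and [V] are antiderivatives of
    [g dz] along the horizontal and the vertical lines; with them the
    additivity under subdivision is an identity between ring expressions. *)
Definition circulation (H V : R -> R -> C) (a b c d : R) : C :=
  (H b c - H a c) + (V b d - V b c) - (H b d - H a d) - (V a d - V a c).

Variables (g : C -> C) (H V : R -> R -> C).
Hypothesis dH : forall y, cantider (fun x => H x y) (fun x => g (Complex x y)).
Hypothesis dV : forall x, cantider (V x) (fun y => ii * g (Complex x y)).

(** An affine function has a quadratic primitive, whose increments around the
    rectangle cancel; only the deviation of [g] from it contributes. *)
Lemma circulation_affine (A B p : C) (a b c d e : R) : a <= b -> c <= d ->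
  (forall x y, a <= x <= b -> c <= y <= d ->
    cmod (g (Complex x y) - (A + B * (Complex x y - p))) <= e) ->
  cmod (circulation H V a b c d) <= 4 * e * ((b - a) + (d - c)).
Proof.
move=> ab cd ge.
pose P z := A * z + (B / 2) * (z - p) ^+ 2.
have dP z : cdiff P z (A + B * (z - p)).
  have -> : A + B * (z - p) =
      A * 1 + B / 2 * ((1 - 0) * (z - p) ^+ 2.-1 *+ 2).
    by rewrite expr1 mulr1 subr0 mul1r -mulr_natr; field.
  apply: cdiffD; apply: cdiffZ; first exact: cdiff_id.
  by apply: cdiffX; apply: cdiffB; [exact: cdiff_id|exact: cdiff_cst].
have hor y : c <= y <= d ->
    cmod ((H b y - P (Complex b y)) - (H a y - P (Complex a y))) <=
    2 * e * (b - a).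
  move=> cyd; rewrite -[X in _ * X]ger0_norm ?subr_ge0 //.
  apply: (cantider_bound (cantiderB (dH y) (cdiff_cantider_x y dP))) => x.
  by rewrite (min_idPl ab) (max_idPr ab) => axb; exact: ge.
have ver x : a <= x <= b ->
    cmod ((V x d - P (Complex x d)) - (V x c - P (Complex x c))) <=
    2 * e * (d - c).
  move=> axb; rewrite -[X in _ * X]ger0_norm ?subr_ge0 //.
  apply: (cantider_bound (cantiderB (dV x) (cdiff_cantider_y x dP))) => y.
  rewrite (min_idPl cd) (max_idPr cd) => cyd.
  by rewrite -mulrBr cmodM cmod_ii mul1r; exact: ge.
rewrite /circulation.
have -> : H b c - H a c + (V b d - V b c) - (H b d - H a d) - (V a d - V a c) =
  ((H b c - P (Complex b c)) - (H a c - P (Complex a c))) +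
  ((V b d - P (Complex b d)) - (V b c - P (Complex b c))) -
  ((H b d - P (Complex b d)) - (H a d - P (Complex a d))) -
  ((V a d - P (Complex a d)) - (V a c - P (Complex a c))) by ring.
have e1 : c <= c <= d by rewrite lexx.
have e2 : c <= d <= d by rewrite lexx andbT.
have e3 : a <= a <= b by rewrite lexx.
have e4 : a <= b <= b by rewrite lexx andbT.
have h := lerD (lerD (lerD (hor c e1) (ver b e4)) (hor d e2)) (ver a e3).
apply: le_trans (le_trans h _); last by rewrite le_eqVlt; apply/orP; left; apply/eqP; ring.
apply: le_trans (cmodB _ _) _; rewrite lerD2r.
apply: le_trans (cmodB _ _) _; rewrite lerD2r.
exact: cmodD.
Qed.

Definition rect := (R * R * R * R)%type.
Definition good_quarter (r s : rect) := let: (a, b, c, d) := r in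
  let: (a', b', c', d') := s in
  [/\ a <= a' /\ b' <= b, c <= c' /\ d' <= d,
      b' - a' = (b - a) / 2, d' - c' = (d - c) / 2 &
      cmod (circulation H V a b c d) / 4 <= cmod (circulation H V a' b' c' d')].

Lemma quarter_exists (r : rect) : exists s : rect,
  let: (a, b, c, d) := r in a <= b -> c <= d -> good_quarter r s.
Proof.
case: r => [[[a b] c] d].
have [/andP[ab cd]|N] := boolP ((a <= b) && (c <= d)); last first.
  by exists (a, b, c, d) => ab cd; rewrite ab cd in N.
pose m := (a + b) / 2; pose n := (c + d) / 2.
have sum : circulation H V a b c d =
    circulation H V a m c n + circulation H V m b c n +
    circulation H V a m n d + circulation H V m b n d.
  by rewrite /circulation; ring.
have [l1|l1] := leP (cmod (circulation H V a b c d) / 4)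
  (cmod (circulation H V a m c n)).
  by exists (a, m, c, n) => _ _; rewrite /good_quarter; split => //;
    rewrite /m /n; lra.
have [l2|l2] := leP (cmod (circulation H V a b c d) / 4)
  (cmod (circulation H V m b c n)).
  by exists (m, b, c, n) => _ _; rewrite /good_quarter; split => //;
    rewrite /m /n; lra.
have [l3|l3] := leP (cmod (circulation H V a b c d) / 4)
  (cmod (circulation H V a m n d)).
  by exists (a, m, n, d) => _ _; rewrite /good_quarter; split => //;
    rewrite /m /n; lra.
have [l4|l4] := leP (cmod (circulation H V a b c d) / 4)
  (cmod (circulation H V m b n d)).
  by exists (m, b, n, d) => _ _; rewrite /good_quarter; split => //;
    rewrite /m /n; lra.
have h1 := cmodD (circulation H V a m c n + circulation H V m b c n +
    circulation H V a m n d) (circulation H V m b n d).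
have h2 := cmodD (circulation H V a m c n + circulation H V m b c n)
    (circulation H V a m n d).
have h3 := cmodD (circulation H V a m c n) (circulation H V m b c n).
by rewrite -sum in h1; exfalso; lra.
Qed.

Lemma nested_point (u v : nat -> R) :
  (forall n, u n <= u n.+1) -> (forall n, v n.+1 <= v n) ->
  (forall n, u n <= v n) -> exists p, forall n, u n <= p <= v n.
Proof.
move=> ui vd uv.
have uh m n : (m <= n)%N -> u m <= u n.
  by move=> mn; rewrite -(subnK mn); elim: (n - m)%N => // k IH; apply: le_trans IH _.
have vh m n : (m <= n)%N -> v n <= v m.
  move=> mn; rewrite -(subnK mn); elim: (n - m)%N => // k; exact: le_trans (vd _).
have uvmn m n : u m <= v n.
  rewrite (le_trans (uh m (maxn m n) (leq_maxl _ _))) //.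
  by rewrite (le_trans (uv _)) // vh // leq_maxr.
exists (sup (range u)) => n; apply/andP; split.
  apply: ub_le_sup; last by exists n.
  by exists (v 0) => _ [k _ <-].
by apply: ge_sup; [exists (u 0); exists 0|move=> _ [k _ <-]].
Qed.

(** Bisection: one of the four quarters of a rectangle carries at least a
    quarter of its circulation.  At the point common to the nested rectangles
    [g] is differentiable, so the circulations are [o(4^-n)]. *)
Lemma goursat (a b c d : R) : a <= b -> c <= d ->
  (forall x y, a <= x <= b -> c <= y <= d ->
     exists l, cdiff g (Complex x y) l) ->
  circulation H V a b c d = 0.
Proof.
move=> ab cd dg; have /choice[q qP] := quarter_exists.
apply/eqP; rewrite -cmod_eq0; apply/negPn/negP => nz.
set K := cmod _ in nz; have K0 : 0 < K by rewrite lt_def nz cmod_ge0.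
pose r n := iter n q (a, b, c, d).
pose ra n := (r n).1.1.1; pose rb n := (r n).1.1.2.
pose rc n := (r n).1.2; pose rd n := (r n).2.
have rE n : r n = (ra n, rb n, rc n, rd n).
  by rewrite /ra /rb /rc /rd; case: (r n) => [[[? ?] ?] ?].
have inv n : [/\ ra n <= rb n, rc n <= rd n & good_quarter (r n) (r n.+1)].
  suff [h1 h2] : ra n <= rb n /\ rc n <= rd n.
    by split=> //; have := qP (r n); rewrite [r n]rE -[r n.+1]/(q (r n)) rE; apply.
  elim: n => [//|n [h1 h2]].
  have := qP (r n); rewrite -[q (r n)]/(r n.+1) [r n]rE [r n.+1]rE.
  by move=> /(_ h1 h2) [_ _ w1 w2 _]; split; lra.
have st n : good_quarter (ra n, rb n, rc n, rd n)
    (ra n.+1, rb n.+1, rc n.+1, rd n.+1).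
  by have [_ _] := inv n; rewrite !rE.
have [px pxP] : exists p, forall n, ra n <= p <= rb n.
  apply: nested_point => n; [by have [[]] := st n|by have [[]] := st n|].
  by have [] := inv n.
have [py pyP] : exists p, forall n, rc n <= p <= rd n.
  apply: nested_point => n; [by have [_ []] := st n|by have [_ []] := st n|].
  by have [] := inv n.
have wx n : rb n - ra n = (b - a) / 2 ^+ n.
  elim: n => [|n IH]; first by rewrite expr0 divr1.
  by have [_ _ -> _ _] := st n; rewrite IH exprS; field; rewrite expf_neq0.
have wy n : rd n - rc n = (d - c) / 2 ^+ n.
  elim: n => [|n IH]; first by rewrite expr0 divr1.
  by have [_ _ _ -> _] := st n; rewrite IH exprS; field; rewrite expf_neq0.
have Kn n : K / 4 ^+ n <= cmod (circulation H V (ra n) (rb n) (rc n) (rd n)).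
  elim: n => [|n IH]; first by rewrite expr0 divr1.
  have [_ _ _ _] := st n; apply: le_trans.
  rewrite exprS invfM mulrCA mulrC ler_wpM2r //.
have [l dl] := dg px py (pxP 0) (pyP 0).
pose s := (b - a) + (d - c).
have s0 : 0 <= s by rewrite /s; lra.
(* The circulation of the n-th rectangle is at most [4 e s^2 / 4^n], and this
   [e] makes the bound smaller than [K / 4^n]. *)
pose e := K / (8 * (s ^+ 2 + 1)).
have s21 : 0 < s ^+ 2 + 1 by rewrite ltr_wpDl ?sqr_ge0.
have e0 : 0 < e by rewrite divr_gt0 // mulr_gt0.
have [dd dd0 sd] := dl e e0.
have [n nP] : exists n, s / 2 ^+ n < dd.
  exists (Num.truncn (s / dd)).+1; rewrite ltr_pdivrMr ?exprn_gt0 //.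
  rewrite mulrC -ltr_pdivrMr //.
  apply: lt_le_trans (truncnS_gt _) _; rewrite -natrX ler_nat.
  by apply: ltnW; exact: ltn_expl.
have [rab rcd _] := inv n.
have bnd x y : ra n <= x <= rb n -> rc n <= y <= rd n ->
    cmod (g (Complex x y) - (g (Complex px py) +
      l * (Complex x y - Complex px py))) <= e * (s / 2 ^+ n).
  move=> xP yP.
  have dz : cmod (Complex x y - Complex px py) <= s / 2 ^+ n.
    rewrite (le_trans (cmod_le_ReIm _)) // recB imcB /=.
    rewrite /s mulrDl -wx -wy; have := pxP n; have := pyP n.
    move: xP yP => /andP[? ?] /andP[? ?] /andP[? ?] /andP[? ?].
    by rewrite lerD // ler_norml; apply/andP; split; lra.
  rewrite opprD addrA; apply: le_trans (sd _ (le_lt_trans dz nP)) _.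
  by rewrite ler_wpM2l // ltW.
have := le_trans (Kn n) (circulation_affine rab rcd bnd).
rewrite wx wy -mulrDl -/s.
have -> : 4 * (e * (s / 2 ^+ n)) * (s / 2 ^+ n) = (4 * e * s ^+ 2) / 4 ^+ n.
  rewrite (_ : 4 ^+ n = 2 ^+ n * 2 ^+ n :> R); first by field; rewrite expf_neq0.
  by rewrite -exprMn; congr (_ ^+ _); ring.
rewrite ler_pM2r ?invr_gt0 ?exprn_gt0 // => le.
have : K * (8 * (s ^+ 2 + 1)) <= 4 * K * s ^+ 2.
  rewrite -ler_pdivlMr ?mulr_gt0 //; apply: le_trans le _.
  by rewrite /e le_eqVlt; apply/orP; left; apply/eqP; field; rewrite gt_eqF.
have := mulr_ge0 (ltW K0) (sqr_ge0 s); lra.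
Qed.

End Goursat.

(** * Primitives on disks *)

Section Primitive.
Variable R : realType.
Local Notation C := R[i].
Local Notation Re := complex.Re.
Local Notation Im := complex.Im.
Local Notation ii := (Complex 0 1 : C).

(** Composition with the radial retraction onto a closed disk extends a function
    continuously to the plane, so that it has antiderivatives along entire
    lines. *)
Definition retract (a : C) (r : R) (z : C) : C :=
  a + (z - a) * ((r / Num.max r (cmod (z - a)))%:C)%C.

Lemma retract_in (a : C) r z : 0 < r -> cmod (retract a r z - a) <= r.
Proof.
move=> r0; rewrite /retract addrC addKr cmodM cmod_real.
have m0 : 0 < Num.max r (cmod (z - a)) by rewrite lt_max r0.
rewrite ger0_norm ?divr_ge0 ?(ltW r0) ?(ltW m0) //.
rewrite mulrA ler_pdivrMr // mulrC ler_wpM2l ?(ltW r0) //.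
by rewrite le_max lexx orbT.
Qed.

Lemma retract_id (a : C) r z : 0 < r -> cmod (z - a) <= r -> retract a r z = z.
Proof.
move=> r0 zr; rewrite /retract (max_idPl zr) divff ?gt_eqF //.
by rewrite mulr1 addrC subrK.
Qed.

Lemma retract_lip (a : C) r z w : 0 < r ->
  cmod (retract a r w - retract a r z) <= 2 * cmod (w - z).
Proof.
move=> r0; rewrite /retract.
set M := Num.max r (cmod (w - a)); set N := Num.max r (cmod (z - a)).
have M0 : 0 < M by rewrite lt_max r0.
have N0 : 0 < N by rewrite lt_max r0.
have rM0 : 0 <= r / M by apply/ltW/divr_gt0.
have rM : r <= M by rewrite le_max lexx.
have rN : r <= N by rewrite le_max lexx.
have zN : cmod (z - a) <= N by rewrite le_max lexx orbT.
have MN : `|N - M| <= cmod (w - z).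
  have h1 := cmod_le_add (w - a) (z - a).
  have h2 := cmod_le_add (z - a) (w - a).
  have E : w - a - (z - a) = w - z by ring.
  have E' : z - a - (w - a) = z - w by ring.
  rewrite E in h1; rewrite E' (cmodBC z w) in h2.
  have p := cmod_ge0 (w - z).
  rewrite ler_norml /M /N.
  have [?|?] := leP r (cmod (w - a)); have [?|?] := leP r (cmod (z - a));
    apply/andP; split; lra.
have -> : a + (w - a) * ((r / M)%:C)%C - (a + (z - a) * ((r / N)%:C)%C) =
  (w - z) * ((r / M)%:C)%C + (z - a) * ((r / M - r / N)%:C)%C.
  by rewrite rmorphB /=; ring.
rewrite (le_trans (cmodD _ _)) // mulr_natl mulr2n lerD // cmodM cmod_real.
  by rewrite ger0_norm // ler_piMr ?cmod_ge0 // ler_pdivrMr // mul1r.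
have -> : r / M - r / N = (r / M) * ((N - M) / N).
  by field; rewrite !gt_eqF.
rewrite normrM (ger0_norm rM0) normf_div (gtr0_norm N0).
rewrite (le_trans _ MN) //.
rewrite [leLHS](_ : _ = (cmod (z - a) / N) * (r / M) * `|N - M|); last first.
  by field; rewrite !gt_eqF.
have zN0 : 0 <= cmod (z - a) / N by rewrite divr_ge0 ?cmod_ge0 // ltW.
by rewrite ler_piMl // mulr_ile1 // ler_pdivrMr // mul1r.
Qed.

Lemma continuous_line (u : R -> C) (f : C -> C) :
  (forall s t, cmod (u s - u t) <= `|s - t|) ->
  (forall z, {for z, continuous f}) ->
  continuous (fun t => Re (f (u t))) /\ continuous (fun t => Im (f (u t))).
Proof.
move=> lu cf; split=> t A /nbhs_ballP [e /= e0 sA]; apply/nbhs_ballP;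
  have [d d0 sd] := (continuousCC f (u t)).1 (@cf (u t)) e e0;
  exists d => // s; rewrite -ball_normE /= distrC => ts; apply: sA;
  rewrite -ball_normE /= distrC.
  rewrite -recB; apply: le_lt_trans (Re_le_cmod _) _; apply: sd.
  exact: le_lt_trans (lu _ _) ts.
rewrite -imcB; apply: le_lt_trans (Im_le_cmod _) _; apply: sd.
exact: le_lt_trans (lu _ _) ts.
Qed.

(** The corners may come in any order: exchanging two sides only changes the
    sign. *)
Lemma goursat_corners (g : C -> C) (H V : R -> R -> C) (a b c d : R) :
  (forall y, cantider (fun x => H x y) (fun x => g (Complex x y))) ->
  (forall x, cantider (V x) (fun y => ii * g (Complex x y))) ->
  (forall x y, Num.min a b <= x <= Num.max a b ->
     Num.min c d <= y <= Num.max c d -> exists l, cdiff g (Complex x y) l) ->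
  circulation H V a b c d = 0.
Proof.
move=> dH dV dg.
have flipx p q s t : circulation H V q p s t = - circulation H V p q s t.
  by rewrite /circulation; ring.
have flipy p q s t : circulation H V p q t s = - circulation H V p q s t.
  by rewrite /circulation; ring.
have [ab|/ltW ba] := leP a b; have [cd|/ltW dc] := leP c d.
- by apply: (goursat dH dV) => // x y hx hy; apply: dg; rewrite ?min_l ?max_r.
- rewrite flipy (goursat dH dV) ?oppr0 // => x y hx hy.
  by apply: dg; rewrite ?(min_l ab) ?(max_r ab) ?(min_r dc) ?(max_l dc).
- rewrite flipx (goursat dH dV) ?oppr0 // => x y hx hy.
  by apply: dg; rewrite ?(min_l cd) ?(max_r cd) ?(min_r ba) ?(max_l ba).
- rewrite flipx flipy (goursat dH dV) ?oppr0 // => x y hx hy.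
  by apply: dg; rewrite ?(min_r dc) ?(max_l dc) ?(min_r ba) ?(max_l ba).
Qed.

Lemma cball_box (a : C) (r x y s t : R) : cball a r (Complex x y) ->
  `|s - Re a| <= `|x - Re a| -> `|t - Im a| <= `|y - Im a| ->
  cball a r (Complex s t).
Proof.
rewrite !cballE => za sx ty; apply: le_lt_trans za.
rewrite -(@ler_pXn2r _ 2) ?nnegrE ?cmod_ge0 // !cmod_sqr !recB !imcB /=.
by rewrite lerD // -ler_sqrt ?sqr_ge0 // !sqrtr_sqr.
Qed.

(** Every point of the rectangle spanned by the centre of a disk and a point
    of the disk lies in the disk, so the two axis-parallel paths from the
    centre give the same primitive; one path exhibits the horizontal and the
    other the vertical derivative. *)
Lemma primitive_ball (f : C -> C) (a : C) (r r0 : R) : 0 < r -> r < r0 ->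
  hol (cball a r0) f ->
  exists F, forall z, cball a r z -> cdiff F z (f z).
Proof.
move=> rp rr0 df.
pose g z := f (retract a r z).
have gE z : cmod (z - a) <= r -> g z = f z by move=> za; rewrite /g retract_id.
have cg z : {for z, continuous g}.
  apply/continuousCC => e e0.
  have [l /cdiff_cont] : exists l, cdiff f (retract a r z) l.
    by apply: df; exact: le_lt_trans (retract_in _ _ rp) rr0.
  move=> /continuousCC /(_ e e0) [d d0 sd]; exists (d / 2); first by rewrite divr_gt0.
  move=> w wz; apply: sd; apply: le_lt_trans (retract_lip _ _ _ rp) _.
  by rewrite mulrC -ltr_pdivlMr.
have dg z : cball a r z -> exists l, cdiff g z l.
  move=> za; have [l dl] : exists l, cdiff f z l.
    by apply: df; exact: lt_trans za rr0.
  have [e e0 sub] := cball_nbhs za.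
  exists l; apply: cdiff_near e0 _ dl => w /sub wa; rewrite gE //.
  exact: ltW.
have lx (y s t : R) : cmod (Complex s y - Complex t y) <= `|s - t|.
  by rewrite cmod_hor.
have ly (x s t : R) : cmod (Complex x s - Complex x t) <= `|s - t|.
  by rewrite cmod_ver.
have /choice[H' dH] : forall y, exists h, cantider h (fun x => g (Complex x y)).
  by move=> y; have [c1 c2] := continuous_line (lx y) cg; exact: cantider_exists.
pose H x y := H' y x.
have cig z : {for z, continuous (fun z => ii * g z)}.
  apply/continuousCC => e e0; have [d d0 sd] := (continuousCC g z).1 (@cg z) e e0.
  by exists d => // w /sd; rewrite -mulrBr cmodM cmod_ii mul1r.
have /choice[V dV] : forall x, exists h, cantider h (fun y => ii * g (Complex x y)).
  by move=> x; have [c1 c2] := continuous_line (ly x) cig; exact: cantider_exists.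
pose x0 := Re a; pose y0 := Im a.
have circ0 x y : cball a r (Complex x y) -> circulation H V x0 x y0 y = 0.
  move=> za; apply: (goursat_corners (g := g)) => // s t.
  move=> /between_dist hs /between_dist ht; apply: dg.
  exact: cball_box za hs ht.
pose F z := H (Re z) y0 - H x0 y0 + (V (Re z) (Im z) - V (Re z) y0).
have F2 x y : cball a r (Complex x y) ->
    F (Complex x y) = V x0 y - V x0 y0 + (H x y - H x0 y).
  move=> /circ0; rewrite /circulation /F /= => c0.
  by apply/eqP; rewrite -subr_eq0 -c0; apply/eqP; ring.
exists F => z za; rewrite -gE ?(ltW za) //.
have [d1 d10 sub] := cball_nbhs za.
apply: (@cdiffW _ _ _ _ 4) => e e0.
have [d2 d20 sd] := (continuousCC g z).1 (@cg z) e e0.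
exists (Num.min d1 d2 / 2); first by rewrite divr_gt0 // lt_min d10.
move=> w wz; case: z za sub sd wz => x y za sub sd.
case: w => x' y' wz.
have m0 : 0 < Num.min d1 d2 by rewrite lt_min d10.
have hx : `|x' - x| < Num.min d1 d2 / 2.
  by apply: le_lt_trans wz; exact: (Re_dist (Complex x' y') (Complex x y)).
have hy : `|y' - y| < Num.min d1 d2 / 2.
  by apply: le_lt_trans wz; exact: (Im_dist (Complex x' y') (Complex x y)).
have near s t : `|s - x| <= `|x' - x| -> `|t - y| <= `|y' - y| ->
    cmod (Complex s t - Complex x y) < Num.min d1 d2.
  move=> hs ht; apply: le_lt_trans (cmod_le_ReIm _) _; rewrite recB imcB /=; lra.
have nb s t : `|s - x| <= `|x' - x| -> `|t - y| <= `|y' - y| ->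
    cball a r (Complex s t).
  by move=> hs ht; apply: sub; have := near _ _ hs ht; rewrite lt_min => /andP[].
have ng s t : `|s - x| <= `|x' - x| -> `|t - y| <= `|y' - y| ->
    cmod (g (Complex s t) - g (Complex x y)) <= e.
  by move=> hs ht; apply/ltW/sd; have := near _ _ hs ht; rewrite lt_min => /andP[].
have z0 (u : R) : `|u - u| <= 0 :> R by rewrite subrr normr0.
have E1 : F (Complex x' y') - F (Complex x y') = H x' y' - H x y'.
  rewrite !F2; first by ring.
    by apply: nb => //; rewrite (le_trans (z0 _)).
  exact: nb.
have E2 : F (Complex x y') - F (Complex x y) = V x y' - V x y.
  by rewrite /F /=; ring.
pose gz := g (Complex x y).
have lin1 : cantider (fun s => gz * Complex s y') (fun s => gz * 1).
  apply: (@cdiff_cantider_x _ (fun z => gz * z) (fun _ => gz * 1)) => u.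
  by apply: cdiffZ; exact: cdiff_id.
have lin2 : cantider (fun t => gz * Complex x t) (fun t => ii * (gz * 1)).
  apply: (@cdiff_cantider_y _ (fun z => gz * z) (fun _ => gz * 1)) => u.
  by apply: cdiffZ; exact: cdiff_id.
have b1 : cmod ((H x' y' - gz * Complex x' y') - (H x y' - gz * Complex x y')) <=
    2 * e * `|x' - x|.
  apply: (cantider_bound (cantiderB (dH y') lin1)) => s /between_dist hs.
  by rewrite mulr1; apply: ng.
have b2 : cmod ((V x y' - gz * Complex x y') - (V x y - gz * Complex x y)) <=
    2 * e * `|y' - y|.
  apply: (cantider_bound (cantiderB (dV x) lin2)) => t /between_dist ht.
  rewrite mulr1 -mulrBr cmodM cmod_ii mul1r.
  by apply: ng => //; rewrite (le_trans (z0 _)).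
have -> : F (Complex x' y') - F (Complex x y) - gz * (Complex x' y' - Complex x y) =
  ((H x' y' - gz * Complex x' y') - (H x y' - gz * Complex x y')) +
  ((V x y' - gz * Complex x y') - (V x y - gz * Complex x y)).
  have -> : F (Complex x' y') - F (Complex x y) =
    (F (Complex x' y') - F (Complex x y')) + (F (Complex x y') - F (Complex x y)).
    by ring.
  by rewrite E1 E2; ring.
apply: le_trans (cmodD _ _) _; apply: le_trans (lerD b1 b2) _.
have h1 : `|x' - x| <= cmod (Complex x' y' - Complex x y).
  by exact: (Re_dist (Complex x' y') (Complex x y)).
have h2 : `|y' - y| <= cmod (Complex x' y' - Complex x y).
  by exact: (Im_dist (Complex x' y') (Complex x y)).
have := ler_wpM2l (ltW e0) (lerD h1 h2); lra.
Qed.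

End Primitive.

(** * The maximum modulus principle *)

Section MaximumPrinciple.
Variable R : realType.
Local Notation C := R[i].
Local Notation Re := complex.Re.
Local Notation Im := complex.Im.

Lemma is_derive_error (g : R -> R) (x l : R) : is_derive x 1 g l -> forall e : R, 0 < e ->
  exists2 d : R, 0 < d & forall y, `|y - x| < d ->
    `|g y - g x - l * (y - x)| <= e * `|y - x|.
Proof.
move=> [dg gl] e e0.
have : h^-1 *: (g (h *: 1 + x) - g x) @[h --> 0^'] --> l.
  by rewrite -gl; exact: dg.
move=> /(_ (ball l e)) [|d /= d0 sd]; first exact: nbhsx_ballx.
exists d => // y yx; have [->|nyx] := eqVneq y x.
  by rewrite !subrr mulr0 subrr normr0 mulr0.
have yx0 : y - x != 0 by rewrite subr_eq0.
have := sd (y - x); rewrite /= sub0r normrN => /(_ yx yx0).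
rewrite -ball_normE /= distrC.
have -> : (y - x) *: 1 + x = y by rewrite /GRing.scale /= mulr1 subrK.
set q := (_ - l); have -> : g y - g x - l * (y - x) = q * (y - x).
  by rewrite /q /GRing.scale /=; field.
by move=> qe; rewrite normrM ler_wpM2r // ltW.
Qed.

(** With a positive second derivative, the first derivative would vanish at
    [x0] and be positive just to the right of it. *)
Lemma second_derivative_test (p p' : R -> R) (x0 l d : R) : 0 < d ->
  (forall x, `|x - x0| < d -> is_derive x 1 p (p' x)) ->
  is_derive x0 1 p' l -> (forall x, `|x - x0| < d -> p x <= p x0) -> l <= 0.
Proof.
move=> d0 dp dp' mx.
have nx (x : R) : x \in `]x0 - d, x0 + d[ -> `|x - x0| < d.
  by rewrite in_itv /= ltr_norml => /andP[? ?]; apply/andP; split; lra.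
have x0d : `|x0 - x0| < d by rewrite subrr normr0.
have p0 : p' x0 = 0.
  have d1 : is_derive x0 1 p 0.
    apply: (@derive1_at_max _ p (x0 - d) (x0 + d)); first by lra.
    - by move=> x /nx /dp [].
    - by rewrite in_itv /=; apply/andP; split; lra.
    - by move=> x /nx; exact: mx.
  have [_ <-] := dp x0 x0d; by have [_ <-] := d1.
rewrite leNgt; apply/negP => l0.
have l20 : 0 < l / 2 by rewrite divr_gt0.
have [e e0 se] := is_derive_error dp' l20.
have pos x : x0 < x -> x < x0 + e -> 0 < p' x.
  move=> x1 x2; have xx : `|x - x0| = x - x0 by rewrite ger0_norm; lra.
  have := se x; rewrite p0 xx subr0 => /(_ ltac:(lra)).
  rewrite ler_norml => /andP[h _].
  have : 0 < l / 2 * (x - x0) by rewrite mulr_gt0 //; lra.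
  lra.
pose m := Num.min d e / 2; have me : 0 < Num.min d e by rewrite lt_min d0.
have [md' me'] : m < d /\ m < e.
  have : m < Num.min d e by rewrite /m; lra.
  by rewrite lt_min => /andP.
have m0 : 0 < m by rewrite divr_gt0.
have ab : x0 < x0 + m by lra.
have nd x : x0 <= x <= x0 + m -> `|x - x0| < d.
  by move=> /andP[? ?]; rewrite ger0_norm; lra.
have dGo x : x \in `]x0, x0 + m[ -> is_derive x 1 p (p' x).
  by rewrite in_itv /= => /andP[? ?]; apply: dp; apply: nd; apply/andP; split; lra.
have cG : {within `[x0, x0 + m], continuous p}.
  apply: derivable_within_continuous => x; rewrite in_itv /= => /nd /dp h.
  by have [] := h.
have [c] := MVT ab dGo cG; rewrite in_itv /= => /andP[c1 c2] E.
have h1 : p (x0 + m) <= p x0 by apply: mx; apply: nd; apply/andP; split; lra.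
have h2 : 0 < p' c by apply: pos; lra.
have : 0 < p' c * (x0 + m - x0) by rewrite mulr_gt0 //; lra.
lra.
Qed.

Lemma local_max_laplacian (u : C -> R) (x0 y0 : R) (ux uy : R -> R)
    (lx ly d : R) : 0 < d ->
  (forall x, `|x - x0| < d -> is_derive x 1 (fun t => u (Complex t y0)) (ux x)) ->
  is_derive x0 1 ux lx ->
  (forall y, `|y - y0| < d -> is_derive y 1 (fun t => u (Complex x0 t)) (uy y)) ->
  is_derive y0 1 uy ly ->
  (forall w, cmod (w - Complex x0 y0) < d -> u w <= u (Complex x0 y0)) ->
  lx + ly <= 0.
Proof.
move=> d0 dx dxx dy dyy mx; rewrite -[0](addr0 0); apply: lerD.
  apply: (second_derivative_test d0 dx dxx) => x xd; apply: mx.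
  by rewrite cmod_hor.
apply: (second_derivative_test d0 dy dyy) => y yd; apply: mx.
by rewrite cmod_ver.
Qed.

Lemma closed_cdisk (a : C) (r : R) : closed [set z | cmod (z - a) <= r].
Proof.
rewrite -openC; apply/openCE => z /= /negP; rewrite -ltNge => h.
exists (cmod (z - a) - r); first by rewrite subr_gt0.
move=> w /= wz; apply/negP; rewrite -ltNge.
have := cmod_tri w z a; rewrite (cmodBC z w); move: wz; rewrite /cball /=; lra.
Qed.

Lemma continuous_Complex : continuous (fun p : R * R => Complex p.1 p.2 : C).
Proof.
move=> p A /nbhsC [e e0 sA]; apply/nbhs_ballP; exists (e / 2).
  by rewrite /= divr_gt0.
move=> q; case: q => q1 q2 [/= h1 h2]; apply: sA.
rewrite cballE.
rewrite -!ball_normE /= in h1 h2.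
apply: le_lt_trans (cmod_le_ReIm _) _; rewrite recB imcB /=.
by rewrite (distrC q1) (distrC q2); lra.
Qed.

Lemma compact_cdisk (a : C) (r : R) : compact [set z | cmod (z - a) <= r].
Proof.
pose S := `[Re a - r, Re a + r]%classic `*` `[Im a - r, Im a + r]%classic.
have cS : compact S by apply: compact_setX; exact: segment_compact.
have : compact [set Complex p.1 p.2 | p in S].
  apply: continuous_compact => //; apply: continuous_subspaceT.
  exact: continuous_Complex.
move=> /(subclosed_compact (@closed_cdisk a r)); apply => z /= za.
exists (Re z, Im z); last by case: (z).
have h1 := le_trans (Re_le_cmod (z - a)) za; rewrite recB ler_norml in h1.
have h2 := le_trans (Im_le_cmod (z - a)) za; rewrite imcB ler_norml in h2.
move: h1 h2 => /andP[? ?] /andP[? ?].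
by split; rewrite /= in_itv /=; apply/andP; split; lra.
Qed.

Lemma EVT_maxC (u : C -> R) (K : set C) : compact K -> K !=set0 ->
  (forall z, K z -> {for z, continuous u}) ->
  exists2 z, K z & forall w, K w -> u w <= u z.
Proof.
move=> cK K0 cu; have [|c cK' mx] := @compact_EVT_max _ _ u K K0 cK.
  by apply: continuous_in_subspaceT => z /set_mem /cu.
by exists c; [exact: set_mem|move=> w Kw; apply: mx; exact: mem_set].
Qed.

Lemma cont_Re (f : C -> C) z : {for z, continuous f} ->
  {for z, continuous (fun w => Re (f w))}.
Proof.
move=> /continuousCC cf; apply/continuousCR => e /cf [d d0 sd].
exists d => // w /sd; rewrite -recB; apply: le_lt_trans; exact: Re_le_cmod.
Qed.

Lemma cont_sqdist (a z : C) (e : R) :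
  {for z, continuous (fun w => e * cmod (w - a) ^+ 2)}.
Proof.
have dz : cdiff (fun w => (w - a)) z (1 - 0).
  by apply: cdiffB; [exact: cdiff_id|exact: cdiff_cst].
have cz := cdiff_cont dz.
have cm : {for z, continuous (fun w => cmod (w - a))}.
  apply/continuousCR => d d0; exists d => // w wz.
  apply: le_lt_trans wz; rewrite ler_norml.
  have := cmod_tri w z a; have := cmod_tri z w a; rewrite (cmodBC z w) => ? ?.
  by apply/andP; split; lra.
have -> : (fun w => e * cmod (w - a) ^+ 2) =
  (fun w => e * (cmod (w - a) * cmod (w - a))) by apply/funext => w; rewrite expr2.
by apply: continuousM; [exact: cst_continuous|apply: continuousM].
Qed.

(** Adding [eps |z - a|^2] makes the real part strictly subharmonic without
    moving its boundary values by more than [eps r^2], which rules out an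
    interior maximum. *)
Lemma max_principle_Re (P p : C -> C) (a : C) (r r0 M : R) : 0 < r -> r < r0 ->
  (forall z, cball a r0 z -> cdiff P z (p z)) ->
  hol (cball a r0) p ->
  (forall z, cmod (z - a) = r -> Re (P z) <= M) ->
  forall z, cmod (z - a) <= r -> Re (P z) <= M.
Proof.
move=> rp rr0 dP dp bM z1 z1r; rewrite leNgt; apply/negP => z1M.
pose e := (Re (P z1) - M) / (2 * (r ^+ 2 + 1)).
have r21 : 0 < r ^+ 2 + 1 by rewrite ltr_wpDl ?sqr_ge0.
have e0 : 0 < e by rewrite divr_gt0 ?mulr_gt0 // subr_gt0.
have er2 : e * r ^+ 2 < Re (P z1) - M.
  have E : e * (2 * (r ^+ 2 + 1)) = Re (P z1) - M.
    by rewrite /e; field; rewrite gt_eqF.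
  have : 0 <= e * r ^+ 2 by rewrite mulr_ge0 ?sqr_ge0 ?ltW.
  by lra.
pose u z := Re (P z) + e * cmod (z - a) ^+ 2.
have cu z : cmod (z - a) <= r -> {for z, continuous u}.
  move=> zr; apply: continuousD; last exact: cont_sqdist.
  by apply: cont_Re; apply: cdiff_cont (dP _ _); exact: le_lt_trans zr rr0.
have [z zr mx] := EVT_maxC (@compact_cdisk a r) (ex_intro _ z1 z1r) cu.
have zlt : cmod (z - a) < r.
  rewrite lt_neqAle zr andbT; apply/negP => /eqP zE.
  have := mx z1 z1r; rewrite /u zE; have := bM z zE.
  have : 0 <= e * cmod (z1 - a) ^+ 2 by rewrite mulr_ge0 ?sqr_ge0 ?ltW.
  by lra.
have [d d0 sub] := cball_nbhs zlt.
have sub0 w : cball z d w -> cball a r0 w.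
  by move=> /sub wr; exact: lt_trans wr rr0.
have [l dl] := dp z (lt_trans zlt rr0).
case: z zr mx zlt sub sub0 dl => x y zr mx zlt sub sub0 dl.
have uE (s t : R) : u (Complex s t) = Re (P (Complex s t)) +
    e * ((s - Re a) ^+ 2 + (t - Im a) ^+ 2).
  by rewrite /u cmod_sqr recB imcB.
have nx t : `|t - x| < d -> cball (Complex x y) d (Complex t y).
  by move=> td; rewrite cballE cmod_hor.
have ny t : `|t - y| < d -> cball (Complex x y) d (Complex x t).
  by move=> td; rewrite cballE cmod_ver.
have sq (b c s : R) : is_derive s 1 (fun t => e * ((t - b) ^+ 2 + c)) (e * (2 * (s - b))).
  by apply: is_derive_eq; rewrite /GRing.scale /=; ring.
have sq' (b c s : R) : is_derive s 1 (fun t => e * (c + (t - b) ^+ 2)) (e * (2 * (s - b))).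
  by apply: is_derive_eq; rewrite /GRing.scale /=; ring.
have ln (b s : R) : is_derive s 1 (fun t => e * (2 * (t - b))) (2 * e).
  by apply: is_derive_eq; rewrite /GRing.scale /=; ring.
have : (Re l + 2 * e) + (- Re l + 2 * e) <= 0.
  apply: (@local_max_laplacian u x y
    (fun t => Re (p (Complex t y)) + e * (2 * (t - Re a)))
    (fun t => - Im (p (Complex x t)) + e * (2 * (t - Im a))) _ _ d d0).
  - move=> t td; under eq_fun do rewrite uE.
    exact: is_deriveD (cdiff_Re_dx (dP _ (sub0 _ (nx _ td)))) (sq _ _ _).
  - exact: is_deriveD (cdiff_Re_dx dl) (ln _ _).
  - move=> t td; under eq_fun do rewrite uE.
    exact: is_deriveD (cdiff_Re_dy (dP _ (sub0 _ (ny _ td)))) (sq' _ _ _).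
  - exact: is_deriveD (is_deriveN (cdiff_Im_dy dl)) (ln _ _).
  - by move=> w /sub wr; apply: mx; rewrite /= ltW.
lra.
Qed.

Lemma cdiff_shift_real (f : C -> C) (z : C) (t : R) l :
  cdiff f (z + Complex t 0) l -> cdiff (fun w => f (w + Complex t 0)) z l.
Proof.
move=> df; have := @cdiff_comp _ (fun w => w + Complex t 0) f z (1 + 0) l.
rewrite addr0 mulr1; apply => //; rewrite -[1]addr0.
by apply: cdiffD; [exact: cdiff_id|exact: cdiff_cst].
Qed.

Lemma diff_quotient_close (F f : C -> C) (z : C) (h e : R) : 0 < h ->
  (forall t, 0 <= t <= h -> cdiff F (z + Complex t 0) (f (z + Complex t 0))) ->
  (forall t, 0 <= t <= h -> cmod (f (z + Complex t 0) - f z) <= e) ->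
  cmod ((F (z + Complex h 0) - F z) / Complex h 0 - f z) <= 2 * e.
Proof.
move=> h0 dF fe.
have h00 : Complex h 0 != 0 :> C by rewrite -cmod_gt0 cmod_Creal normr_gt0 gt_eqF.
pose G w := F w - f z * w.
have dG t : 0 <= t <= h ->
    cdiff G (z + Complex t 0) (f (z + Complex t 0) - f z * 1).
  by move=> th; apply: cdiffB; [exact: dF|apply: cdiffZ; exact: cdiff_id].
have zE t : z + Complex t 0 = Complex (t + Re z) (Im z).
  by apply: complex_ext; rewrite ?recD ?imcD /= ?addr0 // addrC.
have bt (x : R) : Num.min (Re z) (h + Re z) <= x <= Num.max (Re z) (h + Re z) ->
    0 <= x - Re z <= h.
  by rewrite min_l ?max_r; [move=> /andP[? ?]; apply/andP; split; lra|lra|lra].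
have xE (x : R) : Complex x (Im z) = z + Complex (x - Re z) 0.
  by rewrite zE subrK.
have b1 : `|Re (G (Complex (h + Re z) (Im z))) - Re (G (Complex (Re z) (Im z)))|
    <= e * `|h + Re z - Re z|.
  apply: (@mvt_bound _ (fun x => Re (G (Complex x (Im z))))
    (fun x => Re (f (Complex x (Im z)) - f z * 1))) => x /bt xh.
    by apply: cdiff_Re_dx; rewrite xE; exact: dG.
  by apply: le_trans (Re_le_cmod _) _; rewrite mulr1 xE; exact: fe.
have b2 : `|Im (G (Complex (h + Re z) (Im z))) - Im (G (Complex (Re z) (Im z)))|
    <= e * `|h + Re z - Re z|.
  apply: (@mvt_bound _ (fun x => Im (G (Complex x (Im z))))
    (fun x => Im (f (Complex x (Im z)) - f z * 1))) => x /bt xh.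
    by apply: cdiff_Im_dx; rewrite xE; exact: dG.
  by apply: le_trans (Im_le_cmod _) _; rewrite mulr1 xE; exact: fe.
have -> : (F (z + Complex h 0) - F z) / Complex h 0 - f z =
    (G (z + Complex h 0) - G z) / Complex h 0 by rewrite /G; field.
rewrite cmod_div ler_pdivrMr ?cmod_gt0 //.
have -> : cmod (Complex h 0) = h by rewrite cmod_Creal gtr0_norm.
rewrite zE; rewrite addrK (gtr0_norm h0) in b1 b2.
apply: le_trans (cmod_le_ReIm _) _; rewrite recB imcB.
by rewrite Complex_eta in b1 b2; lra.
Qed.

(** A holomorphic function is a uniform limit of difference quotients of a
    primitive, and these are twice differentiable. *)
Theorem maximum_modulus (f : C -> C) (a : C) (r r0 M : R) : 0 < r -> r < r0 ->
  hol (cball a r0) f ->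
  (forall z, cmod (z - a) = r -> cmod (f z) <= M) ->
  forall z, cmod (z - a) <= r -> cmod (f z) <= M.
Proof.
move=> rp rr0 df bM z1 z1r; rewrite leNgt; apply/negP => z1M.
pose q := (r + r0) / 2.
have rq : r < q by rewrite /q; lra.
have qr0 : q < r0 by rewrite /q; lra.
have [F dF] := primitive_ball (lt_trans rp rq) qr0 df.
(* The difference quotient is within [2 e] of [f] both at [z1] and on the
   circle, which accounts for [4 e] of the gap [6 e]. *)
pose e := (cmod (f z1) - M) / 6.
have e0 : 0 < e by rewrite divr_gt0 // subr_gt0.
have fz1 : f z1 != 0.
  rewrite -cmod_gt0 (le_lt_trans _ z1M) //.
  apply: le_trans (cmod_ge0 (f (a + Complex r 0))) (bM _ _).
  by rewrite addrC addKr cmod_Creal gtr0_norm.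
(* The rotation that makes [f z1] real and positive. *)
pose c := conjc (f z1) / ((cmod (f z1))%:C)%C.
have c1 : cmod c = 1.
  rewrite /c cmod_div cmod_conj cmod_real ger0_norm ?cmod_ge0 //.
  by rewrite divff // gt_eqF // cmod_gt0.
have cz1 : Re (c * f z1) = cmod (f z1).
  have -> : c * f z1 = ((cmod (f z1))%:C)%C.
    rewrite /c mulrAC [_ * f z1]mulrC mul_conj rmorphXn /= expr2 mulfK //.
    by rewrite -cmod_gt0 cmod_real normr_gt0 gt_eqF // cmod_gt0.
  by [].
pose Q h z := (F (z + Complex h 0) - F z) / Complex h 0.
have loc (z : C) : cmod (z - a) <= r -> exists2 m : R, 0 < m &
    forall (w : C) (h : R), cmod (w - z) < m / 2 -> 0 < h < m / 2 ->
    cmod (Q h w - f w) <= 2 * e.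
  move=> zr; have [l /cdiff_cont/continuousCC] := df z (le_lt_trans zr rr0).
  have e20 : 0 < e / 2 by rewrite divr_gt0.
  move=> /(_ _ e20) [d d0 sd].
  pose m := Num.min d (q - r).
  have m0 : 0 < m by rewrite lt_min d0 subr_gt0.
  exists m => // w h wz /andP[h0 hm2].
  have near t : 0 <= t <= h -> cmod (w + Complex t 0 - z) < m.
    move=> /andP[t0 th]; have -> : w + Complex t 0 - z = (w - z) + Complex t 0 by ring.
    apply: le_lt_trans (cmodD _ _) _.
    have -> : cmod (Complex t 0) = t by rewrite cmod_Creal ger0_norm.
    lra.
  apply: diff_quotient_close => // t th; have := near t th.
    rewrite lt_min => /andP[_ h1]; apply: dF; rewrite cballE.
    by have := cmod_tri z (w + Complex t 0) a; lra.
  have := near 0; rewrite lexx (ltW h0) => /(_ isT).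
  have -> : w + Complex 0 0 = w by exact: addr0.
  rewrite !lt_min => /andP[/sd h1 _] /andP[/sd h2 _].
  by have := cmod_tri (f z) (f (w + Complex t 0)) (f w); rewrite (cmodBC (f z)); lra.
have close : \forall h \near 0^'+, [set z | cmod (z - a) <= r] `<=`
    [set z | cmod (Q h z - f z) <= 2 * e].
  have /compact_near_coveringP := @compact_cdisk a r.
  apply => z /loc [m m0 mP].
  exists (cball z (m / 2), [set h : R | 0 < h < m / 2]).
    split; first by apply/nbhsC; exists (m / 2) => //; rewrite divr_gt0.
    near=> h; rewrite /=; apply/andP; split; near: h; first exact: nbhs_right_gt.
    by apply: nbhs_right_lt; rewrite divr_gt0.
  by move=> [w h] /= [wz hm]; exact: mP.
have [h [h0 hq hQ]] : exists h : R, [/\ 0 < h, h < (q - r) / 2 &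
    forall z, cmod (z - a) <= r -> cmod (Q h z - f z) <= 2 * e].
  near (0 : R)^'+ => h; exists h; split => //; near: h => //.
  by apply: nbhs_right_lt; rewrite divr_gt0 // subr_gt0.
have h00 : Complex h 0 != 0 :> C by rewrite -cmod_gt0 cmod_Creal normr_gt0 gt_eqF.
have ch : cmod (Complex h 0) = h by rewrite cmod_Creal gtr0_norm.
pose r1 := (q + r) / 2.
have inq z : cball a r1 z -> cball a q z /\ cball a q (z + Complex h 0).
  rewrite !cballE /r1 => zr; split; first by lra.
  have := cmod_tri z (z + Complex h 0) a.
  by rewrite [z + _ - z]addrC addKr ch; lra.
pose k := c / Complex h 0.
have PE z : k * (F (z + Complex h 0) - F z) = c * Q h z.
  by rewrite /k /Q; field.
have ReQ z : cmod (z - a) <= r -> `|Re (c * Q h z) - Re (c * f z)| <= 2 * e.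
  move=> /hQ; rewrite -recB -mulrBr; apply: le_trans.
  by rewrite (le_trans (Re_le_cmod _)) // cmodM c1 mul1r.
have : Re (k * (F (z1 + Complex h 0) - F z1)) <= M + 2 * e.
  apply: (@max_principle_Re (fun z => k * (F (z + Complex h 0) - F z))
    (fun z => k * (f (z + Complex h 0) - f z)) a r r1) => //.
  - by rewrite /r1; lra.
  - move=> z /inq [z0 zh]; apply: cdiffZ; apply: cdiffB; last exact: dF.
    by apply: cdiff_shift_real; exact: dF.
  - move=> z /inq [z0 zh].
    have [l1 dl1] := df _ (lt_trans z0 qr0); have [l2 dl2] := df _ (lt_trans zh qr0).
    exists (k * (l2 - l1)); apply: cdiffZ; apply: cdiffB => //.
    exact: cdiff_shift_real.
  - move=> z zr; rewrite PE.
    have := ReQ z; rewrite zr lexx => /(_ isT); rewrite ler_norml => /andP[_ h2].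
    have h3 : Re (c * f z) <= M.
      apply: le_trans (ler_norm _) _; apply: le_trans (Re_le_cmod _) _.
      by rewrite cmodM c1 mul1r; exact: bM.
    lra.
rewrite PE; have := ReQ z1 z1r; rewrite ler_norml cz1 => /andP[h1 _].
by rewrite /e; move: h1; rewrite /e; lra.
Unshelve. all: by end_near. Qed.

End MaximumPrinciple.

(** * Schwarz's lemma, Taylor remainders and pointwise limits *)

Section Schwarz.
Variable R : realType.
Local Notation C := R[i].

Lemma expn_unbounded (x B : R) : 1 < x -> exists n, B < x ^+ n.
Proof.
move=> x1; have x10 : 0 < x - 1 by rewrite subr_gt0.
have bern n : 1 + (x - 1) *+ n <= x ^+ n.
  elim: n => [|n IH]; first by rewrite mulr0n addr0 expr0.
  rewrite exprS mulrS; apply: le_trans (ler_wpM2l _ IH); last by lra.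
  have : 0 <= (x - 1) * ((x - 1) *+ n) by rewrite mulr_ge0 ?mulrn_wge0 ?ltW.
  by lra.
exists (Num.truncn (B / (x - 1))).+1; apply: lt_le_trans (bern _).
have := truncnS_gt (B / (x - 1)); rewrite ltr_pdivrMr // mulr_natl.
by move=> h; rewrite (lt_trans h) // ltrDr.
Qed.

Lemma lt_left_lim (A B r0 s : R) : s < r0 ->
  (forall r, s < r -> r < r0 -> A * r <= B) -> A * r0 <= B.
Proof.
move=> sr0 H; rewrite leNgt; apply/negP => BA.
pose e := (A * r0 - B) / (2 * (`|A| + 1)).
have A1 : 0 < `|A| + 1 by rewrite ltr_wpDl.
have e0 : 0 < e by rewrite divr_gt0 ?mulr_gt0 // subr_gt0.
pose r := Num.max (r0 - e) ((s + r0) / 2).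
have h1 : s < r by rewrite /r lt_max; apply/orP; right; lra.
have h2 : r < r0 by rewrite /r gt_max; apply/andP; split; lra.
have h3 : r0 - e <= r by rewrite /r le_max lexx.
have := H r h1 h2.
have E : e * (2 * (`|A| + 1)) = A * r0 - B by rewrite /e; field; rewrite gt_eqF.
have h4 : `|A * (r0 - r)| <= `|A| * e.
  by rewrite normrM ler_wpM2l // ger0_norm; lra.
have := le_trans (ler_norm _) h4; have := normr_ge0 A; nra.
Qed.

(** The removable singularity of a difference quotient:
    [(z - a) q(z)^n] is differentiable at [a] as soon as [q] is continuous
    there, and taking [n]-th roots in the maximum modulus principle for it
    makes the factor [z - a] disappear. *)
Lemma maximum_modulus_point (q : C -> C) (a : C) (r r0 M : R) :
  0 < r -> r < r0 -> 0 <= M ->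
  (forall z, cball a r0 z -> z != a -> exists l, cdiff q z l) ->
  {for a, continuous q} ->
  (forall z, cmod (z - a) = r -> cmod (q z) <= M) ->
  forall z, cmod (z - a) <= r -> z != a -> cmod (q z) <= M.
Proof.
move=> rp rr0 M0 dq cq bM z zr za; rewrite leNgt; apply/negP => Mz.
pose N := (M + cmod (q z)) / 2.
have N0 : 0 < N by rewrite /N; lra.
have MN : M <= N by rewrite /N; lra.
have Nz : 1 < cmod (q z) / N by rewrite ltr_pdivlMr // mul1r /N; lra.
have cza : 0 < cmod (z - a) by rewrite cmod_gt0 subr_eq0.
have [n] := expn_unbounded (r / cmod (z - a)) Nz.
rewrite ltr_pdivrMr // => h.
have cqn : {for a, continuous (fun w => q w ^+ n)}.
  apply/continuousCC => e e0.
  have [d1 d10 s1] := (continuousCC _ _).1 (cdiff_cont (cdiffX n (cdiff_id (q a)))) e e0.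
  have [d2 d20 s2] := (continuousCC _ _).1 cq d1 d10.
  by exists d2 => // w /s2 /s1.
have bound : forall w, cmod (w - a) <= r -> cmod ((w - a) * q w ^+ n) <= r * N ^+ n.
  apply: (@maximum_modulus _ _ a r r0) => //.
    move=> w wr0; have [->|wa] := eqVneq w a.
      exists (q a ^+ n) => e e0.
      have [d d0 sd] := (continuousCC _ a).1 cqn e e0; exists d => // u /sd ud.
      rewrite (_ : (u - a) * q u ^+ n - (a - a) * q a ^+ n - q a ^+ n * (u - a) =
        (q u ^+ n - q a ^+ n) * (u - a)); last by ring.
      by rewrite cmodM ler_wpM2r ?cmod_ge0 // ltW.
    have [l dl] := dq w wr0 wa.
    exists ((1 - 0) * q w ^+ n + (w - a) * (l * q w ^+ n.-1 *+ n)).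
    apply: cdiffM; last exact: cdiffX.
    by apply: cdiffB; [exact: cdiff_id|exact: cdiff_cst].
  move=> w wr; rewrite cmodM cmodX wr ler_wpM2l ?(ltW rp) //.
  by rewrite lerXn2r ?nnegrE ?cmod_ge0 ?(ltW N0) // (le_trans (bM w wr)).
have := bound z zr; rewrite cmodM cmodX; apply/negP; rewrite -ltNge.
by move: h; rewrite expr_div_n mulrAC ltr_pdivlMr ?exprn_gt0 // [cmod (z - a) * _]mulrC.
Qed.

Lemma hol_subset (U V : set C) (f : C -> C) : V `<=` U -> hol U f -> hol V f.
Proof. by move=> VU hf z /VU /hf. Qed.

(** The difference quotient of [h] at [a], completed by the derivative, is
    continuous at [a], so [maximum_modulus_point] applies to it on circles of
    radius tending to [r]. *)
Theorem schwarz (h : C -> C) (a : C) (r M : R) : hol (cball a r) h ->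
  (forall z, cball a r z -> cmod (h z - h a) <= M) ->
  forall z, cball a r z -> cmod (h z - h a) * r <= M * cmod (z - a).
Proof.
move=> dh bM z zr.
have [->|za] := eqVneq z a; first by rewrite !subrr cmod0 mul0r mulr0.
have za0 : 0 < cmod (z - a) by rewrite cmod_gt0 subr_eq0.
have M0 : 0 <= M by exact: le_trans (cmod_ge0 _) (bM z zr).
have r0 : 0 < r by exact: lt_trans za0 zr.
have [l dl] := dh a (cballxx a r0).
pose q w := if w == a then l else (h w - h a) / (w - a).
apply: (lt_left_lim zr) => s zs sr.
have s0 : 0 < s := lt_trans za0 zs.
have : cmod (q z) <= M / s.
  apply: (@maximum_modulus_point q a s r) => //; last exact: ltW.
  - by rewrite divr_ge0 // ltW.
  - move=> w wr wa; have [m dm] := dh w wr.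
    have wa0 : w - a != 0 by rewrite subr_eq0.
    have [e e0 sub] : exists2 e : R, 0 < e & forall u, cball w e u -> u != a.
      exists (cmod (w - a)); first by rewrite cmod_gt0.
      by move=> u; rewrite cballE; apply: contraTneq => ->; rewrite cmodBC ltxx.
    exists (((m - 0) * (w - a) - (h w - h a) * (1 - 0)) / (w - a) ^+ 2).
    apply: (cdiff_near e0 (f := fun u => (h u - h a) / (u - a))).
      by move=> u /sub ua; rewrite /q (negbTE ua).
    apply: (cdiff_div (f := fun u => h u - h a) (g := fun u => u - a)) => //.
      by apply: cdiffB => //; exact: cdiff_cst.
    by apply: cdiffB; [exact: cdiff_id|exact: cdiff_cst].
  - apply/continuousCC => e e0; have e20 : 0 < e / 2 by rewrite divr_gt0.
    have [d d0 sd] := dl _ e20; exists d => // w /sd.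
    rewrite /q eqxx; case: eqVneq => [_|wa]; first by rewrite subrr cmod0.
    have wa0 : w - a != 0 by rewrite subr_eq0.
    rewrite (_ : h w - h a - l * (w - a) = ((h w - h a) / (w - a) - l) * (w - a)).
      rewrite cmodM ler_pM2r ?cmod_gt0 //; lra.
    by field.
  - move=> w ws; rewrite /q; case: eqVneq => [wa|wa].
      by move: ws; rewrite wa subrr cmod0; lra.
    by rewrite cmod_div ws ler_wpM2r ?invr_ge0 ?(ltW s0) // bM // cballE ws.
rewrite /q (negbTE za) cmod_div ler_pdivrMr // mulrAC ler_pdivlMr //.
Qed.

Lemma cdiff_bound (h : C -> C) (a l : C) (r K : R) : 0 < r -> cdiff h a l ->
  (forall z, cball a r z -> cmod (h z - h a) <= K * cmod (z - a)) -> cmod l <= K.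
Proof.
move=> r0 dl hK; rewrite leNgt; apply/negP => Kl.
pose e := (cmod l - K) / 2; have e0 : 0 < e by rewrite /e; lra.
have [d d0 sd] := dl e e0.
have m0 : 0 < Num.min d r by rewrite lt_min d0.
pose t := Num.min d r / 2.
have t0 : 0 < t by rewrite divr_gt0.
have : t < Num.min d r by rewrite /t; lra.
rewrite lt_min => /andP[td tr].
have ct : cmod (a + Complex t 0 - a) = t.
  by rewrite addrC addKr cmod_Creal gtr0_norm.
have := sd (a + Complex t 0); rewrite ct => /(_ td) h1.
have := hK (a + Complex t 0); rewrite cballE ct => /(_ tr) h2.
have h3 := cmod_le_add (l * (a + Complex t 0 - a)) (h (a + Complex t 0) - h a).
rewrite cmodM ct (cmodBC (l * _)) in h3.
have : (cmod l - K - e) * t <= 0 by lra.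
by rewrite pmulr_lle0 // /e; lra.
Qed.

(** The Schwarz lemma on the disk of radius [r / 2] about [w], which contains
    [z]. *)
Lemma hol_lipschitz (f : C -> C) (a : C) (r M : R) : 0 < r -> hol (cball a r) f ->
  (forall z, cball a r z -> cmod (f z) <= M) ->
  forall z w, cball a (r / 4) z -> cball a (r / 4) w ->
  cmod (f z - f w) <= 4 * M / r * cmod (z - w).
Proof.
move=> r0 df bM z w; rewrite !cballE => za wa.
have sub : cball w (r / 2) `<=` cball a r.
  by move=> u; rewrite !cballE => uw; have := cmod_tri w u a; lra.
have wr : cball w (r / 2) w by rewrite cballE subrr cmod0; lra.
have := @schwarz f w (r / 2) (2 * M) (hol_subset sub df) _ z.
have h1 : forall u, cball w (r / 2) u -> cmod (f u - f w) <= 2 * M.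
  move=> u /sub /bM h; have := bM w (sub _ wr).
  by have := cmodB (f u) (f w); lra.
move=> /(_ h1); rewrite cballE.
have h2 : cmod (z - w) < r / 2.
  by have := cmod_tri a z w; rewrite (cmodBC a w); lra.
move=> /(_ h2) h3.
rewrite -(@ler_pM2r _ (r / 2)) ?divr_gt0 //; apply: le_trans h3 _.
by rewrite le_eqVlt; apply/orP; left; apply/eqP; field; rewrite gt_eqF.
Qed.

(** The Lipschitz bound applied to [f(z + v) - f(z)], which is bounded by a
    multiple of [|v|] by the Lipschitz bound of [f]; each application divides the
    radius by [4], and translation by [v] costs a factor [2]. *)
Lemma second_difference (f : C -> C) (a : C) (r M : R) : 0 < r ->
  hol (cball a r) f -> (forall z, cball a r z -> cmod (f z) <= M) ->
  forall v, cmod v < r / 32 ->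
  cmod (f (a + v + v) - f (a + v) - (f (a + v) - f a)) <=
    128 * M / r ^+ 2 * cmod v ^+ 2.
Proof.
move=> r0 df bM v vr; pose g z := f (z + v) - f z.
have sub z : cball a (r / 8) z -> cball a (r / 4) (z + v) /\ cball a (r / 4) z.
  rewrite !cballE => zr; split; last by lra.
  have := cmod_tri z (z + v) a; rewrite [z + v - z]addrC addKr; lra.
have sub4 z : cball a (r / 4) z -> cball a r z by rewrite !cballE; lra.
have gb z : cball a (r / 8) z -> cmod (g z) <= 4 * M / r * cmod v.
  move=> /sub [h1 h2]; have := hol_lipschitz r0 df bM h1 h2.
  by rewrite [z + v - z]addrC addKr.
have dg : hol (cball a (r / 8)) g.
  move=> z /sub [/sub4/df [l1 d1] /sub4/df [l2 d2]]; exists (l1 * (1 + 0) - l2).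
  apply: cdiffB => //; apply: (cdiff_comp (f := fun w => w + v)) => //.
  by apply: cdiffD; [exact: cdiff_id|exact: cdiff_cst].
have r8 : 0 < r / 8 by rewrite divr_gt0.
have h1 : cball a (r / 8 / 4) (a + v) by rewrite cballE addrC addKr; lra.
have h2 : cball a (r / 8 / 4) a by apply: cballxx; rewrite divr_gt0.
have := hol_lipschitz r8 dg gb h1 h2; rewrite [a + v - a]addrC addKr => /le_trans; apply.
by rewrite le_eqVlt; apply/orP; left; apply/eqP; field; rewrite gt_eqF.
Qed.

(** Taylor expansion of order one with a remainder that depends only on a
    bound of the function: the error [E] at [2v] is twice the error at [v] up to
    a second difference, and [2^n E(v / 2^n)] tends to [0]. *)
Lemma taylor1 (f : C -> C) (a l : C) (r M : R) : 0 < r ->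
  hol (cball a r) f -> (forall z, cball a r z -> cmod (f z) <= M) -> cdiff f a l ->
  forall w, cmod (w - a) < r / 32 ->
  cmod (f w - f a - l * (w - a)) <= 128 * M / r ^+ 2 * cmod (w - a) ^+ 2.
Proof.
move=> r0 df bM dl w wr; set K := 128 * M / r ^+ 2.
have M0 : 0 <= M by exact: le_trans (cmod_ge0 _) (bM a (cballxx a r0)).
have K0 : 0 <= K by rewrite divr_ge0 ?mulr_ge0 ?exprn_ge0 // ltW.
pose E v := f (a + v) - f a - l * v.
have step v : cmod v < r / 32 -> cmod (E (v + v)) <= 2 * cmod (E v) + K * cmod v ^+ 2.
  move=> vr; have := second_difference r0 df bM vr; rewrite -/K => h.
  have -> : E (v + v) = (E v + E v) +
      (f (a + v + v) - f (a + v) - (f (a + v) - f a)) by rewrite /E addrA; ring.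
  have := cmodD (E v + E v) (f (a + v + v) - f (a + v) - (f (a + v) - f a)).
  have := cmodD (E v) (E v); lra.
have iter n v : cmod v < r / 32 -> cmod (E v) <=
    2 ^+ n * cmod (E (v / 2 ^+ n)) + K * cmod v ^+ 2 * (1 - (2 ^+ n)^-1).
  elim: n v => [|n IH] v vr.
    by rewrite !expr0 divr1 invr1 subrr mulr0 addr0 mul1r.
  have v2 : cmod (v / 2) = cmod v / 2.
    by rewrite cmod_div cmod2.
  have v2r : cmod (v / 2) < r / 32 by rewrite v2; have := cmod_ge0 v; lra.
  have vv : v / 2 + v / 2 = v by field.
  have := step (v / 2) v2r; rewrite vv v2 => h1.
  have := IH (v / 2) v2r; rewrite v2.
  have -> : v / 2 / 2 ^+ n = v / 2 ^+ n.+1 by rewrite exprS invfM mulrA.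
  set X := cmod (E (v / 2 ^+ n.+1)) => h2.
  apply: le_trans h1 _; rewrite [2 ^+ n.+1]exprS invfM.
  have c2 : 0 <= K * cmod v ^+ 2 by rewrite mulr_ge0 ?sqr_ge0.
  have i0 : 0 <= (2 ^+ n)^-1 :> R by rewrite invr_ge0 exprn_ge0.
  have -> : 2 * 2 ^+ n * X = 2 * (2 ^+ n * X) by rewrite mulrA.
  have := mulr_ge0 c2 i0; nra.
have wE : w = a + (w - a) by rewrite addrC subrK.
rewrite {1}wE -/(E (w - a)); set v := w - a in wr *.
apply/ler_addgt0Pr => e e0.
have e10 : 0 < e / (cmod v + 1) by rewrite divr_gt0 // ltr_wpDl ?cmod_ge0.
have [d d0 sd] := dl _ e10.
have [n nP] : exists n, cmod v / d < 2 ^+ n by apply: expn_unbounded; lra.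
have c2n : cmod (v / 2 ^+ n) = cmod v / 2 ^+ n.
  by rewrite cmod_div cmodX cmod2.
have p2 : 0 < 2 ^+ n :> R by rewrite exprn_gt0.
have vd : cmod v / 2 ^+ n < d by rewrite ltr_pdivrMr // mulrC -ltr_pdivrMr.
have := sd (a + v / 2 ^+ n).
rewrite [a + _ - a]addrC addKr -/(E _) c2n => /(_ vd) h; have := iter n v wr.
have h' : 2 ^+ n * cmod (E (v / 2 ^+ n)) <= e.
  apply: le_trans (ler_wpM2l (ltW p2) h) _.
  rewrite [leLHS](_ : _ = e * (cmod v / (cmod v + 1))); last first.
    by field; rewrite !gt_eqF // ltr_wpDl ?cmod_ge0.
  rewrite ler_piMr ?(ltW e0) // ler_pdivrMr ?ltr_wpDl ?cmod_ge0 //.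
  by rewrite mul1r lerDl.
have c2 : 0 <= K * cmod v ^+ 2 by rewrite mulr_ge0 ?sqr_ge0.
have i0 : 0 <= (2 ^+ n)^-1 :> R by rewrite invr_ge0 ltW.
have := mulr_ge0 c2 i0; rewrite mulrBr mulr1; lra.
Qed.

(** Pointwise limits of bounded holomorphic functions are holomorphic: the
    derivatives at [a] are bounded, hence cluster, and the uniform remainder of
    [taylor1] passes to the limit. *)
Theorem limit_holomorphic (T : Type) (F : set_system T) (f_ : T -> C -> C)
  (f : C -> C) (a : C) (r M : R) : ProperFilter F -> 0 < r ->
  (\forall i \near F, hol (cball a r) (f_ i) /\
     forall z, cball a r z -> cmod (f_ i z) <= M) ->
  (forall z, cball a r z -> forall e : R, 0 < e ->
     \forall i \near F, cmod (f_ i z - f z) < e) ->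
  exists l, cdiff f a l.
Proof.
move=> PF r0 hf lf.
have /choice[D DP] : forall i, exists l,
    (exists m, cdiff (f_ i) a m) -> cdiff (f_ i) a l.
  move=> i; have [[m dm]|N] := pselect (exists m, cdiff (f_ i) a m).
    by exists m.
  by exists 0 => /N.
have ha := cballxx a r0.
have dD i : hol (cball a r) (f_ i) -> cdiff (f_ i) a (D i) by move=> /(_ a ha) /DP.
pose K := 2 * M / r.
have bD i : hol (cball a r) (f_ i) -> (forall z, cball a r z -> cmod (f_ i z) <= M) ->
    cmod (D i - 0) <= K.
  move=> hi bi; rewrite subr0; apply: (cdiff_bound r0 (dD i hi)) => z zr.
  rewrite /K mulrAC ler_pdivlMr //; apply: (schwarz hi) zr => w wr.
  by have := cmodB (f_ i w) (f_ i a); have := bi w wr; have := bi a ha; lra.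
have PD : ProperFilter (D @ F) by exact: fmap_proper_filter.
have FK : (D @ F) [set z | cmod (z - 0) <= K].
  by apply: filterS hf => i [hi bi]; exact: bD.
have [l [_ cl]] := @compact_cdisk R 0 K _ PD FK.
exists l; apply: (@cdiff_quadratic _ _ _ _ (r / 32) (128 * M / r ^+ 2)) => [|w wr].
  by rewrite divr_gt0.
apply/ler_addgt0Pr => e e0.
have wr' : cball a r w by rewrite cballE; lra.
pose e1 := e / (2 + cmod (w - a)).
have c20 : 0 < 2 + cmod (w - a) by rewrite ltr_wpDr ?cmod_ge0.
have e10 : 0 < e1 by rewrite divr_gt0.
have e1E : e1 * (2 + cmod (w - a)) = e by rewrite /e1 divfK // gt_eqF.
have G : F [set i | [/\ hol (cball a r) (f_ i),
   forall z, cball a r z -> cmod (f_ i z) <= M, cmod (f_ i w - f w) < e1 &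
   cmod (f_ i a - f a) < e1]].
  have A1 := lf w wr' e1 e10; have A2 := lf a ha e1 e10.
  by apply: filterS (filterI hf (filterI A1 A2)) => i [[? ?] [? ?]]; split.
have [m [[i [hi bi h1 h2] Dm] ml]] :
    D @` [set i | [/\ hol (cball a r) (f_ i),
   forall z, cball a r z -> cmod (f_ i z) <= M, cmod (f_ i w - f w) < e1 &
   cmod (f_ i a - f a) < e1]] `&` cball l e1 !=set0.
  apply: cl; first by apply: (@filterS _ F _ _ _ _ G) => i Gi; exists i.
  by apply/nbhsC; exists e1.
have T1 := taylor1 r0 hi bi (dD i hi) wr.
rewrite -Dm cballE in ml.
have -> : f w - f a - l * (w - a) = (f_ i w - f_ i a - D i * (w - a)) +
    (f_ i a - f a - (f_ i w - f w) + (D i - l) * (w - a)) by ring.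
apply: le_trans (cmodD _ _) (lerD T1 _).
apply: le_trans (cmodD _ _) _; rewrite cmodM.
have h3 := cmodB (f_ i a - f a) (f_ i w - f w).
have h4 := ler_wpM2r (cmod_ge0 (w - a)) (ltW ml); lra.
Qed.

End Schwarz.

(** * Derivatives of holomorphic functions *)

Section HolomorphicFunctions.
Variable R : realType.
Local Notation C := R[i].
Local Notation Re := complex.Re.
Local Notation Im := complex.Im.
Local Notation ii := (Complex 0 1 : C).

Lemma holomorphicE (U : set C) (f : C -> C) : holomorphic U f <-> hol U f.
Proof. by split=> hf z /hf; [move=> /derivable_cdiff|move=> /derivable_cdiff]. Qed.

Definition cderiv (f : C -> C) (z : C) : C := xget 0 [set l | cdiff f z l].

Lemma cderivP (f : C -> C) z : (exists l, cdiff f z l) -> cdiff f z (cderiv f z).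
Proof. by move=> [l dl]; rewrite /cderiv; case: xgetP => [y _ //|/(_ l)]. Qed.

Lemma cderivE f z l : cdiff f z l -> cderiv f z = l.
Proof. by move=> dl; exact: (cdiff_unique (cderivP (ex_intro _ l dl)) dl). Qed.

Lemma hol_cont (U : set C) (f : C -> C) z : hol U f -> U z -> {for z, continuous f}.
Proof. by move=> hf /hf [l]; exact: cdiff_cont. Qed.

(** The derivative is the pointwise limit of difference quotients with real
    increments, and these are holomorphic and bounded by a Lipschitz constant. *)
Theorem hol_deriv (U : set C) (f : C -> C) : open U -> hol U f -> hol U (cderiv f).
Proof.
move=> oU hf a Ua.
have [r1 r10 s1] := openCP oU Ua.
have [r2 r20 s2] := (continuousCC f a).1 (hol_cont hf Ua) 1 ltr01.
pose r := Num.min r1 r2; pose M := cmod (f a) + 1.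
have r0 : 0 < r by rewrite lt_min r10.
have df : hol (cball a r) f.
  by move=> z; rewrite cballE lt_min => /andP[h1 _]; apply: hf; exact: s1.
have bf z : cball a r z -> cmod (f z) <= M.
  rewrite cballE lt_min => /andP[_ /s2 h]; have := cmod_le_add (f z) (f a).
  by rewrite /M; lra.
have r8 : 0 < r / 8 by rewrite divr_gt0.
pose f_ (h : R) z := (f (z + Complex h 0) - f z) / Complex h 0.
have ch (h : R) : 0 < h -> cmod (Complex h 0) = h.
  by move=> h0; rewrite cmod_Creal gtr0_norm.
have ch0 (h : R) : 0 < h -> Complex h 0 != 0 :> C.
  by move=> h0; rewrite -cmod_gt0 ch.
have sub h z : 0 < h < r / 8 -> cball a (r / 8) z ->
    cball a (r / 4) (z + Complex h 0) /\ cball a (r / 4) z.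
  move=> /andP[h0 hr]; rewrite !cballE => za; split; last by lra.
  have := cmod_tri z (z + Complex h 0) a.
  by rewrite [z + _ - z]addrC addKr ch //; lra.
have sub4 z : cball a (r / 4) z -> cball a r z by rewrite !cballE; lra.
have near8 : \forall h \near (0 : R)^'+, 0 < h < r / 8.
  near=> h; apply/andP; split; near: h; first exact: nbhs_right_gt.
  exact: nbhs_right_lt.
apply: (@limit_holomorphic R R (0^'+) f_ (cderiv f) a (r / 8) (4 * M / r)) => //.
  apply: filterS near8 => h hr; have /andP[h0 _] := hr; split=> z za;
    have [z1 z2] := sub h z hr za.
    have [l1 d1] := df _ (sub4 _ z1); have [l2 d2] := df _ (sub4 _ z2).
    exists ((Complex h 0)^-1 * (l1 - l2)).
    have -> : f_ h = fun w => (Complex h 0)^-1 * (f (w + Complex h 0) - f w).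
      by apply/funext => w; rewrite mulrC.
    by apply: cdiffZ; apply: cdiffB => //; exact: cdiff_shift_real.
  have := hol_lipschitz r0 df bf z1 z2.
  rewrite [z + _ - z]addrC addKr ch // => h1.
  by rewrite /f_ cmod_div ch // ler_pdivrMr.
move=> z za e e0.
have zr : cball a r z by move: za; rewrite !cballE; lra.
have e20 : 0 < e / 2 by rewrite divr_gt0.
have [d d0 sd] := cderivP (df z zr) e20.
have neard : \forall h \near (0 : R)^'+, 0 < h < d.
  near=> h; apply/andP; split; near: h; first exact: nbhs_right_gt.
  exact: nbhs_right_lt.
apply: filterS neard => h /andP[h0 hd].
have := sd (z + Complex h 0); rewrite [z + _ - z]addrC addKr ch // => /(_ hd) h1.
have -> : f_ h z - cderiv f z =
    (f (z + Complex h 0) - f z - cderiv f z * Complex h 0) / Complex h 0.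
  by rewrite /f_; field; exact: ch0.
rewrite cmod_div ch // ltr_pdivrMr //; apply: le_lt_trans h1 _.
by rewrite ltr_pM2r //; lra.
Unshelve. all: by end_near. Qed.

(** * Logarithms and their real parts *)

Lemma ln_cmod (z : C) : z != 0 -> ln (cmod z) = ln (Re z ^+ 2 + Im z ^+ 2) / 2.
Proof.
move=> z0; have c0 : 0 < cmod z by rewrite cmod_gt0.
by rewrite -cmod_sqr lnXn // mulr2n; lra.
Qed.

Lemma div_conj (z w : C) : w != 0 ->
  Re (z / w) = (Re z * Re w + Im z * Im w) / (Re w ^+ 2 + Im w ^+ 2) /\
  Im (z / w) = (Im z * Re w - Re z * Im w) / (Re w ^+ 2 + Im w ^+ 2).
Proof.
move=> w0; have n0 : Re w ^+ 2 + Im w ^+ 2 != 0.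
  by rewrite -cmod_sqr gt_eqF // exprn_gt0 // cmod_gt0.
rewrite recM imcM; case: w w0 n0 => c d w0 n0 /=.
by split; field.
Qed.

Lemma is_derive_ln_sq (u v : R -> R) (s du dv : R) : u s ^+ 2 + v s ^+ 2 != 0 ->
  is_derive s 1 u du -> is_derive s 1 v dv ->
  is_derive s 1 (fun t => ln (u t ^+ 2 + v t ^+ 2) / 2)
    ((du * u s + dv * v s) / (u s ^+ 2 + v s ^+ 2)).
Proof.
move=> n0 hu hv.
have p0 : 0 < u s ^+ 2 + v s ^+ 2 by rewrite lt_def n0 addr_ge0 ?sqr_ge0.
have d1 : is_derive s 1 (fun t => u t ^+ 2 + v t ^+ 2) (2 * u s * du + 2 * v s * dv).
  by apply: is_derive_eq; rewrite /GRing.scale /=; ring.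
have d2 := @is_derive1_comp R (@ln R) (fun t => u t ^+ 2 + v t ^+ 2) s _ _
  (is_derive1_ln p0) d1.
have d3 : is_derive s 1 (fun t => 2^-1 * ln (u t ^+ 2 + v t ^+ 2))
    (2^-1 * ((u s ^+ 2 + v s ^+ 2)^-1 * (2 * u s * du + 2 * v s * dv))).
  exact: (is_deriveZ _ d2).
have -> : (fun t => ln (u t ^+ 2 + v t ^+ 2) / 2) =
  (fun t => 2^-1 * ln (u t ^+ 2 + v t ^+ 2)) by apply/funext => t; rewrite mulrC.
by apply: is_derive_eq d3 _; field.
Qed.

Lemma near_line_x (U : set C) (x y : R) : nbhs (Complex x y : C) U ->
  \forall t \near x, U (Complex t y).
Proof.
move=> /nbhsC [r r0 sub]; apply/nbhs_ballP; exists r => // t.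
rewrite -ball_normE /= distrC => tx; apply: sub.
by rewrite cballE cmod_hor.
Qed.

Lemma near_line_y (U : set C) (x y : R) : nbhs (Complex x y : C) U ->
  \forall t \near y, U (Complex x t).
Proof.
move=> /nbhsC [r r0 sub]; apply/nbhs_ballP; exists r => // t.
rewrite -ball_normE /= distrC => tx; apply: sub.
by rewrite cballE cmod_ver.
Qed.

Lemma nbhs_neq0 (f : C -> C) (z : C) : {for z, continuous f} -> f z != 0 ->
  nbhs z [set w | f w != 0].
Proof.
move=> cf fz; have c0 : 0 < cmod (f z) by rewrite cmod_gt0.
have [d d0 sd] := (continuousCC f z).1 cf _ c0.
apply/nbhsC; exists d => // w /sd h /=; apply: contraTneq h => ->.
by rewrite sub0r cmodN ltxx.
Qed.

Lemma ln_cmod_dx (f : C -> C) (x y : R) l : cdiff f (Complex x y) l ->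
  f (Complex x y) != 0 ->
  is_derive x 1 (fun t => ln (cmod (f (Complex t y)))) (Re (l / f (Complex x y))).
Proof.
move=> df f0; have nz := near_line_x (nbhs_neq0 (cdiff_cont df) f0).
apply: (near_eq_is_derive (f := fun t => ln (Re (f (Complex t y)) ^+ 2 +
    Im (f (Complex t y)) ^+ 2) / 2)).
  by apply: filterS nz => t ft; rewrite ln_cmod.
rewrite (div_conj l f0).1.
apply: is_derive_ln_sq; [|exact: cdiff_Re_dx|exact: cdiff_Im_dx].
by rewrite -cmod_sqr gt_eqF // exprn_gt0 // cmod_gt0.
Qed.

Lemma ln_cmod_dy (f : C -> C) (x y : R) l : cdiff f (Complex x y) l ->
  f (Complex x y) != 0 ->
  is_derive y 1 (fun t => ln (cmod (f (Complex x t)))) (- Im (l / f (Complex x y))).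
Proof.
move=> df f0; have nz := near_line_y (nbhs_neq0 (cdiff_cont df) f0).
apply: (near_eq_is_derive (f := fun t => ln (Re (f (Complex x t)) ^+ 2 +
    Im (f (Complex x t)) ^+ 2) / 2)).
  by apply: filterS nz => t ft; rewrite ln_cmod.
rewrite (div_conj l f0).2 -mulNr opprB [X in X / _](_ : _ =
  (- Im l) * Re (f (Complex x y)) + Re l * Im (f (Complex x y))); last by ring.
apply: is_derive_ln_sq; [|exact: cdiff_Re_dy|exact: cdiff_Im_dy].
by rewrite -cmod_sqr gt_eqF // exprn_gt0 // cmod_gt0.
Qed.

(** A branch of [log f] on a disk; only its real part is recorded, which
    avoids the complex exponential. *)
Lemma log_branch (f : C -> C) (a : C) (r r0 : R) : 0 < r -> r < r0 ->
  hol (cball a r0) f -> (forall z, cball a r0 z -> f z != 0) ->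
  exists L, hol (cball a r) L /\ forall z, cball a r z -> Re (L z) = ln (cmod (f z)).
Proof.
move=> rp rr0 hf f0.
have hf' := hol_deriv (@cball_open _ a r0) hf.
have hq : hol (cball a r0) (fun z => cderiv f z / f z).
  move=> z za; have [l1 d1] := hf' z za; have [l2 d2] := hf z za.
  by eexists; apply: (cdiff_div (f0 z za) d1 d2).
have [L dL] := primitive_ball rp rr0 hq.
pose k z := Re (L z) - ln (cmod (f z)).
have sub z : cball a r z -> cball a r0 z by rewrite !cballE; lra.
have kx x y : cball a r (Complex x y) ->
    is_derive x 1 (fun t => k (Complex t y)) 0.
  move=> za; have d1 := cdiff_Re_dx (dL _ za).
  have d2 := ln_cmod_dx (cderivP (hf _ (sub _ za))) (f0 _ (sub _ za)).
  by have := is_deriveB d1 d2; rewrite subrr.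
have ky x y : cball a r (Complex x y) ->
    is_derive y 1 (fun t => k (Complex x t)) 0.
  move=> za; have d1 := cdiff_Re_dy (dL _ za).
  have d2 := ln_cmod_dy (cderivP (hf _ (sub _ za))) (f0 _ (sub _ za)).
  by have := is_deriveB d1 d2; rewrite subrr.
have kc z : cball a r z -> k z = k a.
  case: z => x y za.
  have -> : k (Complex x y) = k (Complex x (Im a)).
    apply: (@derive0_cst _ (fun t => k (Complex x t))) => t /between_dist ht.
    by apply: ky; apply: cball_box za _ ht.
  rewrite -[in RHS](Complex_eta a).
  apply: (@derive0_cst _ (fun t => k (Complex t (Im a)))) => t /between_dist ht.
  by apply: kx; apply: cball_box za ht _; rewrite subrr normr0.
exists (fun z => L z - Complex (k a) 0); split.
  move=> z za; eexists; apply: cdiffB (dL z za) (cdiff_cst _ _).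
by move=> z za; rewrite recB /= -(kc z za) /k; lra.
Qed.

(** * Schwarz-Pick and Harnack *)

Definition mob (w z : C) : C := (z - w) / (1 - conjc w * z).
(** The pseudo-hyperbolic distance, the hyperbolic tangent of the hyperbolic
    distance. *)
Definition rho (z w : C) : R := cmod (mob w z).

Lemma conjcE (z : C) : Re (conjc z) = Re z /\ Im (conjc z) = - Im z.
Proof. by case: z. Qed.

Lemma conjc_mul (z w : C) : conjc (z * w) = conjc z * conjc w.
Proof.
apply: complex_ext.
  rewrite (conjcE (_ * _)).1 !recM (conjcE z).1 (conjcE z).2.
  by rewrite (conjcE w).1 (conjcE w).2; ring.
rewrite (conjcE (_ * _)).2 !imcM (conjcE z).1 (conjcE z).2.
by rewrite (conjcE w).1 (conjcE w).2; ring.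
Qed.

Lemma conjc_divr (z : C) (r : R) : conjc (z / (r%:C)%C) = conjc z / (r%:C)%C.
Proof.
rewrite conjc_mul -fmorphV; congr (_ * _).
by apply: complex_ext => //=; rewrite oppr0.
Qed.

Lemma mob_identity (z w : C) :
  cmod (1 - conjc w * z) ^+ 2 - cmod (z - w) ^+ 2 =
  (1 - cmod z ^+ 2) * (1 - cmod w ^+ 2).
Proof.
rewrite !cmod_sqr !recB !imcB recM imcM (conjcE w).1 (conjcE w).2 /=; ring.
Qed.

Lemma disk_sq (z : C) : disk z -> 0 < 1 - cmod z ^+ 2.
Proof. by move=> hz; rewrite subr_gt0 expr_lt1 ?cmod_ge0. Qed.

Lemma mob_den (z w : C) : disk z -> disk w -> 1 - conjc w * z != 0.
Proof.
move=> hz hw; rewrite -cmod_gt0 -(@ltr_pXn2r _ 2) ?nnegrE ?cmod_ge0 //.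
have := mob_identity z w; have := mulr_gt0 (disk_sq hz) (disk_sq hw).
have := sqr_ge0 (cmod (z - w)); rewrite expr0n /=; lra.
Qed.

Lemma one_sub_rho2 (z w : C) : disk z -> disk w ->
  1 - rho z w ^+ 2 = (1 - cmod z ^+ 2) * (1 - cmod w ^+ 2) /
    cmod (1 - conjc w * z) ^+ 2.
Proof.
move=> hz hw; rewrite -mob_identity /rho /mob cmod_div; field.
by rewrite gt_eqF // cmod_gt0 mob_den.
Qed.

Lemma rho_ge0 z w : 0 <= rho z w. Proof. exact: cmod_ge0. Qed.

Lemma rho_lt1 (z w : C) : disk z -> disk w -> rho z w < 1.
Proof.
move=> hz hw; rewrite -(@ltr_pXn2r _ 2) ?nnegrE ?rho_ge0 // expr1n -subr_gt0.
by rewrite one_sub_rho2 // divr_gt0 ?mulr_gt0 ?disk_sq ?exprn_gt0 ?cmod_gt0 ?mob_den.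
Qed.

Lemma rhoC (z w : C) : rho z w = rho w z.
Proof.
rewrite /rho /mob !cmod_div cmodBC; congr (_ / _).
rewrite -[RHS]cmod_conj; congr cmod; apply: complex_ext.
  rewrite (conjcE (1 - _)).1 !recB !recM (conjcE z).1 (conjcE z).2.
  by rewrite (conjcE w).1 (conjcE w).2; ring.
rewrite (conjcE (1 - _)).2 !imcB !imcM (conjcE z).1 (conjcE z).2.
by rewrite (conjcE w).1 (conjcE w).2 /=; ring.
Qed.

Lemma rhoxx z : rho z z = 0.
Proof. by rewrite /rho /mob subrr mul0r cmod0. Qed.

Lemma mob_disk (w z : C) : disk w -> disk z -> disk (mob w z).
Proof. by move=> hw hz; exact: rho_lt1. Qed.

Lemma diskN (w : C) : disk w -> disk (- w).
Proof. by rewrite /disk /= cmodN. Qed.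

Lemma mobK (w z : C) : disk w -> disk z -> mob (- w) (mob w z) = z.
Proof.
move=> hw hz; have d0 := mob_den hz hw.
have w20 : 1 - w * conjc w != 0.
  rewrite mul_conj -cmod_gt0 -(rmorph1 (real_complex R)) -rmorphB cmod_real.
  by rewrite normr_gt0 gt_eqF // disk_sq.
rewrite /mob rmorphN mulNr !opprK.
have E1 : (z - w) / (1 - conjc w * z) + w = z * (1 - w * conjc w) / (1 - conjc w * z).
  by field.
have E2 : 1 + conjc w * ((z - w) / (1 - conjc w * z)) =
    (1 - w * conjc w) / (1 - conjc w * z) by field.
by rewrite E1 E2; field; rewrite d0 w20.
Qed.

Lemma mob0 (w : C) : mob (- w) 0 = w.
Proof. by rewrite /mob mulr0 subr0 divr1 sub0r opprK. Qed.

Lemma disk_ball (z : C) : disk z = cball 0 1 z.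
Proof. by rewrite cballE subr0. Qed.

Lemma disk_open : open (@disk R).
Proof.
have -> : @disk R = cball 0 1 by apply/seteqP; split => z; rewrite disk_ball.
exact: cball_open.
Qed.

Lemma mob_hol (w z : C) : disk w -> disk z -> exists l, cdiff (mob w) z l.
Proof.
move=> hw hz; eexists; apply: (cdiff_div (f := fun z => z - w)
  (g := fun z => 1 - conjc w * z) (mob_den hz hw)).
  by apply: cdiffB; [exact: cdiff_id|exact: cdiff_cst].
by apply: cdiffB; [exact: cdiff_cst|apply: cdiffZ; exact: cdiff_id].
Qed.

Lemma hol_comp (U V : set C) (f g : C -> C) : hol U f -> hol V g ->
  (forall z, U z -> V (f z)) -> hol U (fun z => g (f z)).
Proof.
move=> hf hg UV z Uz; have [l dl] := hf z Uz; have [m dm] := hg _ (UV _ Uz).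
by exists (m * l); exact: cdiff_comp.
Qed.

(** The Schwarz lemma after the Moebius map that moves the zero to the origin. *)
Lemma schwarz_pick0 (h : C -> C) (w : C) : hol (@disk R) h ->
  (forall z, disk z -> cmod (h z) <= 1) -> disk w -> h w = 0 ->
  forall z, disk z -> cmod (h z) <= rho z w.
Proof.
move=> hh bh hw hw0 z hz.
pose g u := h (mob (- w) u).
have hg : hol (cball 0 1) g.
  apply: hol_comp hh _ => [u|u]; rewrite -disk_ball => hu.
    by apply: mob_hol => //; exact: diskN.
  by apply: mob_disk => //; exact: diskN.
have g0 : g 0 = 0 by rewrite /g mob0.
have gb u : cball 0 1 u -> cmod (g u - g 0) <= 1.
  rewrite -disk_ball g0 subr0 => hu; apply: bh; apply: mob_disk => //.
  exact: diskN.
have := schwarz hg gb (z := mob w z); rewrite -disk_ball => /(_ (mob_disk hw hz)).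
by rewrite g0 !subr0 mulr1 mul1r /g mobK.
Qed.

Theorem schwarz_pick (f : C -> C) (z w : C) : hol (@disk R) f ->
  (forall u, disk u -> disk (f u)) -> disk z -> disk w ->
  rho (f z) (f w) <= rho z w.
Proof.
move=> hf fd hz hw; apply: (@schwarz_pick0 (fun u => mob (f w) (f u))) => //.
- apply: (hol_comp hf (V := @disk R)) => // u hu; apply: mob_hol => //.
  exact: fd.
- by move=> u hu; apply/ltW/mob_disk; exact: fd.
- by rewrite /mob subrr mul0r.
Qed.

Lemma schwarz_pick_ball (f : C -> C) (a : C) (r : R) z : hol (cball a r) f ->
  (forall u, cball a r u -> disk (f u)) -> cball a r z ->
  rho (f z) (f a) * r <= cmod (z - a).
Proof.
move=> hf fd za; have r0 : 0 < r by exact: le_lt_trans (cmod_ge0 _) za.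
have fa := fd a (cballxx a r0).
have m0 : mob (f a) (f a) = 0 by rewrite /mob subrr mul0r.
have := @schwarz _ (fun u => mob (f a) (f u)) a r 1 _ _ z za.
rewrite m0 subr0 mul1r; apply.
  by apply: (hol_comp hf (V := @disk R)) => // u hu; exact: mob_hol.
by move=> u /fd fu; rewrite subr0; apply/ltW/mob_disk.
Qed.

(** [|A - B| / |A + conj B|] is the pseudo-hyperbolic distance of the left
    half-plane, where equal imaginary parts are the worst case. *)
Lemma half_plane_ineq (A B : C) (s : R) : 0 <= s -> s <= 1 ->
  Re A < 0 -> Re B < 0 -> cmod (A - B) <= s * cmod (A + conjc B) ->
  - Re A + Re B <= s * (- Re A - Re B).
Proof.
move=> s0 s1 A0 B0 h.
have h2 : cmod (A - B) ^+ 2 <= s ^+ 2 * cmod (A + conjc B) ^+ 2.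
  by rewrite -exprMn lerXn2r ?nnegrE ?mulr_ge0 ?cmod_ge0.
rewrite !cmod_sqr recB imcB recD imcD (conjcE B).1 (conjcE B).2 in h2.
have s2 : s ^+ 2 <= 1 by rewrite expr_le1.
have h3 : (- Re A + Re B) ^+ 2 <= (s * (- Re A - Re B)) ^+ 2.
  have := mulr_ge0 (_ : 0 <= 1 - s ^+ 2) (sqr_ge0 (Im A - Im B)).
  by rewrite subr_ge0 => /(_ s2); rewrite exprMn; nra.
have t0 : 0 <= s * (- Re A - Re B) by rewrite mulr_ge0 //; lra.
have [n0|p0] := leP (- Re A + Re B) 0; first by lra.
by move: h3; rewrite ler_pXn2r // nnegrE ltW.
Qed.

(** Harnack's inequality for the positive harmonic function [- log |f|]: a
    branch of [log f] maps the disk into a half-plane, where the Schwarz-Pick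
    lemma bounds quotients of real parts.  Branches exist on smaller disks, so
    the radius tends to [1]. *)
Theorem harnack (f : C -> C) (z w : C) : hol (@disk R) f ->
  (forall u, disk u -> 0 < cmod (f u) < 1) -> disk z -> disk w ->
  (1 - rho z w) * - ln (cmod (f z)) <= 2 * - ln (cmod (f w)).
Proof.
move=> hf fd hz hw.
set al := - ln (cmod (f z)); set be := - ln (cmod (f w)).
have lnn u : disk u -> ln (cmod (f u)) < 0.
  by move=> /fd /andP[? ?]; apply: ln_lt0; apply/andP.
have al0 : 0 < al by rewrite /al oppr_gt0 lnn.
have be0 : 0 < be by rewrite /be oppr_gt0 lnn.
have hf1 : hol (cball 0 1) f by move=> u; rewrite -disk_ball; exact: hf.
have key (r : R) : Num.max (cmod z) (cmod w) < r -> r < 1 ->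
    (al - be) * cmod ((r ^+ 2)%:C%C - conjc w * z) <= r * cmod (z - w) * (al + be).
  rewrite gt_max => /andP[zr wr] r1.
  have r0 : 0 < r by exact: le_lt_trans (cmod_ge0 _) zr.
  have rC0 : (r%:C)%C != 0 :> C by rewrite -cmod_gt0 cmod_real normr_gt0 gt_eqF.
  have [|L [hL LE]] := log_branch r0 r1 hf1.
    by move=> u; rewrite -disk_ball => /fd /andP[+ _]; rewrite cmod_gt0.
  have inr u : disk u -> cball 0 r (r%:C%C * u).
    rewrite cballE subr0 cmodM cmod_real gtr0_norm // => hu.
    by rewrite gtr_pMr.
  have Lneg u : disk u -> Re (L (r%:C%C * u)) < 0.
    move=> hu; rewrite LE; last exact: inr.
    apply: lnn; rewrite disk_ball cballE; have := inr u hu; rewrite cballE; lra.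
  pose z' := z / r%:C%C; pose w' := w / r%:C%C.
  have hz' : disk z'.
    by rewrite /disk /mkset /z' cmod_div cmod_real gtr0_norm // ltr_pdivrMr // mul1r.
  have hw' : disk w'.
    by rewrite /disk /mkset /w' cmod_div cmod_real gtr0_norm // ltr_pdivrMr // mul1r.
  have zE : r%:C%C * z' = z by rewrite /z' mulrC divfK.
  have wE : r%:C%C * w' = w by rewrite /w' mulrC divfK.
  pose B := L w.
  have B0 : Re B < 0 by rewrite /B -wE; exact: Lneg.
  have den u : disk u -> L (r%:C%C * u) + conjc B != 0.
    move=> hu; apply/negP => /eqP E; have := congr1 (@complex.Re R) E.
    by rewrite recD (conjcE B).1 /=; have := Lneg u hu; lra.
  pose h u := (L (r%:C%C * u) - B) / (L (r%:C%C * u) + conjc B).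
  have hh : hol (@disk R) h.
    move=> u hu; have [l dl] := hL _ (inr u hu).
    have dc : cdiff (fun u => L (r%:C%C * u)) u (l * (r%:C%C * 1)).
      by apply: cdiff_comp dl; apply: cdiffZ; exact: cdiff_id.
    eexists; apply: (cdiff_div (f := fun u => L (r%:C%C * u) - B)
      (g := fun u => L (r%:C%C * u) + conjc B) (den u hu)).
      by apply: cdiffB dc (cdiff_cst _ _).
    by apply: cdiffD dc (cdiff_cst _ _).
  have hb u : disk u -> cmod (h u) <= 1.
    move=> hu; rewrite /h cmod_div ler_pdivrMr ?cmod_gt0 ?den // mul1r.
    rewrite -(@ler_pXn2r _ 2) ?nnegrE ?cmod_ge0 // !cmod_sqr recB imcB recD imcD.
    by rewrite (conjcE B).1 (conjcE B).2; have := Lneg u hu; nra.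
  have h0 : h w' = 0 by rewrite /h wE -/B subrr mul0r.
  have := schwarz_pick0 hh hb hw' h0 hz'; rewrite /h zE cmod_div.
  rewrite ler_pdivrMr ?cmod_gt0; last by have := den z' hz'; rewrite zE.
  move=> hA.
  have LzE : Re (L z) = - al.
    by rewrite LE /al ?opprK //; have := inr z' hz'; rewrite zE.
  have BE : Re B = - be.
    by rewrite /B LE /be ?opprK //; have := inr w' hw'; rewrite wE.
  have A0 : Re (L z) < 0 by rewrite LzE oppr_lt0.
  have := half_plane_ineq (rho_ge0 _ _) (ltW (rho_lt1 hz' hw')) A0 B0 hA.
  rewrite LzE BE !opprK.
  have E0 : 1 - conjc w' * z' = ((r ^+ 2)%:C%C - conjc w * z) / r%:C%C ^+ 2.
    by rewrite /z' /w' conjc_divr rmorphXn /=; field.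
  have dn : (r ^+ 2)%:C%C - conjc w * z != 0.
    by have := mob_den hz' hw'; apply: contraNN => /eqP E; rewrite E0 E mul0r.
  have -> : rho z' w' = r * cmod (z - w) / cmod ((r ^+ 2)%:C%C - conjc w * z).
    rewrite /rho /mob E0 /z' /w' -mulrBl.
    have -> : r * cmod (z - w) = cmod (r%:C%C * (z - w)).
      by rewrite cmodM cmod_real gtr0_norm.
    rewrite -cmod_div; congr cmod.
    by move: dn; set D := (r ^+ 2)%:C%C - conjc w * z => dn; field; rewrite dn rC0.
  have dn' : 0 < cmod ((r ^+ 2)%:C%C - conjc w * z) by rewrite cmod_gt0.
  rewrite mulrAC ler_pdivlMr //; lra.
have main : (al - be) * cmod (1 - conjc w * z) <= cmod (z - w) * (al + be).
  have [le|gt] := leP al be.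
    apply: (@le_trans _ _ 0); first by rewrite mulr_le0_ge0 ?cmod_ge0 //; lra.
    by rewrite mulr_ge0 ?cmod_ge0 //; lra.
  apply/ler_addgt0Pr => e e0.
  pose m := Num.max (cmod z) (cmod w).
  have m1 : m < 1 by rewrite /m gt_max; apply/andP.
  have m0 : 0 <= m by rewrite /m le_max cmod_ge0.
  have ab0 : 0 < al - be by rewrite subr_gt0.
  pose r := Num.max ((1 + m) / 2) (1 - e / (2 * (al - be))).
  have mr : m < r by rewrite /r lt_max; apply/orP; left; lra.
  have r1 : r < 1.
    rewrite /r gt_max; apply/andP; split; first by lra.
    by rewrite gtrBl divr_gt0 // mulr_gt0.
  have re : 1 - e / (2 * (al - be)) <= r by rewrite /r le_max lexx orbT.
  have r0 : 0 < r by lra.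
  have := key r mr r1.
  have h1 := cmod_le_add (1 - conjc w * z) ((r ^+ 2)%:C%C - conjc w * z).
  have E : 1 - conjc w * z - ((r ^+ 2)%:C%C - conjc w * z) = (1 - r ^+ 2)%:C%C.
    by rewrite rmorphB rmorph1; ring.
  have r21 : 0 <= 1 - r ^+ 2 by rewrite subr_ge0 expr_le1 // ltW.
  rewrite E cmod_real ger0_norm // in h1.
  have h2 : (al - be) * (1 - r ^+ 2) <= e.
    have : 1 - r ^+ 2 <= e / (al - be).
      have -> : e / (al - be) = 2 * (e / (2 * (al - be))).
        by field; rewrite gt_eqF.
      by nra.
    by rewrite ler_pdivlMr // mulrC.
  have h3 : r * cmod (z - w) * (al + be) <= cmod (z - w) * (al + be).
    rewrite -mulrA ler_piMl ?(ltW r1) // mulr_ge0 ?cmod_ge0 //; lra.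
  have := ler_wpM2l (ltW ab0) h1; rewrite mulrDr; lra.
have dn : 0 < cmod (1 - conjc w * z) by rewrite cmod_gt0 mob_den.
have : al - be <= rho z w * (al + be).
  rewrite /rho /mob cmod_div mulrAC ler_pdivlMr //.
have := rho_lt1 hz hw; nra.
Qed.

(** * Harmonicity of [log |f|] *)

Lemma C1_Re (U : set C) (q : C -> C) (v : C -> R) : open U -> hol U q ->
  (forall z, U z -> v z = Re (q z)) ->
  C1_on U v /\ forall z, U z ->
    dx v z = Re (cderiv q z) /\ dy v z = - Im (cderiv q z).
Proof.
move=> oU hq vE.
have ddx z : U z -> is_derive (Re z) 1 (fun t => v (Complex t (Im z))) (Re (cderiv q z)).
  case: z => x y Uz /=; apply: (near_eq_is_derive (f := fun t => Re (q (Complex t y)))).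
    have /near_line_x : nbhs (Complex x y) U by rewrite openE in oU; exact: oU.
    by apply: filterS => t /vE ->.
  exact: cdiff_Re_dx (cderivP (hq _ Uz)).
have ddy z : U z -> is_derive (Im z) 1 (fun t => v (Complex (Re z) t)) (- Im (cderiv q z)).
  case: z => x y Uz /=; apply: (near_eq_is_derive (f := fun t => Re (q (Complex x t)))).
    have /near_line_y : nbhs (Complex x y) U by rewrite openE in oU; exact: oU.
    by apply: filterS => t /vE ->.
  exact: cdiff_Re_dy (cderivP (hq _ Uz)).
have dxE z : U z -> dx v z = Re (cderiv q z).
  by move=> Uz; rewrite /dx derive1E; have [_] := ddx z Uz.
have dyE z : U z -> dy v z = - Im (cderiv q z).
  by move=> Uz; rewrite /dy derive1E; have [_] := ddy z Uz.
split=> [z Uz|z Uz]; last by rewrite dxE ?dyE.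
have cq := hol_cont (hol_deriv oU hq) Uz.
have [r r0 sub] := openCP oU Uz.
split; [by have [] := ddx z Uz|by have [] := ddy z Uz| |].
  apply/continuousCR => e /(proj1 (continuousCC _ _) cq) [d d0 sd].
  exists (Num.min d r); first by rewrite lt_min d0.
  move=> w; rewrite lt_min => /andP[wd wr]; rewrite !dxE //; last exact: sub.
  by rewrite -recB; apply: le_lt_trans (Re_le_cmod _) (sd w wd).
apply/continuousCR => e /(proj1 (continuousCC _ _) cq) [d d0 sd].
exists (Num.min d r); first by rewrite lt_min d0.
move=> w; rewrite lt_min => /andP[wd wr]; rewrite !dyE //; last exact: sub.
rewrite -opprD normrN -imcB; apply: le_lt_trans (Im_le_cmod _) (sd w wd).
Qed.

(** The partial derivatives of [log |f|] are real parts of multiples of the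
    holomorphic function [f' / f]. *)
Theorem harmonic_ln_cmod (U : set C) (f : C -> C) : open U -> hol U f ->
  (forall z, U z -> f z != 0) -> harmonic_on U (fun z => ln (cmod (f z))).
Proof.
move=> oU hf f0; set u := fun z => _.
pose q z := cderiv f z / f z.
have hq : hol U q.
  move=> z Uz; have [l1 d1] := hol_deriv oU hf Uz; have [l2 d2] := hf z Uz.
  by eexists; apply: (cdiff_div (f0 z Uz) d1 d2).
have ddx z : U z -> is_derive (Re z) 1 (fun t => u (Complex t (Im z))) (Re (q z)).
  case: z => x y Uz /=.
  exact: ln_cmod_dx (cderivP (hf _ Uz)) (f0 _ Uz).
have ddy z : U z -> is_derive (Im z) 1 (fun t => u (Complex (Re z) t)) (- Im (q z)).
  case: z => x y Uz /=.
  exact: ln_cmod_dy (cderivP (hf _ Uz)) (f0 _ Uz).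
have dxE z : U z -> dx u z = Re (q z).
  by move=> Uz; rewrite /dx derive1E; have [_] := ddx z Uz.
have dyE z : U z -> dy u z = Re (ii * q z).
  by move=> Uz; rewrite /dy derive1E ii_mul /=; have [_] := ddy z Uz.
have hiq : hol U (fun z => ii * q z).
  by move=> z /hq [l dl]; exists (ii * l); exact: cdiffZ.
have [C1 E1] := C1_Re oU hq dxE.
have [C2 E2] := C1_Re oU hiq dyE.
split; [move=> z Uz|exact: C1|exact: C2|move=> z Uz]; last first.
  rewrite (E1 z Uz).1 (E2 z Uz).2.
  have -> : cderiv (fun z => ii * q z) z = ii * cderiv q z.
    by apply: cderivE; apply: cdiffZ; exact: cderivP (hq z Uz).
  by rewrite ii_mul /= subrr.
have [r r0 sub] := openCP oU Uz.
split; [by have [] := ddx z Uz|by have [] := ddy z Uz| |].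
  apply/continuousCR => e /(proj1 (continuousCC _ _) (hol_cont hq Uz)) [d d0 sd].
  exists (Num.min d r); first by rewrite lt_min d0.
  move=> w; rewrite lt_min => /andP[wd wr]; rewrite !dxE //; last exact: sub.
  by rewrite -recB; apply: le_lt_trans (Re_le_cmod _) (sd w wd).
apply/continuousCR => e /(proj1 (continuousCC _ _) (hol_cont hiq Uz)) [d d0 sd].
exists (Num.min d r); first by rewrite lt_min d0.
move=> w; rewrite lt_min => /andP[wd wr]; rewrite !dyE //; last exact: sub.
by rewrite -recB; apply: le_lt_trans (Re_le_cmod _) (sd w wd).
Qed.

End HolomorphicFunctions.

(** * Green functions of subdomains of the disk *)

Section GreenFunctions.
Variable R : realType.
Local Notation C := R[i].
Local Notation Re := complex.Re.
Local Notation Im := complex.Im.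

Lemma C1_dx (U : set C) (u : C -> R) z : C1_on U u -> U z ->
  is_derive (Re z) 1 (fun t => u (Complex t (Im z))) (dx u z).
Proof. by move=> hu /hu [d _ _ _]; apply: DeriveDef => //; rewrite /dx derive1E. Qed.

Lemma C1_dy (U : set C) (u : C -> R) z : C1_on U u -> U z ->
  is_derive (Im z) 1 (fun t => u (Complex (Re z) t)) (dy u z).
Proof. by move=> hu /hu [_ d _ _]; apply: DeriveDef => //; rewrite /dy derive1E. Qed.

Lemma norm_le_add1 (p q : R) : `|p - q| < 1 -> `|p| <= 1 + `|q|.
Proof. by move=> h; have := ler_normD (p - q) q; rewrite subrK; lra. Qed.

(** Harmonicity is phrased with partial derivatives, which alone would not give
    continuity; continuous ones are locally bounded, so the function is
    Lipschitz along axis-parallel paths. *)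
Lemma C1_continuous (U : set C) (u : C -> R) z : open U -> C1_on U u -> U z ->
  {for z, continuous u}.
Proof.
move=> oU hu Uz; have [_ _ cx cy] := hu z Uz.
have [r r0 sub] := openCP oU Uz.
have [d1 d10 s1] := (continuousCR (dx u) z).1 cx 1 ltr01.
have [d2 d20 s2] := (continuousCR (dy u) z).1 cy 1 ltr01.
apply/continuousCR => e e0.
pose B := 1 + `|dx u z| + `|dy u z|.
have B0 : 0 < B by rewrite /B -addrA ltr_wpDr // addr_ge0.
pose m := Num.min (Num.min r (e / B)) (Num.min d1 d2).
have m0 : 0 < m by rewrite !lt_min r0 d10 d20 divr_gt0.
exists (m / 2); first by rewrite divr_gt0.
case: z Uz cx cy sub s1 s2 @B B0 @m m0 => x y Uz cx cy sub s1 s2 B B0 m m0.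
case=> x' y' wz.
have hx : `|x' - x| < m / 2.
  apply: le_lt_trans wz.
  by exact: (Re_dist (Complex x' y') (Complex x y)).
have hy : `|y' - y| < m / 2.
  apply: le_lt_trans wz.
  by exact: (Im_dist (Complex x' y') (Complex x y)).
have near s t : `|s - x| <= `|x' - x| -> `|t - y| <= `|y' - y| ->
    cmod (Complex s t - Complex x y) < m.
  move=> hs ht; apply: le_lt_trans (cmod_le_ReIm _) _; rewrite recB imcB.
  rewrite -[Re _]/s -[Im _]/t -[Re (Complex x y)]/x -[Im (Complex x y)]/y; lra.
have z0 (v : R) : `|v - v| <= 0 :> R by rewrite subrr normr0.
have b1 : `|u (Complex x' y') - u (Complex x y')| <= B * `|x' - x|.
  apply: (@mvt_bound _ (fun t => u (Complex t y')) (fun t => dx u (Complex t y'))).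
    move=> t /between_dist ht; apply: (@C1_dx U u (Complex t y') hu).
    by have := near _ _ ht (lexx _); rewrite !lt_min => /andP[/andP[h _] _]; exact: sub.
  move=> t /between_dist ht.
  have := near _ _ ht (lexx _); rewrite !lt_min => /andP[_ /andP[/s1 h _]].
  by rewrite (le_trans (norm_le_add1 h)) // /B lerDl.
have b2 : `|u (Complex x y') - u (Complex x y)| <= B * `|y' - y|.
  apply: (@mvt_bound _ (fun t => u (Complex x t)) (fun t => dy u (Complex x t))).
    move=> t /between_dist ht; apply: (@C1_dy U u (Complex x t) hu).
    have := near x t; rewrite (le_trans (z0 _)) // => /(_ isT ht).
    by rewrite !lt_min => /andP[/andP[h _] _]; exact: sub.
  move=> t /between_dist ht.
  have := near x t; rewrite (le_trans (z0 _)) // => /(_ isT ht).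
  rewrite !lt_min => /andP[_ /andP[_ /s2 h]].
  by rewrite (le_trans (norm_le_add1 h)) // /B addrAC lerDl.
have -> : u (Complex x' y') - u (Complex x y) = (u (Complex x' y') - u (Complex x y')) +
   (u (Complex x y') - u (Complex x y)) by ring.
apply: le_lt_trans (ler_normD _ _) _.
have : B * m <= e.
  by rewrite mulrC -ler_pdivlMr // /m !ge_min lexx !orbT.
have := ltr_pM2l B0 (`|x' - x|) (m / 2); have := ltr_pM2l B0 (`|y' - y|) (m / 2).
rewrite hx hy; lra.
Qed.

Lemma harmonic_lines (U : set C) (u : C -> R) (x y : R) : open U ->
  harmonic_on U u -> U (Complex x y) ->
  exists2 d : R, 0 < d &
   [/\ forall t, `|t - x| < d ->
         is_derive t 1 (fun s => u (Complex s y)) (dx u (Complex t y)),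
       is_derive x 1 (fun s => dx u (Complex s y)) (dx (dx u) (Complex x y)),
       forall t, `|t - y| < d ->
         is_derive t 1 (fun s => u (Complex x s)) (dy u (Complex x t)) &
       is_derive y 1 (fun s => dy u (Complex x s)) (dy (dy u) (Complex x y))].
Proof.
move=> oU [C0 Cx Cy _] Uz; have [d d0 sub] := openCP oU Uz; exists d; first exact: d0.
split.
- move=> t td; apply: (@C1_dx U u (Complex t y) C0); apply: sub.
  by rewrite cballE cmod_hor.
- exact: (@C1_dx U (dx u) (Complex x y) Cx Uz).
- move=> t td; apply: (@C1_dy U u (Complex x t) C0); apply: sub.
  by rewrite cballE cmod_ver.
- exact: (@C1_dy U (dy u) (Complex x y) Cy Uz).
Qed.

Lemma hol_affine w (c : C) (U : set C) : hol U (fun z => (z - w) * c).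
Proof.
move=> z _; eexists; apply: cdiffM (cdiff_cst c z).
by apply: cdiffB; [exact: cdiff_id|exact: cdiff_cst].
Qed.

Lemma open_neq (w : C) : open [set z : C | z != w].
Proof.
apply/openCE => z /= zw; exists (cmod (z - w)).
  by rewrite cmod_gt0 subr_eq0.
by move=> u; rewrite cballE /=; apply: contraTneq => ->; rewrite cmodBC ltxx.
Qed.

Lemma open_setD1 (D : set C) w : open D -> open (D `\ w).
Proof.
move=> oD; have -> : D `\ w = D `&` [set z | z != w].
  by apply/seteqP; split => z /= [Dz zw]; split => //; apply/eqP.
by apply: openI => //; exact: open_neq.
Qed.

Lemma within_nbhsC (D : set C) (zeta : C) (g : C -> R) (l : R) :
  g z @[z --> within D (nbhs zeta)] --> l <->
  forall e : R, 0 < e -> exists2 d : R, 0 < d &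
    forall z, D z -> cmod (z - zeta) < d -> `|g z - l| < e.
Proof.
split=> [cg e e0|H A /nbhs_ballP [e /= e0 sA]].
  have /nbhsC [d d0 sd] : nbhs zeta [set z | D z -> ball l e (g z)].
    by apply: (cg (ball l e)); exact: nbhsx_ballx.
  by exists d => // z Dz /sd /(_ Dz); rewrite -ball_normE /= distrC.
have [d d0 sd] := H e e0; apply/nbhsC; exists d => // z zd Dz; apply: sA.
by rewrite -ball_normE /= distrC; exact: sd.
Qed.

Lemma notin_closure_ball (D : set C) z : ~ closure D z ->
  exists2 d : R, 0 < d & forall u, cmod (u - z) < d -> ~ D u.
Proof.
move=> ncl; apply: contrapT => N; apply: ncl => B /nbhsC [d d0 sd].
apply: contrapT => E; apply: N; exists d => // u /sd Bu Du.
by apply: E; exists u.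
Qed.

Lemma ln_small (M e : R) : 0 < e -> exists2 d : R, 0 < d &
  forall x, 0 < x < d -> e * ln x < M.
Proof.
move=> e0; exists (expR (M / e)); first exact: expR_gt0.
move=> x /andP[x0 xd]; rewrite mulrC -ltr_pdivlMr //.
by rewrite -ltr_expR lnK.
Qed.

Lemma lap_sum (e a a' b b' c c' : R) : a + a' = 0 -> b + b' = 0 ->
  c + c' = 0 -> a - b + e * (c + 2) + (a' - b' + e * (c' + 2)) = e * 4.
Proof.
move=> h1 h2 h3; transitivity ((a + a') - (b + b') + e * (c + c') + e * 4).
  by ring.
by rewrite h1 h2 h3; ring.
Qed.

(** The term [e |z|^2] has Laplacian [4 e > 0] and the others are harmonic. *)
Lemma no_local_max (U : set C) (u1 u2 u3 : C -> R) (e d0 : R) (z : C) :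
  open U -> harmonic_on U u1 -> harmonic_on U u2 -> harmonic_on U u3 ->
  0 < e -> U z -> 0 < d0 ->
  let v := fun z => u1 z - u2 z + e * (u3 z + cmod z ^+ 2 - 1) in
  (forall w, cball z d0 w -> v w <= v z) -> False.
Proof.
move=> oU h1 h2 h3 e0 Uz d00 v lmax.
case: z Uz lmax => x y Uz lmax.
have [d1 d10 [p1 p2 p3 p4]] := harmonic_lines oU h1 Uz.
have [d2 d20 [q1 q2 q3 q4]] := harmonic_lines oU h2 Uz.
have [d3 d30 [r1 r2 r3 r4]] := harmonic_lines oU h3 Uz.
have vE (t u : R) : v (Complex t u) = u1 (Complex t u) - u2 (Complex t u) +
    e * (u3 (Complex t u) + (t ^+ 2 + u ^+ 2) - 1) by rewrite /v cmod_sqr.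
pose d := Num.min (Num.min d0 d1) (Num.min d2 d3).
have dd : 0 < d by rewrite !lt_min d00 d10 d20 d30.
have Dmul (k m : R -> R) (t dk c : R) : is_derive t 1 k dk -> is_derive t 1 m c ->
  is_derive t 1 (fun s => e * (k s + m s - 1)) (e * (dk + c)).
  move=> hk hm; have := is_deriveZ e (is_deriveB (is_deriveD hk hm)
    (is_derive_cst (1 : R) t (1 : R))).
  by rewrite subr0.
have Dmul2 (k : R -> R) (t dk : R) : is_derive t 1 k dk ->
  is_derive t 1 (fun s => e * (k s + 2 * s)) (e * (dk + 2)).
  move=> hk; have l2 : is_derive t 1 (fun s : R => 2 * s) (2 : R).
    by apply: is_derive_eq; rewrite /GRing.scale /=; ring.
  by have := is_deriveZ e (is_deriveD hk l2).
have sq (c t : R) : is_derive t 1 (fun s => s ^+ 2 + c) (2 * t).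
  by apply: is_derive_eq; rewrite /GRing.scale /=; ring.
have sq' (c t : R) : is_derive t 1 (fun s => c + s ^+ 2) (2 * t).
  by apply: is_derive_eq; rewrite /GRing.scale /=; ring.
have [_ _ _ l1] := h1; have [_ _ _ l2] := h2; have [_ _ _ l3] := h3.
have E1 := l1 _ Uz; have E2 := l2 _ Uz; have E3 := l3 _ Uz.
suff : e * 4 <= 0 by rewrite pmulr_rle0 // leNgt ltr0n.
rewrite -(lap_sum e E1 E2 E3).
have H1 t : `|t - x| < d -> is_derive t 1 (fun s => v (Complex s y))
    (dx u1 (Complex t y) - dx u2 (Complex t y) + e * (dx u3 (Complex t y) + 2 * t)).
  rewrite !lt_min => /andP[/andP[_ t1] /andP[t2 t3]].
  under eq_fun do rewrite vE.
  exact: is_deriveD (is_deriveB (p1 t t1) (q1 t t2)) (Dmul _ _ _ _ _ (r1 t t3) (sq _ _)).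
have H2 := is_deriveD (is_deriveB p2 q2) (Dmul2 _ _ _ r2).
have H3 t : `|t - y| < d -> is_derive t 1 (fun s => v (Complex x s))
    (dy u1 (Complex x t) - dy u2 (Complex x t) + e * (dy u3 (Complex x t) + 2 * t)).
  rewrite !lt_min => /andP[/andP[_ t1] /andP[t2 t3]].
  under eq_fun do rewrite vE.
  exact: is_deriveD (is_deriveB (p3 t t1) (q3 t t2)) (Dmul _ _ _ _ _ (r3 t t3) (sq' _ _)).
have H4 := is_deriveD (is_deriveB p4 q4) (Dmul2 _ _ _ r4).
apply: (local_max_laplacian dd H1 H2 H3 H4) => w.
by rewrite !lt_min => /andP[/andP[wd _] _]; exact: lmax.
Qed.

(** Two Green functions differ by a function that is bounded near the pole and
    vanishes on the boundary; adding the negative, strictly subharmonic function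
    [eps (log (|z - w| / 2) + |z|^2 - 1)], which tends to [-oo] at the pole,
    reduces uniqueness to the absence of interior maxima. *)
Lemma green_le (D : set C) (w : C) (g1 g2 : C -> R) : open D -> D `<=` @disk R ->
  D w -> is_green D w g1 -> is_green D w g2 ->
  forall z, D z -> z <> w -> g1 z <= g2 z.
Proof.
move=> oD Dd Dw [[h1 _] _ [M1 n1] b1] [[h2 _] _ [M2 n2] b2] z1 Dz1 z1w.
rewrite leNgt; apply/negP => lt12.
have oDw := open_setD1 (w := w) oD.
pose f z := (z - w) * (2^-1 : R)%:C%C.
have f0 z : z != w -> f z != 0.
  move=> zw; rewrite mulf_neq0 ?subr_eq0 // -cmod_gt0 cmod_real normr_gt0.
  by rewrite invr_neq0.
have hf : harmonic_on (D `\ w) (fun z => ln (cmod (f z))).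
  apply: harmonic_ln_cmod => //; first exact: hol_affine.
  by move=> z [_ /eqP]; exact: f0.
pose h z := ln (cmod (f z)).
have cf z : cmod (f z) = cmod (z - w) / 2.
  by rewrite /f cmodM cmod_real gtr0_norm.
have bneg z : D z -> z <> w -> h z + cmod z ^+ 2 - 1 < 0.
  move=> Dz /eqP zw; have := Dd z Dz; have := Dd w Dw; rewrite /disk /= => w1 zd.
  have : h z < 0.
    rewrite /h; apply: ln_lt0; rewrite cmod_gt0 f0 //= cf.
    by have := cmodB z w; lra.
  have := disk_sq zd; lra.
pose b z := h z + cmod z ^+ 2 - 1.
pose del := g1 z1 - g2 z1.
have del0 : 0 < del by rewrite subr_gt0.
(* Half of the gap at [z1] survives the perturbation. *)
pose e := del / (2 * - b z1).
have b10 : b z1 < 0 by exact: bneg.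
have e0 : 0 < e by rewrite divr_gt0 // mulr_gt0 ?oppr_gt0.
pose v z := g1 z - g2 z + e * b z.
have v1 : v z1 = del / 2.
  by rewrite /v -/del /e; field; rewrite lt_eqF.
pose s := del / 2; have s0 : 0 < s by rewrite divr_gt0.
have cv z : (D `\ w) z -> {for z, continuous v}.
  move=> Dz; have [c1 _ _ _] := h1; have [c2 _ _ _] := h2; have [c3 _ _ _] := hf.
  have k1 := C1_continuous oDw c1 Dz; have k2 := C1_continuous oDw c2 Dz.
  have k3 := C1_continuous oDw c3 Dz.
  have k4 := @cont_sqdist R 0 z e.
  apply: continuousD; first exact: continuousB.
  have -> : (fun z => e * b z) = (fun z => (e * h z + e * cmod (z - 0) ^+ 2) - e).
    by apply/funext => u; rewrite /b subr0; ring.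
  apply: continuousB; last exact: cst_continuous.
  apply: continuousD => //; apply: continuousM => //; exact: cst_continuous.
pose A := [set z | (D `\ w) z /\ s <= v z].
have clA : closed A.
  rewrite -openC; apply/openCE => z nAz.
  have [->|/eqP zw] := eqVneq z w.
    have /nbhsC [d1 d10 s1] := n1; have /nbhsC [d2 d20 s2] := n2.
    have [d3 d30 s3] := ln_small (- (M1 + M2)) e0.
    exists (Num.min (Num.min d1 d2) d3); first by rewrite !lt_min d10 d20.
    move=> u; rewrite cballE !lt_min => /andP[/andP[/s1 u1 /s2 u2] u3] [[Du uw] su].
    move/eqP: (uw) => uw'; have := u1 uw'; have := u2 uw'.
    rewrite !ler_norml => /andP[a1 a2] /andP[a3 a4].
    have : e * ln (cmod (f u)) < - (M1 + M2).
      by apply: s3; rewrite cmod_gt0 f0 //= cf; have := cmod_ge0 (u - w); lra.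
    have := disk_sq (Dd u Du); move: su; rewrite /v /b /h => su ud.
    have := mulr_gt0 e0 ud; lra.
  have [Dz|nDz] := pselect (D z).
    have vz : v z < s by rewrite ltNge; apply/negP => vs; apply: nAz.
    have k0 : 0 < s - v z by rewrite subr_gt0.
    have [d d0 sd] := (continuousCR v z).1 (cv z (conj Dz zw)) _ k0.
    exists d => // u /sd; rewrite ltr_norml => /andP[_ hu] [_]; lra.
  have [clz|nclz] := pselect (closure D z); last first.
    have [d d0 sd] := notin_closure_ball nclz.
    by exists d => // u /sd nDu [[Du _] _].
  have bz : boundary D z by split => //; move=> /interior_subset.
  have s20 : 0 < s / 2 by rewrite divr_gt0.
  have [d1 d10 s1] := (within_nbhsC D z g1 0).1 (b1 z bz) _ s20.
  have [d2 d20 s2] := (within_nbhsC D z g2 0).1 (b2 z bz) _ s20.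
  exists (Num.min d1 d2); first by rewrite lt_min d10.
  move=> u; rewrite cballE lt_min => /andP[u1 u2] [[Du uw] su].
  have := s1 u Du u1; have := s2 u Du u2.
  rewrite !subr0 !ltr_norml => /andP[? ?] /andP[? ?].
  have := bneg u Du uw; rewrite -/(b u) => bu.
  have : e * b u < 0 by rewrite pmulr_rlt0.
  move: su; rewrite /v; lra.
have cA : compact A.
  apply: (subclosed_compact clA (@compact_cdisk R 0 1)) => z [[/Dd zd _] _] /=.
  by rewrite subr0 ltW.
have [|z Az mx] := EVT_maxC cA _ (fun z Az => cv z Az.1).
  by exists z1; split => //; rewrite v1.
have [Dz sz] := Az.
have [d0 d00 sub] := openCP oDw Dz.
have lmax u : cball z d0 u -> v u <= v z.
  move=> /sub Du; have [su|su] := leP s (v u); first exact: mx.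
  by apply: ltW; exact: lt_le_trans su sz.
exact: (no_local_max oDw h1 h2 hf e0 Dz d00 lmax).
Qed.

Lemma greenE (D : set C) (w : C) (g : C -> R) : open D -> D `<=` @disk R ->
  D w -> is_green D w g -> forall z, D z -> z != w -> green D z w = (g z)%:E.
Proof.
move=> oD Dd Dw gg z Dz zw; rewrite /green (negbTE zw); congr EFin.
have gx : is_green D w (xget (fun=> 0) [set g | is_green D w g]).
  by case: xgetP => // /(_ g).
by apply/eqP; rewrite eq_le; apply/andP; split; apply: (green_le oD Dd Dw) => //; apply/eqP.
Qed.

(** The bounds say that [h] behaves like a Riemann map of [D] with its zero at
    [w]: near the zero it is comparable to [z - w], and its modulus tends to [1]
    at the boundary. *)
Theorem is_green_map (D : set C) (w : C) (h : C -> C) (r : R) : open D ->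
  0 < r -> hol D h ->
  (forall z, D z -> z != w -> cmod (z - w) / 2 <= cmod (h z)) ->
  (forall z, D z -> z != w -> cmod (h z) < 1) ->
  (forall z, D z -> cmod (z - w) < r -> cmod (h z) * r <= cmod (z - w)) ->
  cball w r `<=` D ->
  (forall zeta, boundary D zeta -> forall e : R, 0 < e -> exists2 d : R, 0 < d &
     forall z, D z -> cmod (z - zeta) < d -> 1 - e < cmod (h z) <= 1) ->
  is_green D w (fun z => - ln (cmod (h z))).
Proof.
move=> oD r0 hh low up pole sub bd.
have h0 z : D z -> z != w -> h z != 0.
  move=> Dz zw; rewrite -cmod_gt0; apply: lt_le_trans (low z Dz zw).
  by rewrite divr_gt0 // cmod_gt0 subr_eq0.
have lnneg z : D z -> z != w -> ln (cmod (h z)) < 0.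
  by move=> Dz zw; apply: ln_lt0; rewrite cmod_gt0 h0 //= up.
split.
- split; last by move=> z [Dz /eqP zw]; rewrite oppr_gt0 lnneg.
  have -> : (fun z => - ln (cmod (h z))) = (fun z => ln (cmod ((h z)^-1))).
    apply/funext => z; rewrite cmodV; have [->|hz] := eqVneq (h z) 0.
      by rewrite cmod0 invr0 ln0 // oppr0.
    by rewrite lnV // posrE cmod_gt0.
  apply: harmonic_ln_cmod; first exact: open_setD1.
    move=> z [Dz /eqP zw]; have [l dl] := hh z Dz; eexists.
    exact: cdiffV (h0 z Dz zw) dl.
  by move=> z [Dz /eqP zw]; rewrite invr_eq0 h0.
- move=> U /nbhsC [e e0 sU]; exists (- ln (e / 2)) => z Dz nUz.
  have ez : e <= cmod (z - w) by rewrite leNgt; apply/negP => /sU.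
  have zw : z != w by rewrite -subr_eq0 -cmod_gt0; exact: lt_le_trans ez.
  rewrite normrN ltr0_norm ?lnneg // lerN2 ler_ln ?posrE ?divr_gt0 ?cmod_gt0 ?h0 //.
  by apply: le_trans (low z Dz zw); lra.
- exists (ln 2 + `|ln r|); apply/nbhsC; exists r => // z zr /eqP/eqP zw.
  have Dz : D z by exact: sub.
  have c0 : 0 < cmod (z - w) by rewrite cmod_gt0 subr_eq0.
  have ch0 : 0 < cmod (h z) by rewrite cmod_gt0 h0.
  have a1 : ln (cmod (z - w)) - ln 2 <= ln (cmod (h z)).
    by rewrite -ln_div ?posrE // ler_ln ?posrE ?divr_gt0 //; exact: low.
  have a2 : ln (cmod (h z)) + ln r <= ln (cmod (z - w)).
    by rewrite -lnM ?posrE // ler_ln ?posrE ?mulr_gt0 //; exact: pole.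
  have := ler_norm (- ln r); rewrite normrN => a3.
  have a4 : 0 <= ln 2 :> R by apply: ln_ge0; rewrite ler1n.
  by rewrite ler_norml; apply/andP; split; have := normr_ge0 (ln r); lra.
- move=> zeta bz; apply/within_nbhsC => e e0.
  have e10 : 0 < 1 - expR (- e) by rewrite subr_gt0 -expR0 ltr_expR oppr_lt0.
  have [d d0 sd] := bd zeta bz _ e10; exists d => // z Dz /(sd z Dz) /andP[hz hz1].
  have hz' : expR (- e) < cmod (h z) by lra.
  have p0 : 0 < cmod (h z) by exact: lt_trans (expR_gt0 _) hz'.
  rewrite subr0 normrN ler0_norm ?ln_le0 //.
  have : - e < ln (cmod (h z)) by rewrite -ltr_expR lnK.
  lra.
Qed.

Lemma half_le_rho (z w : C) : disk z -> disk w -> cmod (z - w) / 2 <= rho z w.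
Proof.
move=> hz hw; rewrite /rho /mob cmod_div ler_wpM2l ?cmod_ge0 //.
have d0 : 0 < cmod (1 - conjc w * z) by rewrite cmod_gt0 mob_den.
rewrite lef_pV2 ?posrE //; apply: le_trans (cmodB _ _) _.
rewrite cmod1 cmodM cmod_conj.
have : cmod w * cmod z <= 1 * 1.
  by rewrite ler_pM ?cmod_ge0 //; exact: ltW.
lra.
Qed.

Lemma den_lower (z w : C) : disk z -> disk w -> 1 - cmod w <= cmod (1 - conjc w * z).
Proof.
move=> hz hw; have := cmod_le_add 1 (1 - conjc w * z).
have -> : 1 - (1 - conjc w * z) = conjc w * z by ring.
rewrite cmod1 cmodM cmod_conj.
have : cmod w * cmod z <= cmod w by rewrite ler_piMr ?cmod_ge0 // ltW.
lra.
Qed.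

Theorem green_disk (z w : C) : disk z -> disk w -> z != w ->
  green (@disk R) z w = (- ln (rho z w))%:E.
Proof.
move=> hz hw zw.
have r0 : 0 < 1 - cmod w by rewrite subr_gt0.
apply: (greenE (@disk_open R) (fun _ h => h) hw (g := fun u => - ln (rho u w))) => //.
apply: (@is_green_map _ w (mob w) (1 - cmod w) (@disk_open R)) => //.
- by move=> u hu; exact: mob_hol.
- by move=> u hu _; exact: half_le_rho.
- by move=> u hu _; exact: mob_disk.
- move=> u hu _; rewrite /mob cmod_div mulrAC ler_pdivrMr ?cmod_gt0 ?mob_den //.
  by rewrite ler_wpM2l ?cmod_ge0 // den_lower.
- move=> u; rewrite cballE => uw; rewrite /disk /=.
  by have := cmod_le_add u w; lra.
- move=> zeta [_ nz] e e0.
  have z1 : 1 <= cmod zeta.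
    rewrite leNgt; apply/negP => h; apply: nz.
    by have := @disk_open R; rewrite openE; apply.
  pose d := e * (1 - cmod w) ^+ 2 / 2.
  exists d; first by rewrite !mulr_gt0 ?exprn_gt0.
  move=> u hu ud; have ur := rho_lt1 hu hw.
  rewrite -/(rho u w) (ltW ur) andbT.
  have h1 := one_sub_rho2 hu hw.
  have dl := den_lower hu hw.
  have h2 : 1 - rho u w ^+ 2 <= (1 - cmod u ^+ 2) / (1 - cmod w) ^+ 2.
    rewrite h1 ler_pM ?invr_ge0 ?exprn_ge0 ?cmod_ge0 //.
    + by rewrite mulr_ge0 // ltW // disk_sq.
    + by rewrite ler_piMr ?(ltW (disk_sq hu)) // gerBl exprn_ge0 ?cmod_ge0.
    + rewrite lef_pV2 ?posrE ?exprn_gt0 ?cmod_gt0 ?mob_den //.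
      by rewrite lerXn2r ?nnegrE ?cmod_ge0 ?(ltW r0).
  have h3 : 1 - cmod u < d.
    by have := cmod_le_add zeta u; rewrite cmodBC; lra.
  have h4 : (1 - cmod u ^+ 2) / (1 - cmod w) ^+ 2 < e.
    rewrite ltr_pdivrMr ?exprn_gt0 //.
    have -> : e * (1 - cmod w) ^+ 2 = 2 * d by rewrite /d; field.
    have := cmod_ge0 u; move: hu; rewrite /disk /=; nra.
  have := rho_ge0 u w; nra.
Qed.

End GreenFunctions.

(** * The pseudo-hyperbolic metric *)

Section PseudoHyperbolic.
Variable R : realType.
Local Notation C := R[i].

(** The Schwarz-Pick inequalities of a Moebius map and of its inverse. *)
Lemma rho_mob (y x z : C) : disk y -> disk x -> disk z ->
  rho (mob y x) (mob y z) = rho x z.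
Proof.
move=> hy hx hz.
have md v : disk v -> hol (@disk R) (mob v) /\ forall u, disk u -> disk (mob v u).
  by move=> hv; split=> u hu; [exact: mob_hol|exact: mob_disk].
have [h1 d1] := md y hy; have [h2 d2] := md (- y) (diskN hy).
apply/eqP; rewrite eq_le (schwarz_pick h1 d1) //=.
by have := schwarz_pick h2 d2 (d1 x hx) (d1 z hz); rewrite !mobK.
Qed.

(** The addition formula of the hyperbolic tangent bounds the distance of two
    points by their distances from a third. *)
Lemma rho_add (x y z : C) : disk x -> disk y -> disk z ->
  rho x z * (1 + rho x y * rho y z) <= rho x y + rho y z.
Proof.
move=> hx hy hz; rewrite -(rho_mob hy hx hz) (rhoC y z).
rewrite -[rho x y]/(cmod (mob y x)) -[rho z y]/(cmod (mob y z)).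
have ha := mob_disk hy hx; have hc := mob_disk hy hz.
set a := mob y x in ha *; set c := mob y z in hc *.
have a0 := cmod_ge0 a; have c0 := cmod_ge0 c.
have ac0 := mulr_ge0 a0 c0.
have d0 : 0 < cmod (1 - conjc c * a) by rewrite cmod_gt0 mob_den.
have dle : cmod (1 - conjc c * a) <= 1 + cmod a * cmod c.
  by apply: le_trans (cmodB _ _) _; rewrite cmod1 cmodM cmod_conj mulrC.
rewrite -(@ler_pXn2r _ 2) ?nnegrE ?mulr_ge0 ?rho_ge0 ?addr_ge0 //.
have := one_sub_rho2 ha hc => E.
have h1 : (1 - cmod a ^+ 2) * (1 - cmod c ^+ 2) <=
    (1 - rho a c ^+ 2) * (1 + cmod a * cmod c) ^+ 2.
  rewrite E mulrAC ler_pdivlMr ?exprn_gt0 // ler_wpM2l //.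
    by rewrite mulr_ge0 // ltW // disk_sq.
  by rewrite lerXn2r ?nnegrE ?(ltW d0) // addr_ge0.
rewrite exprMn; nra.
Qed.

Lemma rho_triangle (x y z : C) : disk x -> disk y -> disk z ->
  rho x z <= rho x y + rho y z.
Proof.
move=> hx hy hz; apply: le_trans (rho_add hx hy hz).
by rewrite ler_peMr ?rho_ge0 // lerDl mulr_ge0 ?rho_ge0.
Qed.

(** A form of the triangle inequality that keeps distances away from [1], and
    therefore survives the limit. *)
Lemma rho_gap (x y z : C) : disk x -> disk y -> disk z ->
  (1 - rho x y) * (1 - rho y z) <= 2 * (1 - rho x z).
Proof.
move=> hx hy hz; have := rho_add hx hy hz.
have := rho_ge0 x y; have := rho_ge0 y z; have := rho_ge0 x z.
have := rho_lt1 hx hy; have := rho_lt1 hy hz; have := rho_lt1 hx hz.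
set a := rho x y; set b := rho y z; set c := rho x z => c1 b1 a1 c0 b0 a0 h.
have h1 : (1 - a) * (1 - b) <= (1 - c) * (1 + a * b) by nra.
have h2 : a * b <= 1 by rewrite mulr_ile1 // ltW.
have h3 : 0 <= (1 - c) * (1 - a * b) by rewrite mulr_ge0 // subr_ge0 // ltW.
lra.
Qed.

End PseudoHyperbolic.

(** * The limit of the distances along a backward flow *)

Section BackwardFlow.
Variable R : realType.
Local Notation C := R[i].
Variables (Delta : set C) (f_ phi : R -> C -> C).
Hypothesis oD : open Delta.
Hypothesis cD : connected Delta.
Hypothesis Dd : Delta `<=` @disk R.
Hypothesis hf : forall t : R, 0 <= t -> hol Delta (f_ t).
Hypothesis fD : forall (t : R) z, 0 <= t -> Delta z -> disk (f_ t z).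
Hypothesis phol : forall t : R, 0 <= t -> hol (@disk R) (phi t).
Hypothesis pd : forall (t : R) z, 0 <= t -> disk z -> disk (phi t z).
Hypothesis ff : forall (s t : R) z, 0 <= s -> s <= t -> Delta z ->
  f_ s z = phi (t - s) (f_ t z).
Hypothesis f0 : forall z, Delta z -> f_ 0 z = z.
Hypothesis bdc : forall zeta, boundary Delta zeta -> forall e : R, 0 < e ->
  exists2 c, cmod (c - zeta) < e &
    exists2 t : R, 0 <= t & forall u, disk u -> phi t u != c.

Definition rho_back (t : R) (z w : C) : R := rho (f_ t z) (f_ t w).

Lemma rho_back_mono (s t : R) z w : 0 <= s -> s <= t -> Delta z -> Delta w ->
  rho_back s z w <= rho_back t z w.
Proof.
move=> s0 st Dz Dw; have t0 := le_trans s0 st.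
rewrite /rho_back (ff s0 st Dz) (ff s0 st Dw); apply: schwarz_pick.
- by apply: phol; rewrite subr_ge0.
- by move=> u hu; apply: pd => //; rewrite subr_ge0.
- exact: fD.
- exact: fD.
Qed.

(** The pseudo-hyperbolic distance of the backward images increases with time;
    its limit is intrinsic to [Delta], and [- log] of it is the Green
    function. *)
Definition rho_lim (z w : C) : R := sup [set rho_back t z w | t in [set t : R | 0 <= t]].

Let S z w := [set rho_back t z w | t in [set t : R | 0 <= t]].

Lemma rho_back_le_rho_lim (t : R) z w : 0 <= t -> Delta z -> Delta w ->
  rho_back t z w <= rho_lim z w.
Proof.
move=> t0 Dz Dw; apply: ub_le_sup; last by exists t.
by exists 1 => _ [s s0 <-]; apply/ltW/rho_lt1; exact: fD.
Qed.

Lemma rho_lim_le (z w : C) (M : R) :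
  (forall t : R, 0 <= t -> rho_back t z w <= M) -> rho_lim z w <= M.
Proof.
move=> H; apply: ge_sup; first by exists (rho_back 0 z w); exists 0 => //=.
by move=> _ [t t0 <-]; exact: H.
Qed.

Lemma rho_lim_le1 z w : Delta z -> Delta w -> rho_lim z w <= 1.
Proof. by move=> Dz Dw; apply: rho_lim_le => t t0; apply/ltW/rho_lt1; exact: fD. Qed.

Lemma rho_lim_ge0 z w : Delta z -> Delta w -> 0 <= rho_lim z w.
Proof. by move=> Dz Dw; apply: le_trans (rho_back_le_rho_lim (lexx 0) Dz Dw); exact: rho_ge0. Qed.

Lemma rho_lim_approx z w (e : R) : Delta z -> Delta w -> 0 < e ->
  exists2 t : R, 0 <= t & forall s, t <= s -> rho_lim z w - e < rho_back s z w.
Proof.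
move=> Dz Dw e0; apply: contrapT => N.
suff : rho_lim z w <= rho_lim z w - e by lra.
apply: rho_lim_le => t t0; rewrite leNgt; apply/negP => h; apply: N.
by exists t => // s ts; apply: lt_le_trans h _; exact: rho_back_mono.
Qed.

Lemma rho_limC z w : rho_lim z w = rho_lim w z.
Proof.
rewrite /rho_lim; congr sup; apply/seteqP.
by split=> x [t t0 <-]; exists t => //; rewrite /rho_back rhoC.
Qed.

Lemma rho_lim_local z w (r : R) : 0 < r -> cball w r `<=` Delta -> cball w r z ->
  rho_lim z w * r <= cmod (z - w).
Proof.
move=> r0 sub zr; rewrite -ler_pdivlMr //; apply: rho_lim_le => t t0.
rewrite ler_pdivlMr //; apply: schwarz_pick_ball => //.
  by move=> u /sub; exact: hf.
by move=> u /sub Du; exact: fD.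
Qed.

Lemma rho_lim_triangle x y z : Delta x -> Delta y -> Delta z ->
  rho_lim x z <= rho_lim x y + rho_lim y z.
Proof.
move=> Dx Dy Dz; apply: rho_lim_le => t t0.
apply: le_trans (rho_triangle (fD t0 Dx) (fD t0 Dy) (fD t0 Dz)) _.
by rewrite lerD // rho_back_le_rho_lim.
Qed.

Lemma rho_lim_gap x y z : Delta x -> Delta y -> Delta z ->
  (1 - rho_lim x y) * (1 - rho_lim y z) <= 2 * (1 - rho_lim x z).
Proof.
move=> Dx Dy Dz; suff : rho_lim x z <= 1 - (1 - rho_lim x y) * (1 - rho_lim y z) / 2 by lra.
apply: rho_lim_le => t t0.
have := rho_gap (fD t0 Dx) (fD t0 Dy) (fD t0 Dz); rewrite -!/(rho_back _ _ _) => h.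
have h1 := rho_back_le_rho_lim t0 Dx Dy; have h2 := rho_back_le_rho_lim t0 Dy Dz.
have h3 := rho_lim_le1 Dx Dy; have h4 := rho_lim_le1 Dy Dz.
have : (1 - rho_lim x y) * (1 - rho_lim y z) <= (1 - rho_back t x y) * (1 - rho_back t y z).
  by rewrite ler_pM // ?subr_ge0 // lerB.
lra.
Qed.

(** Nearby points have [rho_lim < 1], so [rho_lim . w < 1] defines a subset of
    [Delta] that is open and closed in it. *)
Lemma rho_lim_lt1 z w : Delta z -> Delta w -> rho_lim z w < 1.
Proof.
move=> Dz Dw.
have loc x : Delta x -> exists2 r : R, 0 < r & forall u, cball x r u ->
    Delta u /\ rho_lim u x < 1.
  move=> Dx; have [r r0 sub] := openCP oD Dx; exists r => // u ur; split; first exact: sub.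
  have := rho_lim_local r0 sub ur; rewrite -ler_pdivlMr // => /le_lt_trans; apply.
  by rewrite ltr_pdivrMr // mul1r.
have step x u : Delta x -> Delta u -> rho_lim u x < 1 -> rho_lim x w < 1 -> rho_lim u w < 1.
  move=> Dx Du h1 h2; have := rho_lim_gap Du Dx Dw.
  have : 0 < (1 - rho_lim u x) * (1 - rho_lim x w) by rewrite mulr_gt0 // subr_gt0.
  lra.
pose B := [set x | Delta x /\ rho_lim x w < 1].
suff BE : B = Delta by have [] : B z by rewrite BE.
apply: cD.
- exists w; split => //; have [r r0 /(_ w (cballxx w r0))] := loc w Dw.
  by case.
- exists B; last by apply/seteqP; split => x [] // _ [].
  apply/openCE => x [Dx h]; have [r r0 rP] := loc x Dx; exists r => // u /rP [Du hu].
  by split => //; exact: (step x).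
- exists (~` [set x | Delta x /\ ~ rho_lim x w < 1]).
    rewrite closedC; apply/openCE => x [Dx h]; have [r r0 rP] := loc x Dx.
    exists r => // u /rP [Du hu]; split => // uw; apply: h.
    by apply: (step u) => //; rewrite rho_limC.
  apply/seteqP; split => x.
    by move=> [Dx h]; split => //= -[_].
  by move=> [Dx h]; split => //; apply: contrapT => h'; apply: h.
Qed.

Lemma half_le_rho_lim z w : Delta z -> Delta w -> cmod (z - w) / 2 <= rho_lim z w.
Proof.
move=> Dz Dw; apply: le_trans (rho_back_le_rho_lim (lexx 0) Dz Dw).
by rewrite /rho_back !f0 //; apply: half_le_rho; exact: Dd.
Qed.

(** For [c] outside [phi_t(D)] the function [(phi_t - c) / 4] has no zero and
    modulus less than [1]; Harnack's inequality at the points that [phi_t] maps to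
    [z] and [w] compares [log (4 / |z - c|)] with [log (4 / |w - c|)].  The first
    is large if [z] is close to [zeta] and [c] closer still. *)
Lemma rho_lim_boundary w zeta (e : R) : Delta w -> boundary Delta zeta -> 0 < e ->
  exists2 d : R, 0 < d & forall z, Delta z -> cmod (z - zeta) < d ->
    1 - e < rho_lim z w <= 1.
Proof.
move=> Dw bz e0.
have [clz ni] := bz.
have neq u : Delta u -> 0 < cmod (u - zeta).
  move=> Du; rewrite cmod_gt0 subr_eq0; apply/eqP => E; apply: ni.
  by rewrite -E; move: oD; rewrite openE; apply.
have z1 : cmod zeta <= 1.
  rewrite leNgt; apply/negP => h.
  have [|u [/Dd ud uz]] := clz (cball zeta (cmod zeta - 1)).
    by apply/nbhsC; exists (cmod zeta - 1) => //; rewrite subr_gt0.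
  move: ud uz; rewrite /disk cballE /mkset => ud uz.
  by have := cmod_le_add zeta u; rewrite (cmodBC zeta); lra.
pose B := 2 * - ln (cmod (w - zeta) / 8).
have [d' d'0 sd] := ln_small (- B) e0.
pose d := Num.min (2 * d') (Num.min 1 (cmod (w - zeta) / 2)).
have d0 : 0 < d by rewrite !lt_min mulr_gt0 // ltr01 divr_gt0 // neq.
exists d => // z Dz zd; rewrite rho_lim_le1 // andbT.
move: zd; rewrite !lt_min => /and3P[zd1 zd2 zd3].
have zz := neq z Dz.
(* Taking [c] closer to [zeta] than [z] gives [|z - c| <= 2 |z - zeta|]. *)
have [c cz [t t0 ct]] := bdc bz zz.
pose f u := (phi t u - c) * (4^-1 : R)%:C%C.
have fE u : cmod (f u) = cmod (phi t u - c) / 4.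
  by rewrite /f cmodM cmod_real gtr0_norm.
have c2 : cmod c < 2 by have := cmod_le_add c zeta; lra.
have hfl : hol (@disk R) f.
  move=> u /(phol t0) [l dl]; eexists; apply: cdiffM (cdiff_cst _ _).
  exact: cdiffB dl (cdiff_cst _ _).
have fb u : disk u -> 0 < cmod (f u) < 1.
  move=> hu; rewrite fE divr_gt0 ?cmod_gt0 ?subr_eq0 ?ct //=.
  have := cmodB (phi t u) c; have := pd t0 hu; rewrite /disk /mkset; lra.
have H := harnack hfl fb (fD t0 Dz) (fD t0 Dw).
have E u : Delta u -> phi t (f_ t u) = u.
  by move=> Du; rewrite -[in RHS](f0 Du) (ff (lexx 0) t0 Du) subr0.
rewrite !fE !E // -/(rho_back t z w) in H.
have Hz : cmod (z - c) / 4 <= cmod (z - zeta) / 2.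
  by have := cmod_tri zeta z c; rewrite (cmodBC zeta c); lra.
have Hw : cmod (w - zeta) / 8 <= cmod (w - c) / 4.
  by have := cmod_tri c w zeta; lra.
have zc0 : 0 < cmod (z - c).
  by rewrite cmod_gt0 subr_eq0 -(E z Dz); apply: ct; exact: fD.
have wz0 := neq w Dw.
have lz : - ln (cmod (z - zeta) / 2) <= - ln (cmod (z - c) / 4).
  by rewrite lerN2 ler_ln // posrE divr_gt0.
have lw : - ln (cmod (w - c) / 4) <= - ln (cmod (w - zeta) / 8).
  have w8 : 0 < cmod (w - zeta) / 8 by rewrite divr_gt0.
  by rewrite lerN2 ler_ln // posrE // (lt_le_trans w8).
have h3 : e * ln (cmod (z - zeta) / 2) < - B by apply: sd; apply/andP; split; lra.
have ln0 : 0 < - ln (cmod (z - zeta) / 2).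
  by rewrite oppr_gt0; apply: ln_lt0; apply/andP; split; lra.
have r1 : 1 - rho_lim z w <= 1 - rho_back t z w by rewrite lerB // rho_back_le_rho_lim.
have r0 : 0 <= 1 - rho_lim z w by rewrite subr_ge0 rho_lim_le1.
have h4 : (1 - rho_lim z w) * - ln (cmod (z - zeta) / 2) <= B.
  apply: le_trans (ler_pM r0 (ltW ln0) r1 lz) _; apply: le_trans H _.
  by rewrite /B ler_wpM2l.
rewrite ltNge; apply/negP => le.
have : e * - ln (cmod (z - zeta) / 2) <= (1 - rho_lim z w) * - ln (cmod (z - zeta) / 2).
  by rewrite ler_wpM2r ?(ltW ln0) //; lra.
lra.
Qed.

Lemma ultra_limit (T : Type) (G : set_system T) (u : T -> C) (M : R) :
  UltraFilter G -> (\forall t \near G, cmod (u t) <= M) ->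
  exists l, forall e : R, 0 < e -> \forall t \near G, cmod (u t - l) < e.
Proof.
move=> UG bM; have PG : ProperFilter G by exact: ultra_proper.
have Pu : ProperFilter (u @ G) by exact: fmap_proper_filter.
have FK : (u @ G) [set z | cmod (z - 0) <= M].
  by apply: filterS bM => t; rewrite /= subr0.
have [l [_ cl]] := @compact_cdisk R 0 M _ Pu FK.
exists l => e e0; have [//|nG] := in_ultra_setVsetC [set t | cmod (u t - l) < e] UG.
have n1 : (u @ G) (~` cball l e) by [].
have n2 : nbhs l (cball l e) by apply/nbhsC; exists e.
by have [z [Nz zl]] := cl _ _ n1 n2; exfalso; exact: Nz.
Qed.

(** Along an ultrafilter every bounded family converges, so no subsequence has
    to be chosen and the limit exists at all points at once. *)
Lemma limit_map w : Delta w -> exists h, hol Delta h /\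
  forall z, Delta z -> cmod (h z) = rho_lim z w.
Proof.
move=> Dw.
have [G [UG sG]] := ultraFilterLemma (@proper_pinfty_nbhs R).
have PG : ProperFilter G by exact: ultra_proper.
have ge (s : R) : \forall t \near G, s <= t.
  by apply: sG; exact: nbhs_pinfty_ge (num_real _).
pose m (t : R) z := mob (f_ t w) (f_ t z).
have mb t z : 0 <= t -> Delta z -> cmod (m t z) <= 1.
  by move=> t0 Dz; apply/ltW/mob_disk; exact: fD.
have /choice[h hP] : forall z, exists l, Delta z -> forall e : R, 0 < e ->
    \forall t \near G, cmod (m t z - l) < e.
  move=> z; have [Dz|nDz] := pselect (Delta z); last by exists 0 => /nDz.
  have [|l lP] := @ultra_limit R G (m ^~ z) 1 UG; last by exists l.
  by apply: filterS (ge 0) => t t0; exact: mb.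
exists h; split=> [a Da|z Dz].
  have [r r0 sub] := openCP oD Da.
  apply: (@limit_holomorphic R R G m h a r 1) => //.
    apply: filterS (ge 0) => t t0; split=> z /sub Dz; last exact: mb.
    have [l dl] := hf t0 Dz; have [k dk] := mob_hol (fD t0 Dw) (fD t0 Dz).
    by exists (k * l); exact: cdiff_comp.
  by move=> z /sub Dz e e0; exact: hP.
apply/eqP; rewrite eq_le; apply/andP; split; apply/ler_addgt0Pr => e e0.
  have [t [h1 h2]] := filter_ex (filterI (hP z Dz e e0) (ge 0)).
  have := cmod_le_add (h z) (m t z); rewrite cmodBC.
  have := rho_back_le_rho_lim h2 Dz Dw; rewrite /rho_back /rho -/(m t z); lra.
have e20 : 0 < e / 2 by rewrite divr_gt0.
have [s s0 sP] := rho_lim_approx Dz Dw e20.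
have [t [h1 h2]] := filter_ex (filterI (hP z Dz (e / 2) e20) (ge s)).
have := cmod_le_add (m t z) (h z).
have := sP t h2; rewrite /rho_back /rho -/(m t z); lra.
Qed.

Theorem green_petal z w : Delta z -> Delta w -> z != w ->
  green Delta z w = (- ln (rho_lim z w))%:E.
Proof.
move=> Dz Dw zw; have [h [hh hE]] := limit_map Dw.
have [r r0 sub] := openCP oD Dw.
rewrite -(hE z Dz).
apply: (greenE oD Dd Dw (g := fun u => - ln (cmod (h u)))) => //.
apply: (@is_green_map _ Delta w h r oD r0 hh) => //.
- by move=> u Du _; rewrite hE //; exact: half_le_rho_lim.
- by move=> u Du _; rewrite hE //; exact: rho_lim_lt1.
- by move=> u Du ur; rewrite hE //; exact: rho_lim_local.
- move=> zeta bz e e0; have [d d0 sd] := rho_lim_boundary Dw bz e0.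
  by exists d => // u Du ud; rewrite hE //; exact: sd.
Qed.

End BackwardFlow.

(** * Petals as components of the backward invariant set *)

Section Petal.
Variable R : realType.
Local Notation C := R[i].

Lemma cball_connected (a : C) (r : R) : 0 < r -> connected (cball a r).
Proof.
move=> r0.
pose seg (z : C) (t : R) : C := a + (t%:C)%C * (z - a).
have -> : cball a r = \bigcup_(z in cball a r) [set seg z t | t in `[0, 1]%classic].
  apply/seteqP; split => [z za|w [z za [t]]].
    exists z => //; exists 1; first by rewrite /= in_itv /= ler01 lexx.
    by rewrite /seg rmorph1 mul1r addrC subrK.
  rewrite /= in_itv /= => /andP[t0 t1] <-.
  rewrite cballE /seg addrC addKr cmodM cmod_real ger0_norm //.
  by apply: le_lt_trans za; rewrite ler_piMl ?cmod_ge0.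
apply: bigcup_connected.
  exists a => z za; exists 0; first by rewrite /= in_itv /= lexx ler01.
  by rewrite /seg rmorph0 mul0r addr0.
move=> z za; apply: connected_continuous_connected.
  exact: segment_connected.
apply: continuous_subspaceT => t A /nbhsC [e e0 sA].
have c0 : 0 < 1 + cmod (z - a) by rewrite ltr_wpDr ?cmod_ge0.
apply/nbhs_ballP; exists (e / (1 + cmod (z - a))); first by rewrite /= divr_gt0.
move=> s; rewrite -ball_normE /= distrC ltr_pdivlMr // => h; apply: sA; rewrite cballE.
have -> : seg z s - seg z t = ((s - t)%:C)%C * (z - a).
  by rewrite /seg rmorphB; ring.
rewrite cmodM cmod_real; apply: le_lt_trans h.
by rewrite ler_wpM2l // lerDr.
Qed.

Lemma component_open_near (W : set C) (x z : C) (r : R) : open W ->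
  0 < r -> cball z r `<=` W -> cball z r `&` connected_component W x !=set0 ->
  cball z r `<=` connected_component W x.
Proof.
move=> oW r0 sub [u [ur ux]].
have uW : W u by exact: sub.
rewrite (same_connected_component ux).
by apply: connected_component_max => //; exact: cball_connected.
Qed.

Variables (phi : R -> C -> C) (tau : C) (Delta : set C).
Hypothesis hphi : semigroup phi.
Hypothesis hDelta : petal phi tau Delta.

Let W := backward_invariant_set phi.

Lemma petal_component : exists2 z0, (W°) z0 & Delta = connected_component (W°) z0.
Proof. by have [] := hDelta. Qed.

Lemma petal_sub_interior : Delta `<=` W°.
Proof. by have [z0 _ ->] := petal_component; exact: connected_component_sub. Qed.

Lemma petal_open : open Delta.
Proof.
have [z0 Wz DE] := petal_component; apply/openCE => z Dz.
have oW : open (W°) by exact: open_interior.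
have [r r0 sub] := openCP oW (petal_sub_interior Dz).
exists r => //; rewrite DE; apply: component_open_near => //.
by exists z; split; [exact: cballxx|rewrite -DE].
Qed.

Lemma petal_connected : connected Delta.
Proof. by have [z0 _ ->] := petal_component; exact: component_connected. Qed.

Lemma petal_disk : Delta `<=` @disk R.
Proof.
move=> z /petal_sub_interior /interior_subset /(_ 0 (lexx 0)) [u du <-].
by have [_ p0 _ _] := hphi; rewrite p0.
Qed.

Definition back (t : R) : C -> C := flow phi Delta (- t).

Lemma flow_aut t : automorphism Delta (flow phi Delta t).
Proof. by have [_ _ [_ [h _]] _ _] := hDelta. Qed.

Lemma flow_in t z : Delta z -> Delta (flow phi Delta t z).
Proof. by move=> Dz; have [_ [h _ _] _] := flow_aut t; exact: h. Qed.

Lemma back_in t z : Delta z -> Delta (back t z).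
Proof. exact: flow_in. Qed.

Lemma back_hol t : hol Delta (back t).
Proof. by have [h _ _] := flow_aut (- t); exact/holomorphicE. Qed.

Lemma phi_hol t : 0 <= t -> hol (@disk R) (phi t).
Proof. by move=> t0; have [h _ _ _] := hphi; apply/holomorphicE; exact: (h t t0).1. Qed.

Lemma phi_disk t z : 0 <= t -> disk z -> disk (phi t z).
Proof.
by move=> t0 dz; have [h _ _ _] := hphi; apply: (h t t0).2; exists z.
Qed.

Lemma back_phi (s t : R) z : 0 <= s -> s <= t -> Delta z ->
  back s z = phi (t - s) (back t z).
Proof.
move=> s0 st Dz; have [_ _ [_ [_ h]] _ _] := hDelta.
have := h (t - s) (- t) z Dz; rewrite -/(back t z) => E.
have -> : back s z = flow phi Delta (t - s - t) z by rewrite /back; congr flow; ring.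
by rewrite E /flow subr_ge0 st.
Qed.

Lemma back0 z : Delta z -> back 0 z = z.
Proof.
move=> Dz; rewrite /back /flow oppr0 lexx.
by have [_ p0 _ _] := hphi; apply: p0; exact: petal_disk.
Qed.

Lemma phi_back t z : 0 <= t -> Delta z -> phi t (back t z) = z.
Proof. by move=> t0 Dz; rewrite -[RHS]back0 // (back_phi (lexx 0) t0 Dz) subr0. Qed.

Lemma phi_in t z : 0 <= t -> Delta z -> Delta (phi t z).
Proof. by move=> t0 Dz; have := flow_in t Dz; rewrite /flow t0. Qed.

Lemma back_phiK t z : 0 <= t -> Delta z -> back t (phi t z) = z.
Proof.
move=> t0 Dz; have [_ _ [_ [_ h]] _ _] := hDelta.
have := h (- t) t z Dz; rewrite addNr {3}/flow t0 -/(back t _) => <-.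
by rewrite -[RHS]back0 // /back oppr0.
Qed.

(** The component of an open set is closed relative to it, so a boundary point
    of a petal cannot be interior to the backward invariant set. *)
Lemma petal_boundary zeta : boundary Delta zeta -> forall e : R, 0 < e ->
  exists2 c, cmod (c - zeta) < e &
    exists2 t : R, 0 <= t & forall u, disk u -> phi t u != c.
Proof.
move=> [clz ni] e e0; apply: contrapT => N.
have sub : cball zeta e `<=` W.
  move=> c cz t t0; apply: contrapT => nc; apply: N; exists c => //; exists t => //.
  by move=> u du; apply/eqP => E; apply: nc; exists u.
have oW : open (W°) by exact: open_interior.
have Wz : (W°) zeta by apply/nbhsC; exists e.
have [r r0 subr] := openCP oW Wz.
have [z0 Wz0 DE] := petal_component.
apply: ni; apply/nbhsC; exists r => // w wz; rewrite DE.
apply: (component_open_near oW r0 subr) => //.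
rewrite -DE; have [|u [Du uz]] := clz (cball zeta r).
  by apply/nbhsC; exists r.
by exists u.
Qed.

End Petal.

(** * Potentials of pseudo-hyperbolic kernels *)

Section Measure.
Variable R : realType.
Local Notation C := R[i].
Local Notation B := (borelC R).

Lemma open_borel (U : set C) : open U -> measurable (U : set B).
Proof. by move=> oU; apply: sub_gen_smallest. Qed.

Lemma closed_borel (U : set C) : closed U -> measurable (U : set B).
Proof.
move=> cU; rewrite -(setCK U); apply: measurableC; apply: open_borel.
by rewrite openC.
Qed.

Lemma compact_closedC (K : set C) : compact K -> closed K.
Proof. by apply: compact_closed; exact: norm_hausdorff. Qed.

Lemma compact_borel (K : set C) : compact K -> measurable (K : set B).
Proof. by move=> cK; apply: closed_borel; exact: compact_closedC. Qed.

Lemma measurable_loc_cont (O K : set C) (g : C -> R) : open O -> K `<=` O ->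
  measurable (K : set B) ->
  (forall z, O z -> forall e : R, 0 < e -> exists2 d : R, 0 < d &
     forall u, cmod (u - z) < d -> O u -> `|g u - g z| < e) ->
  measurable_fun (K : set B) (g : B -> R).
Proof.
move=> oO KO mK cg _.
apply: (measurability _ (RGenOInfty.measurableE R)) => //.
move=> _ [_ [a ->] <-].
have -> : K `&` g @^-1` `]a, +oo[ = K `&` (O `&` [set z | a < g z]).
  apply/seteqP; split => z /=.
    by rewrite in_itv /= andbT => -[Kz h]; split => //; split => //; exact: KO.
  by rewrite in_itv /= andbT => -[Kz [_ h]].
apply: measurableI => //; apply: open_borel; apply/openCE => z [Oz /= az].
have [r r0 sub] := openCP oO Oz.
have [d d0 sd] := cg z Oz (g z - a) (ltac:(by rewrite subr_gt0)).
exists (Num.min r d); first by rewrite lt_min r0.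
move=> u; rewrite cballE lt_min => /andP[ur ud].
have Ou : O u by exact: sub.
by split => //=; have := sd u ud Ou; rewrite ltr_norml => /andP[? _]; lra.
Qed.

(** The disk with [rho], and [Delta] with the distances of the backward images
    and with their limit, share these properties; they make the potentials of
    [- log r] measurable and insensitive to the choice of the distance. *)
Record kmetric (O : set C) (r : C -> C -> R) : Prop := KMetric {
  km_open : open O;
  km_ge0 : forall x y, O x -> O y -> 0 <= r x y;
  km_le1 : forall x y, O x -> O y -> r x y <= 1;
  km_xx : forall x, O x -> r x x = 0;
  km_gt0 : forall x y, O x -> O y -> x != y -> 0 < r x y;
  km_sym : forall x y, r x y = r y x;
  km_tri : forall x y z, O x -> O y -> O z -> r x z <= r x y + r y z;
  km_loc : forall x, O x -> forall e : R, 0 < e -> exists2 d : R, 0 < d &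
    forall u, cmod (u - x) < d -> O u -> r u x < e }.

Definition kern (r : C -> C -> R) (x y : C) : \bar R :=
  if x == y then +oo%E else (- ln (r x y))%:E.

(** Truncating the distance from below makes the kernel a Lipschitz function of
    the distance, so truncated potentials are continuous; they increase to the
    potential, which is therefore measurable. *)
Definition trunc (m : nat) (s : R) : R := - ln (Num.max s (expR (- m%:R))).

Lemma trunc_arg_gt0 m (s : R) : 0 < Num.max s (expR (- m%:R)).
Proof. by rewrite lt_max expR_gt0 orbT. Qed.

Lemma trunc_ge0 m s : s <= 1 -> 0 <= trunc m s.
Proof.
move=> s1; rewrite /trunc oppr_ge0 ln_le0 // ge_max s1 /=.
by rewrite -expR0 ler_expR oppr_le0.
Qed.

Lemma trunc_mono m n s : (m <= n)%N -> trunc m s <= trunc n s.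
Proof.
move=> mn; rewrite /trunc lerN2 ler_ln ?posrE ?trunc_arg_gt0 //.
by rewrite ge_max !le_max lexx /= ler_expR lerN2 ler_nat mn orbT.
Qed.

Lemma trunc_lip m s s' : trunc m s <= trunc m s' + expR m%:R * `|s - s'|.
Proof.
pose c : R := expR (- m%:R).
have c0 : 0 < c by exact: expR_gt0.
have cE : expR m%:R = c^-1 by rewrite /c expRN invrK.
have a0 := trunc_arg_gt0 m s; have b0 := trunc_arg_gt0 m s'.
rewrite /trunc; set a := Num.max s _ in a0 *; set b := Num.max s' _ in b0 *.
have ac : c <= a by rewrite /a le_max lexx orbT.
have ab : `|b - a| <= `|s - s'|.
  rewrite distrC /a /b -/c ler_norml.
  have := ler_norm (s - s'); have := ler_norm (s' - s); rewrite (distrC s').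
  by have [?|?] := leP s c; have [?|?] := leP s' c; move=> ? ?; apply/andP; split; lra.
have : ln (b / a) <= b / a - 1.
  by have := expR_ge1Dx (ln (b / a)); rewrite lnK ?posrE ?divr_gt0 //; lra.
rewrite ln_div ?posrE // => h.
have h2 : b / a - 1 <= c^-1 * `|s - s'|.
  have -> : b / a - 1 = (b - a) / a by field; rewrite gt_eqF.
  rewrite ler_pdivrMr //; apply: le_trans (ler_norm _) _; apply: le_trans ab _.
  rewrite mulrAC ler_peMl // mulrC ler_pdivlMr // mul1r //.
rewrite cE; lra.
Qed.

Lemma trunc_cvg (O : set C) r x y : kmetric O r -> O x -> O y ->
  (trunc m (r x y))%:E @[m --> \oo] --> kern r x y.
Proof.
move=> kr Ox Oy; rewrite /kern; case: eqVneq => [->|xy].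
  have -> : (fun m => (trunc m (r y y))%:E) = (fun m => (m%:R)%:E).
    apply/funext => m; rewrite (km_xx kr Oy) /trunc max_r ?expR_ge0 //.
    by rewrite expRK opprK.
  by apply/cvgeryP; exact: cvgr_idn.
have r0 := km_gt0 kr Ox Oy xy.
apply: cvg_near_cst; exists (Num.truncn (- ln (r x y))).+1 => // m /= hm.
congr EFin; rewrite /trunc max_l //.
rewrite -[leRHS]lnK ?posrE // ler_expR lerNl.
apply: ltW; apply: lt_le_trans (truncnS_gt _) _.
by rewrite ler_nat.
Qed.

Section Kernel.
Variables (O : set C) (r : C -> C -> R) (K : set C).
Hypothesis kr : kmetric O r.
Hypothesis KO : K `<=` O.
Hypothesis cK : compact K.
Variable mu : probability B R.

Let mK : measurable (K : set B) := compact_borel cK.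

Lemma km_diff x y u : O x -> O y -> O u -> `|r x u - r x y| <= r u y.
Proof.
move=> Ox Oy Ou; have := km_tri kr Ox Ou Oy; have := km_tri kr Ox Oy Ou.
by rewrite (km_sym kr y u) ler_norml => ? ?; apply/andP; split; lra.
Qed.

Lemma kern_ge0 x y : O x -> O y -> (0 <= kern r x y)%E.
Proof.
move=> Ox Oy; rewrite /kern; case: eqVneq => [_|xy]; first exact: leey.
by rewrite lee_fin oppr_ge0 ln_le0 // (km_le1 kr).
Qed.

Lemma measurable_trunc m y : O y ->
  measurable_fun (K : set B) (fun x : B => (trunc m (r x y))%:E).
Proof.
move=> Oy; apply/measurable_EFinP.
apply: (measurable_loc_cont (km_open kr) KO mK) => z Oz e e0.
have ee0 : 0 < e / expR m%:R by rewrite divr_gt0 // expR_gt0.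
have [d d0 sd] := km_loc kr Oz ee0; exists d => // u ud Ou.
have h1 := trunc_lip m (r u y) (r z y); have h2 := trunc_lip m (r z y) (r u y).
rewrite distrC in h2.
have h3 : `|r u y - r z y| < e / expR m%:R.
  rewrite (km_sym kr u) (km_sym kr z); apply: le_lt_trans (km_diff Oy Oz Ou) _.
  exact: sd.
rewrite ltr_pdivlMr ?expR_gt0 // mulrC in h3.
by rewrite ltr_norml; apply/andP; split; lra.
Qed.

Lemma measurable_kern y : O y ->
  measurable_fun (K : set B) (fun x : B => kern r x y).
Proof.
move=> Oy; apply: (measurable_realfun.emeasurable_fun_cvg
  (fun m (x : B) => (trunc m (r x y))%:E)) => [m|x Kx].
  exact: measurable_trunc.
exact: (trunc_cvg kr (KO Kx) Oy).
Qed.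

Let J m (y : C) : \bar R := (\int[mu]_(x in K) (trunc m (r x y))%:E)%E.

Lemma mu_le1 (A : set B) : measurable A -> (mu A <= 1)%E.
Proof. exact: probability_le1. Qed.

(** The triangle inequality bounds the change of [r x y] by the distance of [y]
    and [y'], uniformly in [x]. *)
Lemma J_lip m y y' : O y -> O y' -> (J m y <= J m y' + (expR m%:R * r y y')%:E)%E.
Proof.
move=> Oy Oy'; pose L := expR m%:R * r y y'.
have L0 : 0 <= L by rewrite mulr_ge0 ?expR_ge0 ?(km_ge0 kr).
have t0 z x : O z -> K x -> (0 <= (trunc m (r x z))%:E)%E.
  by move=> Oz Kx; rewrite lee_fin trunc_ge0 // (km_le1 kr) //; exact: KO.
apply: (@le_trans _ _ (\int[mu]_(x in K) ((trunc m (r x y'))%:E + (cst L%:E) x))%E).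
  apply: ge0_le_integral => //.
  - by move=> x; exact: t0.
  - exact: measurable_trunc.
  - by apply: emeasurable_funD; [exact: measurable_trunc|exact: measurable_cst].
  - move=> x Kx; rewrite -EFinD lee_fin; apply: le_trans (trunc_lip m _ (r x y')) _.
    rewrite lerD2l ler_wpM2l ?expR_ge0 //; apply: km_diff => //; exact: KO.
have cL0 (x : B) : K x -> (0 <= cst L%:E x)%E by rewrite lee_fin.
rewrite (ge0_integralD mu mK (fun x => t0 y' x Oy') (measurable_trunc m Oy') cL0
  (measurable_cst _)).
rewrite leeD2l // integral_cst // -[leRHS]mule1 lee_wpmul2l ?lee_fin //.
exact: mu_le1.
Qed.

Lemma J_fin m y : O y -> J m y \is a fin_num.
Proof.
move=> Oy; rewrite ge0_fin_numE; last first.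
  apply: integral_ge0 => x Kx; rewrite lee_fin trunc_ge0 // (km_le1 kr) //.
  exact: KO.
apply: (@le_lt_trans _ _ (\int[mu]_(x in K) (cst (m%:R)%:E) x)%E).
  apply: ge0_le_integral => //.
  - by move=> x Kx; rewrite lee_fin trunc_ge0 // (km_le1 kr) //; exact: KO.
  - exact: measurable_trunc.
  - move=> x Kx; rewrite lee_fin /trunc lerNl -[leLHS]expRK.
    by rewrite ler_ln ?posrE ?expR_gt0 ?trunc_arg_gt0 // le_max lexx orbT.
rewrite integral_cst //; apply: le_lt_trans (_ : (m%:R%:E * 1 < +oo)%E).
  by rewrite lee_wpmul2l ?lee_fin //; exact: mu_le1.
by rewrite mule1 ltry.
Qed.

Lemma measurable_J m : measurable_fun (K : set B) (J m : B -> \bar R).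
Proof.
apply: (eq_measurable_fun (fun y : B => (fine (J m y))%:E)).
  by move=> y /set_mem Ky /=; rewrite fineK // J_fin //; exact: KO.
apply/measurable_EFinP.
apply: (measurable_loc_cont (km_open kr) KO mK) => z Oz e e0.
have ee0 : 0 < e / expR m%:R by rewrite divr_gt0 // expR_gt0.
have [d d0 sd] := km_loc kr Oz ee0; exists d => // u ud Ou.
have h3 := sd u ud Ou; rewrite ltr_pdivlMr ?expR_gt0 // mulrC in h3.
have h1 := J_lip m Ou Oz; have h2 := J_lip m Oz Ou.
rewrite -(fineK (J_fin m Oz)) -(fineK (J_fin m Ou)) -EFinD lee_fin in h1.
rewrite -(fineK (J_fin m Oz)) -(fineK (J_fin m Ou)) -EFinD lee_fin in h2.
rewrite (km_sym kr z u) in h2.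
by rewrite ltr_norml /=; apply/andP; split; lra.
Qed.

Lemma J_cvg y : O y -> J m y @[m --> \oo] --> (\int[mu]_(x in K) kern r x y)%E.
Proof.
move=> Oy.
have h := @cvg_monotone_convergence _ _ _ mu _ mK
  (fun m (x : B) => (trunc m (r x y))%:E) (fun m => measurable_trunc m Oy).
have -> : (\int[mu]_(x in K) kern r x y)%E =
   (\int[mu]_(x in K) limn (fun m => (trunc m (r x y))%:E))%E.
  apply: eq_integral => x /set_mem Kx; apply/esym/cvg_lim => //.
  exact: (trunc_cvg kr (KO Kx) Oy).
apply: h => [m x Kx|x Kx m n mn].
  by rewrite lee_fin trunc_ge0 // (km_le1 kr) //; exact: KO.
by rewrite lee_fin; exact: trunc_mono.
Qed.

Lemma measurable_potential :
  measurable_fun (K : set B) (fun y : B => (\int[mu]_(x in K) kern r x y)%E).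
Proof.
apply: (measurable_realfun.emeasurable_fun_cvg (fun m (y : B) => J m y)) => [m|y Ky].
  exact: measurable_J.
by apply: J_cvg; exact: KO.
Qed.

Lemma potential_ge0 y : O y -> (0 <= \int[mu]_(x in K) kern r x y)%E.
Proof. by move=> Oy; apply: integral_ge0 => x Kx; apply: kern_ge0 => //; exact: KO. Qed.

End Kernel.

End Measure.

(** * Energies and their limits *)

Section Energy.
Variable R : realType.
Local Notation C := R[i].
Local Notation B := (borelC R).

Section Push.
Variables (mu : probability B R) (psi : B -> B).
Hypothesis mpsi : measurable_fun setT psi.
HB.instance Definition _ := isMeasurableFun.Build _ _ _ _ psi mpsi.

Lemma push_exists : exists nu : probability B R,
  (forall A, nu A = mu (psi @^-1` A)) /\
  forall (D : set B) (g : B -> \bar R), measurable D -> measurable_fun D g ->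
    (forall y, D y -> (0 <= g y)%E) ->
    (\int[nu]_(y in D) g y = \int[mu]_(x in psi @^-1` D) g (psi x))%E.
Proof.
exists (distribution mu psi); split=> // D g mD mg g0.
rewrite -[LHS]/(\int[pushforward mu psi]_(y in D) g y)%E.
rewrite ge0_integral_pushforward // => y /set_mem; exact: g0.
Qed.
End Push.

(** Holomorphic maps are only controlled on their domain; outside it they are
    replaced by a constant before measures are pushed forward. *)
Lemma measurable_patch (O : set C) (f : C -> C) (c : C) : open O ->
  (forall z, O z -> {for z, continuous f}) ->
  measurable_fun setT ((fun z => if z \in O then f z else c) : B -> B).
Proof.
move=> oO cf; have gen : @measurable _ B = <<s @open C >> by [].
apply: (measurability _ gen) => // _ [U oU <-].
rewrite setTI.
have oV : open (O `&` f @^-1` U).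
  apply/openCE => z [Oz Uz]; have [r1 r10 s1] := openCP oO Oz.
  have [r2 r20 s2] := openCP oU Uz.
  have [d d0 sd] := (continuousCC f z).1 (cf z Oz) r2 r20.
  exists (Num.min r1 d); first by rewrite lt_min r10.
  move=> u; rewrite cballE lt_min => /andP[u1 u2].
  by split; [exact: s1|apply: s2; exact: sd].
have [Uc|nUc] := pselect (U c).
  have -> : (fun z => if z \in O then f z else c) @^-1` U = (O `&` f @^-1` U) `|` ~` O.
    apply/seteqP; split => z /=.
      by case: ifPn => [/set_mem Oz Uz|/negP nO Ucc]; [left|right => Oz; apply: nO; exact: mem_set].
    by case=> [[/mem_set -> //]|nO]; case: ifPn => // /set_mem.
  by apply: measurableU; [exact: open_borel|apply: measurableC; exact: open_borel].
have -> : (fun z => if z \in O then f z else c) @^-1` U = O `&` f @^-1` U.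
  apply/seteqP; split => z /=; last by case=> /mem_set ->.
  by case: ifPn => [/set_mem Oz Uz|_ /nUc].
exact: open_borel.
Qed.

Lemma energy_push (mu : probability B R) (psi : C -> C) (E E' O : set C)
    (r : C -> C -> R) : kmetric O r -> E' `<=` O -> compact E' -> compact E ->
  measurable_fun setT (psi : B -> B) -> (forall z, E z -> E' (psi z)) ->
  mu (~` E) = 0%E -> exists2 nu : probability B R, supported_in E' nu &
    energy E' (kern r) nu =
      (\int[mu]_(y in E) \int[mu]_(x in E) kern r (psi x) (psi y))%E.
Proof.
move=> kr E'O cE' cE mpsi EE' mu0; have [nu [nuE nuI]] := push_exists mu mpsi.
have mE := compact_borel cE; have mE' := compact_borel cE'.
have mC : measurable (~` E : set B) by exact: measurableC.
have mP : measurable (psi @^-1` E' : set B) by rewrite -[X in measurable X]setTI; exact: mpsi.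
exists nu.
  rewrite /supported_in /= nuE; apply/eqP; rewrite eq_le measure_ge0 andbT -mu0.
  apply: le_measure; rewrite ?inE //.
    rewrite preimage_setC; exact: measurableC.
  by move=> z /= nz Ez; apply: nz; exact: EE'.
have key (g : B -> \bar R) : measurable_fun (E' : set B) g ->
    (forall y, E' y -> (0 <= g y)%E) ->
    (\int[nu]_(y in E') g y = \int[mu]_(x in E) g (psi x))%E.
  move=> mg g0; rewrite nuI //.
  have m1 : measurable_fun (psi @^-1` E' : set B) (g \o psi : B -> \bar R).
    apply: (@measurable_comp _ _ _ B B _ E' g (psi @^-1` E') psi) => //.
      by move=> _ [z Ez <-].
    exact: measurable_funTS.
  have g1 (x : B) : (psi @^-1` E') x -> (0 <= (g \o psi) x)%E by exact: g0.
  rewrite (ge0_negligible_integral mC mP m1 g1 mu0).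
  congr (integral _ _ _); apply/seteqP; split => z /=.
    by case=> _; apply: contrapT.
  by move=> Ez; split; [exact: EE'|exact].
rewrite /energy key; last 2 first.
- exact: (measurable_potential kr E'O cE' nu).
- by move=> y E'y; apply: (potential_ge0 kr E'O); exact: E'O.
apply: eq_integral => y /set_mem Ey; rewrite key //.
- by apply: (measurable_kern kr E'O cE'); apply: E'O; exact: EE'.
- by move=> x E'x; apply: (kern_ge0 kr); apply: E'O => //; exact: EE'.
Qed.

Lemma eq_energy (E : set C) k k' (mu : probability B R) :
  (forall x y, E x -> E y -> k x y = k' x y) -> energy E k mu = energy E k' mu.
Proof.
move=> kk; apply: eq_integral => y /set_mem Ey.
by apply: eq_integral => x /set_mem Ex; exact: kk.
Qed.

Lemma energy_mono (E O : set C) r r' (mu : probability B R) : kmetric O r ->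
  kmetric O r' -> E `<=` O -> compact E ->
  (forall x y, E x -> E y -> r' x y <= r x y) ->
  (energy E (kern r) mu <= energy E (kern r') mu)%E.
Proof.
move=> kr kr' EO cE rr'; have mE := compact_borel cE.
have kk x y : E x -> E y -> (kern r x y <= kern r' x y)%E.
  move=> Ex Ey; rewrite /kern; case: eqVneq => // xy; rewrite lee_fin lerN2.
  by rewrite ler_ln ?rr' // posrE ?(km_gt0 kr) ?(km_gt0 kr') //; exact: EO.
apply: ge0_le_integral => //.
- by move=> y Ey; apply: (potential_ge0 kr EO); exact: EO.
- exact: (measurable_potential kr EO cE mu).
- exact: (measurable_potential kr' EO cE mu).
- move=> y Ey; apply: ge0_le_integral => //.
  + by move=> x Ex; apply: (kern_ge0 kr); exact: EO.
  + by apply: (measurable_kern kr EO cE); exact: EO.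
  + by apply: (measurable_kern kr' EO cE); exact: EO.
  + by move=> x Ex; exact: kk.
Qed.

(** The approximating kernels exceed the limit by at most a constant, so each
    integral of the double integral converges by dominated convergence at every
    point of finite potential. *)
Lemma energy_cvg (E O : set C) (r : C -> C -> R) (rn : nat -> C -> C -> R)
    (L : R) (mu : probability B R) : kmetric O r -> (forall n, kmetric O (rn n)) ->
  E `<=` O -> compact E -> 0 <= L ->
  (forall n x y, E x -> E y -> rn 0%N x y <= rn n x y) ->
  (forall x y, E x -> E y -> x != y -> - ln (rn 0%N x y) <= - ln (r x y) + L) ->
  (forall x y, E x -> E y -> rn n x y @[n --> \oo] --> r x y) ->
  (energy E (kern r) mu < +oo)%E ->
  energy E (kern (rn n)) mu @[n --> \oo] --> energy E (kern r) mu.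
Proof.
move=> kr krn EO cE L0 mono bnd cvg fin.
have mE := compact_borel cE.
pose A n (y : B) := (\int[mu]_(x in E) kern (rn n) x y)%E.
pose A' (y : B) := (\int[mu]_(x in E) kern r x y)%E.
have mA n : measurable_fun (E : set B) (A n).
  exact: (measurable_potential (krn n) EO cE mu).
have mA' : measurable_fun (E : set B) A' by exact: (measurable_potential kr EO cE mu).
have A0 n y : E y -> (0 <= A n y)%E.
  by move=> Ey; apply: (potential_ge0 (krn n) EO); exact: EO.
have A'0 y : E y -> (0 <= A' y)%E.
  by move=> Ey; apply: (potential_ge0 kr EO); exact: EO.
have mk n y : E y -> measurable_fun (E : set B) (fun x : B => kern (rn n) x y).
  by move=> Ey; apply: (measurable_kern (krn n) EO cE); exact: EO.
have mk' y : E y -> measurable_fun (E : set B) (fun x : B => kern r x y).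
  by move=> Ey; apply: (measurable_kern kr EO cE); exact: EO.
have k0 n x y : E x -> E y -> (0 <= kern (rn n) x y)%E.
  by move=> Ex Ey; apply: (kern_ge0 (krn n)); exact: EO.
have k'0 x y : E x -> E y -> (0 <= kern r x y)%E.
  by move=> Ex Ey; apply: (kern_ge0 kr); exact: EO.
have kmono n x y : E x -> E y -> (kern (rn n) x y <= kern (rn 0%N) x y)%E.
  move=> Ex Ey; rewrite /kern; case: eqVneq => // xy; rewrite lee_fin lerN2.
  by rewrite ler_ln ?mono // posrE (km_gt0 (krn _)) //; exact: EO.
have AL y : E y -> (A 0%N y <= A' y + L%:E)%E.
  move=> Ey; apply: (@le_trans _ _ (\int[mu]_(x in E) (kern r x y + cst L%:E x))%E).
    apply: ge0_le_integral => //.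
    - by move=> x Ex; exact: k0.
    - exact: mk.
    - by apply: emeasurable_funD; [exact: mk'|exact: measurable_cst].
    - move=> x Ex; rewrite /kern; case: eqVneq => [_|xy]; first by rewrite addye.
      by rewrite -EFinD lee_fin; exact: bnd.
  have cL0 (x : B) : E x -> (0 <= cst L%:E x)%E by rewrite lee_fin.
  rewrite (ge0_integralD mu mE (fun x Ex => k'0 x y Ex Ey) (mk' y Ey) cL0
    (measurable_cst _)).
  rewrite leeD2l // integral_cst // -[leRHS]mule1 lee_wpmul2l ?lee_fin //.
  exact: probability_le1.
have Amono n y : E y -> (A n y <= A 0%N y)%E.
  move=> Ey; apply: ge0_le_integral => //.
  - by move=> x Ex; exact: k0.
  - exact: mk.
  - exact: mk.
  - by move=> x Ex; exact: kmono.
have kcvg x y : E x -> E y -> kern (rn n) x y @[n --> \oo] --> kern r x y.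
  move=> Ex Ey; rewrite /kern; case: eqVneq => [_|xy]; first exact: cvg_cst.
  apply: cvg_EFin; first by apply: nearW.
  apply: cvgN; apply: continuous_cvg; last exact: cvg.
  by apply: continuous_ln; apply: (km_gt0 kr) => //; exact: EO.
have Acvg y : E y -> A' y \is a fin_num -> A n y @[n --> \oo] --> A' y.
  move=> Ey fy.
  have ik : mu.-integrable (E : set B) (fun x : B => kern (rn 0%N) x y).
    apply/integrableP; split; first exact: mk.
    rewrite (eq_integral (fun x : B => kern (rn 0%N) x y)); last first.
      by move=> x /set_mem Ex; rewrite gee0_abs //; exact: k0.
    apply: le_lt_trans (AL y Ey) _.
    by rewrite -(fineK fy) -EFinD ltry.
  have [] := @dominated_convergence _ B R mu _ mE (fun n (x : B) => kern (rn n) x y)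
    (fun x : B => kern r x y) (fun x : B => kern (rn 0%N) x y)
    (fun n => mk n y Ey) (mk' y Ey) _ ik _.
  - by apply: aeW => x Ex; exact: kcvg.
  - by apply: aeW => x n Ex; rewrite gee0_abs ?kmono //; exact: k0.
  - by [].
have iA' : mu.-integrable (E : set B) A'.
  apply/integrableP; split => //.
  rewrite (eq_integral A') //; move=> x /set_mem Ex; rewrite gee0_abs //.
  exact: A'0.
have iA0 : mu.-integrable (E : set B) (A 0%N).
  apply/integrableP; split; first exact: mA.
  rewrite (eq_integral (A 0%N)); last first.
    by move=> x /set_mem Ex; rewrite gee0_abs //; exact: A0.
  apply: (@le_lt_trans _ _ (\int[mu]_(x in E) (A' x + cst L%:E x))%E).
    apply: ge0_le_integral => //.
    - by move=> x Ex; exact: A0.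
    - by apply: emeasurable_funD => //; exact: measurable_cst.
  have cL0 (x : B) : E x -> (0 <= cst L%:E x)%E by rewrite lee_fin.
  rewrite (ge0_integralD mu mE A'0 mA' cL0 (measurable_cst _)) integral_cst //.
  apply: lte_add_pinfty; first exact: fin.
  apply: (@le_lt_trans _ _ (L%:E * 1)%E); last by rewrite mule1 ltry.
  by rewrite lee_wpmul2l ?lee_fin //; exact: probability_le1.
have [] := @dominated_convergence _ B R mu _ mE A A' (A 0%N) mA mA' _ iA0 _.
- have := integrable_ae mE iA'; apply: filterS => y fy Ey; apply: Acvg => //.
  exact: fy.
- by apply: aeW => y n Ey; rewrite gee0_abs ?Amono //; exact: A0.
- by [].
Qed.

End Energy.

(** * Condenser capacities in a petal *)

Section Condenser.
Variable R : realType.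
Local Notation C := R[i].
Local Notation B := (borelC R).

Lemma compact_radius (K U : set C) : compact K -> open U -> K `<=` U ->
  exists2 r : R, 0 < r & forall x, K x -> cball x r `<=` U.
Proof.
move=> cK oU KU.
have loc (x : C) : K x -> exists2 m : R, 0 < m & forall (y : C) (r : R),
    cmod (y - x) < m -> r < m -> cball y r `<=` U.
  move=> Kx; have [r r0 sub] := openCP oU (KU x Kx).
  exists (r / 2); first by rewrite divr_gt0.
  move=> y s yx sr u; rewrite cballE => uy; apply: sub; rewrite cballE.
  by have := cmod_tri y u x; lra.
have : \forall r \near (0 : R)^'+, K `<=` [set x | cball x r `<=` U].
  have /compact_near_coveringP := cK; apply => x /loc [m m0 mP].
  exists (cball x m, [set r : R | r < m]).
    split; first by apply/nbhsC; exists m.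
    exact: nbhs_right_lt.
  by move=> [y r] /= [yx rm]; exact: mP.
move=> near; have [r [r0 rP]] := filter_ex (filterI (@nbhs_right_gt R 0) near).
by exists r.
Qed.

Lemma kmetric_disk : kmetric (@disk R) (@rho R).
Proof.
split.
- exact: disk_open.
- by move=> x y _ _; exact: rho_ge0.
- by move=> x y hx hy; apply/ltW/rho_lt1.
- by move=> x _; exact: rhoxx.
- move=> x y hx hy xy; apply: lt_le_trans (half_le_rho hx hy).
  by rewrite divr_gt0 // cmod_gt0 subr_eq0.
- exact: rhoC.
- by move=> x y z; exact: rho_triangle.
- move=> x hx e e0; have x1 : 0 < 1 - cmod x by rewrite subr_gt0.
  exists (e * (1 - cmod x)); first by rewrite mulr_gt0.
  move=> u ux hu; have d0 := den_lower hu hx.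
  rewrite /rho /mob cmod_div ltr_pdivrMr ?cmod_gt0 ?mob_den //.
  by apply: lt_le_trans ux _; rewrite ler_wpM2l // ltW.
Qed.

Variables (phi : R -> C -> C) (tau : C) (Delta K : set C).
Hypothesis hphi : semigroup phi.
Hypothesis hDelta : petal phi tau Delta.
Hypothesis cK : compact K.
Hypothesis KD : K `<=` Delta.

Local Notation f := (back phi Delta).
Local Notation rt := (rho_back f).
Local Notation ro := (rho_lim f).

Let oD : open Delta := petal_open hDelta.
Let Dd : Delta `<=` @disk R := petal_disk hphi hDelta.
Let fD (t : R) z : 0 <= t -> Delta z -> disk (f t z).
Proof. by move=> _ Dz; apply: Dd; exact: (back_in hDelta). Qed.
Let fhol (t : R) : 0 <= t -> hol Delta (f t).
Proof. by move=> _; exact: (back_hol hDelta). Qed.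
Let f0 z : Delta z -> f 0 z = z := back0 hphi hDelta (z := z).

Lemma petal_rho_back_mono (s t : R) x y : 0 <= s -> s <= t -> Delta x -> Delta y ->
  rt s x y <= rt t x y.
Proof.
move=> s0 st Dx Dy; apply: (rho_back_mono fD (phi_hol hphi) _ (back_phi hDelta)) => //.
by move=> u z; exact: (phi_disk hphi).
Qed.

Lemma kmetric_rho_lim : kmetric Delta ro.
Proof.
split.
- exact: oD.
- by move=> x y; exact: (rho_lim_ge0 fD).
- by move=> x y; exact: (rho_lim_le1 fD).
- move=> x Dx; apply/eqP; rewrite eq_le (rho_lim_ge0 fD) // andbT.
  by apply: rho_lim_le => t _; rewrite /rho_back rhoxx.
- move=> x y Dx Dy xy; apply: lt_le_trans (half_le_rho_lim Dd fD f0 Dx Dy).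
  by rewrite divr_gt0 // cmod_gt0 subr_eq0.
- exact: rho_limC.
- by move=> x y z; exact: (rho_lim_triangle fD).
- move=> x Dx e e0; have [r r0 sub] := openCP oD Dx.
  exists (Num.min r (e * r)); first by rewrite lt_min r0 mulr_gt0.
  move=> u; rewrite lt_min => /andP[ur ue] Du.
  have := rho_lim_local fhol fD r0 sub ur.
  by rewrite -(@ltr_pM2r _ r) //; lra.
Qed.

Lemma kmetric_rho_back t : 0 <= t -> kmetric Delta (rt t).
Proof.
move=> t0; split.
- exact: oD.
- by move=> x y _ _; exact: rho_ge0.
- by move=> x y Dx Dy; apply/ltW/rho_lt1; exact: fD.
- by move=> x _; exact: rhoxx.
- move=> x y Dx Dy xy; apply: lt_le_trans (petal_rho_back_mono (lexx 0) t0 Dx Dy).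
  rewrite /rho_back !f0 //; apply: (km_gt0 kmetric_disk) => //; exact: Dd.
- by move=> x y; exact: rhoC.
- by move=> x y z Dx Dy Dz; apply: rho_triangle; exact: fD.
- move=> x Dx e e0; have [d d0 sd] := km_loc kmetric_rho_lim Dx e0.
  exists d => // u ud Du; apply: le_lt_trans (sd u ud Du).
  exact: (rho_back_le_rho_lim fD).
Qed.

Lemma back_phiD (s t : R) z : 0 <= t -> Delta z -> f (s + t) (phi t z) = f s z.
Proof.
move=> t0 Dz; have [_ _ [_ [_ h]] _ _] := hDelta.
have := h (- (s + t)) t z Dz; rewrite {3}/flow t0 -/(back phi Delta (s + t) _) => <-.
by rewrite /back; congr flow; ring.
Qed.

(** Applying [phi t] to both points only shifts the time parameter by [t]. *)
Lemma rho_lim_phi (t : R) x y : 0 <= t -> Delta x -> Delta y ->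
  ro (phi t x) (phi t y) = ro x y.
Proof.
move=> t0 Dx Dy.
have px : Delta (phi t x) by exact: (phi_in hDelta).
have py : Delta (phi t y) by exact: (phi_in hDelta).
have shift s : rt (s + t) (phi t x) (phi t y) = rt s x y.
  by rewrite /rho_back !back_phiD.
apply/eqP; rewrite eq_le; apply/andP; split; apply: rho_lim_le => s s0.
  apply: (@le_trans _ _ (rt (s + t) (phi t x) (phi t y))).
    by apply: petal_rho_back_mono => //; rewrite lerDl.
  by rewrite shift (rho_back_le_rho_lim fD).
by rewrite -shift (rho_back_le_rho_lim fD) // addr_ge0.
Qed.

Lemma green_energy_petal (mu : probability B R) :
  energy K (green Delta) mu = energy K (kern ro) mu.
Proof.
apply: eq_energy => x y Kx Ky; rewrite /kern; case: eqVneq => [->|xy].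
  by rewrite /green eqxx.
apply: (green_petal (phi := phi) oD (petal_connected hDelta) Dd fhol fD
  (phi_hol hphi) _ (back_phi hDelta) f0 (petal_boundary hDelta)) => //.
- by move=> t z; exact: (phi_disk hphi).
- exact: KD.
- exact: KD.
Qed.

Lemma green_energy_disk (E : set C) (mu : probability B R) : E `<=` @disk R ->
  energy E (green (@disk R)) mu = energy E (kern (@rho R)) mu.
Proof.
move=> Ed; apply: eq_energy => x y Ex Ey; rewrite /kern; case: eqVneq => [->|xy].
  by rewrite /green eqxx.
by rewrite green_disk //; exact: Ed.
Qed.

Let Kt (t : R) := f t @` K.

Lemma Kt_sub t : Kt t `<=` Delta.
Proof. by move=> _ [z Kz <-]; apply: (back_in hDelta); exact: KD. Qed.

Lemma Kt_compact t : compact (Kt t).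
Proof.
apply: continuous_compact cK; apply: continuous_in_subspaceT => z /set_mem Kz.
exact: (hol_cont (back_hol hDelta t) (KD Kz)).
Qed.

Let V (t : R) := green_energy (@disk R) (Kt t).
Let V_oo := green_energy Delta K.

(** A measure on [phi_{-t}(K)] moves to [K] under [phi t].  The limit kernel is
    invariant under [phi t], and it is smaller than the kernel of the disk. *)
Lemma capacity_lower (t : R) : 0 <= t -> (V_oo <= V t)%E.
Proof.
move=> t0; apply: le_ereal_inf_tmp => _ [mu smu <-].
have KtD : Kt t `<=` @disk R by move=> z /Kt_sub; exact: Dd.
rewrite green_energy_disk //.
pose psi (z : C) := if z \in @disk R then phi t z else 0.
have mpsi : measurable_fun setT (psi : B -> B).
  apply: measurable_patch; first exact: disk_open.
  by move=> z; exact: (hol_cont (phi_hol hphi t0)).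
have psiE z : Kt t z -> psi z = phi t z by move=> /KtD zd; rewrite /psi mem_set.
have psiK z : Kt t z -> K (psi z).
  move=> zt; rewrite psiE //; have [u Ku <-] := zt.
  by rewrite (phi_back hphi hDelta) //; exact: KD.
have [nu snu nuE] := energy_push kmetric_rho_lim KD cK (Kt_compact (t := t)) mpsi psiK smu.
apply: (@le_trans _ _ (energy K (kern ro) nu)).
  by rewrite -green_energy_petal; apply: ereal_inf_lbound; exists nu.
rewrite nuE.
apply: (@le_trans _ _ (energy (Kt t) (kern ro) mu)).
  rewrite le_eqVlt; apply/orP; left; apply/eqP.
  apply: eq_energy => x y xt yt; rewrite !psiE // /kern.
  have [Dx Dy] := (Kt_sub xt, Kt_sub yt).
  rewrite rho_lim_phi //; congr (if _ then _ else _); apply/eqP/eqP => [E|-> //].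
  by rewrite -(back_phiK hphi hDelta t0 Dx) E (back_phiK hphi hDelta t0 Dy).
rewrite (@eq_energy _ _ (kern (@rho R)) (kern (rt 0))); last first.
  by move=> x y /Kt_sub Dx /Kt_sub Dy; rewrite /kern /rho_back !f0.
apply: (energy_mono _ kmetric_rho_lim (kmetric_rho_back (lexx 0)) (Kt_sub (t := t))).
  exact: Kt_compact.
by move=> x y /Kt_sub Dx /Kt_sub Dy; exact: (rho_back_le_rho_lim fD).
Qed.

(** Moving a measure on [K] to [phi_{-t}(K)] turns the kernel of the disk into
    that of [rho_back]. *)
Lemma capacity_upper (t : R) (nu : probability B R) : 0 <= t ->
  supported_in K nu -> (V t <= energy K (kern (rt t)) nu)%E.
Proof.
move=> t0 snu.
pose psi (z : C) := if z \in Delta then f t z else 0.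
have mpsi : measurable_fun setT (psi : B -> B).
  by apply: measurable_patch oD _ => z; exact: (hol_cont (back_hol hDelta t)).
have psiE z : K z -> psi z = f t z by move=> /KD Dz; rewrite /psi mem_set.
have psiK z : K z -> Kt t (psi z) by move=> Kz; rewrite psiE //; exists z.
have KtD : Kt t `<=` @disk R by move=> z /Kt_sub; exact: Dd.
have [mu smu muE] := energy_push kmetric_disk KtD (Kt_compact (t := t)) cK mpsi psiK snu.
apply: (@le_trans _ _ (energy (Kt t) (kern (@rho R)) mu)).
  by rewrite -green_energy_disk //; apply: ereal_inf_lbound; exists mu.
rewrite muE le_eqVlt; apply/orP; left; apply/eqP.
apply: eq_energy => x y Kx Ky; rewrite !psiE // /kern.
have [Dx Dy] := (KD Kx, KD Ky).
congr (if _ then _ else _); apply/eqP/eqP => [E|-> //].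
by rewrite -(phi_back hphi hDelta t0 Dx) E (phi_back hphi hDelta t0 Dy).
Qed.

Lemma rho_back_cvg x y : Delta x -> Delta y -> rt n%:R x y @[n --> \oo] --> ro x y.
Proof.
move=> Dx Dy; apply/cvgrPdist_lt => e e0.
have [|t t0 tP] := rho_lim_approx fD (phi_hol hphi) _ (back_phi hDelta) Dx Dy e0.
  by move=> t z; exact: (phi_disk hphi).
near=> n.
have tn : t <= n%:R by near: n; exact: nbhs_infty_ger.
have := tP _ tn; have := rho_back_le_rho_lim fD (ler0n R n) Dx Dy.
by move=> h1 h2; rewrite ger0_norm; lra.
Unshelve. all: by end_near. Qed.

(** On [K] the distance [rho] is at least [|x - y| / 2] and the limit distance is
    at most [|x - y| / r], where [r] is a radius of disks about the points of [K]
    that stay in [Delta]; so the kernels differ by at most [|log (r / 2)|]. *)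
Lemma capacity_approx (nu : probability B R) (e : R) : supported_in K nu ->
  (energy K (kern ro) nu < +oo)%E -> 0 < e -> exists2 T : R, 0 <= T &
    forall t, T <= t -> (V t <= energy K (kern ro) nu + e%:E)%E.
Proof.
move=> snu fin e0.
have [r r0 rP] := compact_radius cK oD KD.
pose L := `|ln (r / 2)|.
have bnd x y : K x -> K y -> x != y -> - ln (rt 0 x y) <= - ln (ro x y) + L.
  move=> Kx Ky xy; have [Dx Dy] := (KD Kx, KD Ky).
  have p1 := km_gt0 kmetric_rho_lim Dx Dy xy.
  have h1 : ro x y * r <= cmod (x - y).
    have [xr|xr] := ltP (cmod (x - y)) r.
      by apply: (rho_lim_local fhol fD) => //; exact: rP.
    by apply: le_trans xr; rewrite ler_piMl ?(ltW r0) // (rho_lim_le1 fD).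
  have h2 : cmod (x - y) / 2 <= rt 0 x y.
    by rewrite /rho_back !f0 //; apply: half_le_rho; exact: Dd.
  have h3 : ro x y * (r / 2) <= rt 0 x y by lra.
  have r20 : 0 < r / 2 by rewrite divr_gt0.
  have : ln (ro x y * (r / 2)) <= ln (rt 0 x y).
    by rewrite ler_ln ?posrE ?mulr_gt0 //; apply: lt_le_trans h3; rewrite mulr_gt0.
  rewrite lnM ?posrE // => h4.
  have := ler_norm (- ln (r / 2)); rewrite normrN -/L; lra.
have krn n : kmetric Delta (rt n%:R) by apply: kmetric_rho_back.
have cvg := @energy_cvg R K Delta ro (fun n => rt n%:R) L nu kmetric_rho_lim krn KD cK
  (normr_ge0 _) _ bnd _ fin.
have {}cvg : energy K (kern (rt n%:R)) nu @[n --> \oo] --> energy K (kern ro) nu.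
  apply: cvg => [n x y Kx Ky|x y Kx Ky].
    by apply: petal_rho_back_mono => //; exact: KD.
  by apply: rho_back_cvg; exact: KD.
have E0 : (0 <= energy K (kern ro) nu)%E.
  apply: integral_ge0 => y Ky; apply: (potential_ge0 kmetric_rho_lim KD); exact: KD.
have Ef : energy K (kern ro) nu \is a fin_num by rewrite ge0_fin_numE.
have [n nP] : exists n : nat,
    (energy K (kern (rt n%:R)) nu < energy K (kern ro) nu + e%:E)%E.
  have h : \forall n \near \oo,
      (energy K (kern (rt n%:R)) nu < energy K (kern ro) nu + e%:E)%E.
    apply: (cvg [set z | (z < energy K (kern ro) nu + e%:E)%E]).
    apply: open_nbhs_nbhs; split; first exact: open_ereal_lt_ereal.
    by rewrite /= lteDl // lte_fin.
  exact: filter_ex h.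
exists n%:R => // t nt; have t0 : 0 <= t by exact: le_trans nt.
apply: le_trans (capacity_upper t0 snu) _; apply: le_trans (ltW nP).
apply: (energy_mono _ (kmetric_rho_back t0) (krn n) KD cK) => x y Kx Ky.
by apply: petal_rho_back_mono => //; exact: KD.
Qed.

(** The limit distance to a fixed point of [K] has a maximum below [1] on [K], and
    [rho_lim_gap] turns this into a bound for pairs of points. *)
Lemma energy_pos : exists2 c : R, 0 < c & (c%:E <= V_oo)%E.
Proof.
have [K0|nK] := pselect (K !=set0); last first.
  exists 1 => //; apply: le_ereal_inf_tmp => _ [mu smu <-].
  have KE : K = set0 by apply/seteqP; split => // z Kz; apply: nK; exists z.
  have := smu; rewrite /supported_in /= KE setC0 probability_setT => /eqP.
  by rewrite eqe oner_eq0.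
have [y0 Ky0] := K0; have Dy0 := KD Ky0.
have cro z : K z -> {for z, continuous (fun x => ro x y0)}.
  move=> /KD Dz; apply/continuousCR => e e0.
  have [d d0 sd] := km_loc kmetric_rho_lim Dz e0.
  have [r r0 sub] := openCP oD Dz.
  exists (Num.min d r); first by rewrite lt_min d0.
  move=> u; rewrite lt_min => /andP[ud /sub Du].
  rewrite (rho_limC f u) (rho_limC f z).
  exact: le_lt_trans (km_diff kmetric_rho_lim Dy0 Dz Du) (sd u ud Du).
have [z Kz mx] := EVT_maxC cK K0 cro.
pose m := ro z y0.
have m1 : m < 1 by apply: (rho_lim_lt1 oD (petal_connected hDelta) fhol fD) => //; exact: KD.
have m0 : 0 <= m by apply: (rho_lim_ge0 fD) => //; exact: KD.
have gap x y : K x -> K y -> ro x y <= 1 - (1 - m) ^+ 2 / 2.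
  move=> Kx Ky; have := rho_lim_gap fD (KD Kx) Dy0 (KD Ky).
  have h1 := mx x Kx; have h2 := mx y Ky; rewrite (rho_limC f y) in h2.
  have : (1 - m) * (1 - m) <= (1 - ro x y0) * (1 - ro y0 y).
    by rewrite ler_pM ?subr_ge0 ?(ltW m1) // lerB.
  rewrite -expr2; lra.
pose q := 1 - (1 - m) ^+ 2 / 2.
have q1 : q < 1 by rewrite /q gtrBl divr_gt0 // exprn_gt0 // subr_gt0.
have q0 : 0 < q.
  have : (1 - m) ^+ 2 <= 1 by rewrite expr_le1 ?subr_ge0 ?(ltW m1) // gerBl.
  by rewrite /q; lra.
exists (- ln q); first by rewrite oppr_gt0; apply: ln_lt0; apply/andP.
apply: le_ereal_inf_tmp => _ [mu smu <-]; rewrite green_energy_petal.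
have mK := compact_borel cK.
have muK : mu K = 1%E.
  have s0 : mu (~` K) = 0%E := smu.
  by have := probability_setC mu (measurableC mK); rewrite setCK s0 sube0.
have c0 : 0 <= - ln q by rewrite oppr_ge0 ln_le0 // ltW.
have kc x y : K x -> K y -> ((- ln q)%:E <= kern ro x y)%E.
  move=> Kx Ky; rewrite /kern; case: eqVneq => [_|xy]; first exact: leey.
  rewrite lee_fin lerN2 ler_ln ?gap // posrE //.
  by apply: (km_gt0 kmetric_rho_lim) => //; exact: KD.
have pc y : K y -> ((- ln q)%:E <= \int[mu]_(x in K) kern ro x y)%E.
  move=> Ky; rewrite -[leLHS]mule1 -[X in (_ * X)%E]muK -integral_cst //.
  apply: ge0_le_integral => //.
  - by apply: (measurable_kern kmetric_rho_lim KD cK); exact: KD.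
  - by move=> x Kx; exact: kc.
rewrite -[leLHS]mule1 -[X in (_ * X)%E]muK -integral_cst //.
apply: ge0_le_integral => //.
- exact: (measurable_potential kmetric_rho_lim KD cK mu).
Qed.

Lemma capacity_limit :
  condenser_capacity (@disk R) (flow phi Delta t @` K) @[t --> -oo%R] -->
    condenser_capacity Delta K.
Proof.
have flowE t : flow phi Delta t @` K = Kt (- t).
  by rewrite /Kt /back opprK.
rewrite /condenser_capacity.
have -> : (fun t => ((2 * pi)%:E / green_energy (@disk R) (flow phi Delta t @` K))%E) =
    (fun t => ((2 * pi)%:E / V (- t))%E) by apply/funext => t; rewrite flowE.
rewrite -/V_oo.
have [c c0 cV] := energy_pos.
have low t : t <= 0 -> (V_oo <= V (- t))%E.
  by move=> t0; apply: capacity_lower; rewrite oppr_ge0.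
case VE : V_oo => [v| |]; last by move: cV; rewrite VE.
- have v0 : 0 < v by move: cV; rewrite VE lee_fin; apply: lt_le_trans.
  have approx (e : R) : 0 < e -> \forall t \near -oo%R,
      exists2 w : R, V (- t) = w%:E & v <= w <= v + e.
    move=> e0; have e20 : 0 < e / 2 by rewrite divr_gt0.
    have Vf : V_oo \is a fin_num by rewrite VE.
    have [_ [mu smu <-] muV] := lb_ereal_inf_adherent e20 Vf.
    have {}muV : (energy K (green Delta) mu < V_oo + (e / 2)%:E)%E := muV.
    rewrite green_energy_petal VE -EFinD in muV.
    have fin : (energy K (kern ro) mu < +oo)%E by exact: lt_trans muV (ltry _).
    have [T T0 TP] := capacity_approx smu fin e20.
    near=> t.
    have tT : t <= - T by near: t; exact: nbhs_ninfty_le (num_real _).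
    have t0 : t <= 0 by lra.
    have h1 := low t t0; rewrite VE in h1.
    have h2 : (V (- t) <= (v + e)%:E)%E.
      apply: le_trans (TP (- t) _) _; first by lra.
      have -> : v + e = (v + e / 2) + e / 2 by lra.
      by rewrite EFinD leeD2r // ltW.
    case: (V (- t)) h1 h2 => [w| |] // h1 h2; exists w => //.
    by move: h1 h2; rewrite !lee_fin => -> ->.
  have -> : ((2 * pi)%:E / v%:E)%E = (2 * pi / v)%:E.
    by rewrite inver gt_eqF.
  apply: (@cvg_trans _ ((fun t => ((2 * pi) / fine (V (- t)))%:E) @ -oo%R)).
    apply: near_eq_cvg; near=> t.
    have [w -> /andP[vw _]] : exists2 w : R, V (- t) = w%:E & v <= w <= v + 1.
      by near: t; exact: approx.
    by rewrite /= inver gt_eqF // (lt_le_trans v0).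
  apply: cvg_EFin; first by apply: nearW.
  apply: cvgMr; apply: cvgV; first by rewrite gt_eqF.
  apply/cvgrPdist_le => e e0; near=> t.
  have [w -> /andP[vw we]] : exists2 w : R, V (- t) = w%:E & v <= w <= v + e.
    by near: t; exact: approx.
  by rewrite /= distrC ger0_norm; lra.
- apply: cvg_near_cst; near=> t.
  have t0 : t <= 0 by near: t; exact: nbhs_ninfty_le (num_real _).
  by have := low t t0; rewrite VE leye_eq => /eqP ->.
Unshelve. all: by end_near. Qed.

End Condenser.

Theorem theorem1p6 (R : realType) (phi : R -> R[i] -> R[i]) (tau : R[i])
    (Delta K : set R[i])
    (hphi : semigroup phi) (htau : non_elliptic phi tau)
    (hDelta : petal phi tau Delta)
    (hK : compact K) (hKDelta : K `<=` Delta) (hKpolar : ~ polar K) :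
  condenser_capacity (@disk R) (flow phi Delta t @` K) @[t --> -oo%R] -->
    condenser_capacity Delta K.
Proof. exact: (capacity_limit hphi hDelta hK hKDelta). Qed.
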